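(* Let $f\in L_2(\Omega)$ be given. Consider the primal hybrid formulation: find $u\in H^2(\mathcal T)$ and $\boldsymbol\eta\in H^{-3/2,-1/2}(\mathcal S)$ such that \[ (\mathcal C D^2u,D^2\delta u)_{\mathcal T}+\langle\boldsymbol\eta,\delta u\rangle_{\mathcal S}=(f,\delta u),\qquad \langle\boldsymbol{\delta\eta},u\rangle_{\mathcal S}=0 \] holds for any $\delta u\in H^2(\mathcal T)$ and $\boldsymbol{\delta\eta}\in H^{-3/2,-1/2}(\mathcal S)$. This problem is well posed (it has exactly one solution, depending continuously on $f$). Its solution $(u,\boldsymbol\eta)$ satisfies \[ \|u\|_{2,\mathcal T}+\|\boldsymbol\eta\|_{-3/2,-1/2,\mathcal S}\le C\|f\| \] with a constant $C$ that is independent of $f$ and $\mathcal T$. Furthermore, $u\in H^2_0(\Omega)$, $\boldsymbol\eta=\gamma_{\mathrm{dDiv}}(\mathcal C D^2u)$, and $u$, $\boldsymbol M:=\mathcal C D^2u$ solve the Kirchhoff–Love problem \[ \operatorname{div}\operatorname{\mathbf{div}}\boldsymbol M=f,\quad \boldsymbol M=\mathcal C D^2u\ \text{ in }\Omega,\qquad u=\partial_nu=0\ \text{ on }\Gamma. \]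
   Context: $\Omega\subset\mathbb R^2$ is a bounded, simply connected Lipschitz polygon with boundary $\Gamma=\partial\Omega$; $\partial_n$ is the exterior normal derivative. $\mathbb S$ is the space of symmetric $2\times2$ real matrices; $\mathcal C$ is a symmetric, (uniformly) positive definite $L_\infty$ tensor field on $\Omega$, acting pointwise as a linear map $\mathbb S\to\mathbb S$. $D^2$ is the Hessian and $\operatorname{\mathbf{div}}$ the row-wise divergence of tensors. $(\cdot,\cdot)$, $\|\cdot\|$ are the $L_2(\Omega)$ inner product and norm (scalar or tensor valued). For a domain $\omega$, $\|v\|_{2,\omega}^2:=\|v\|_{L_2(\omega)}^2+\|D^2v\|_{L_2(\omega)}^2$ on $H^2(\omega)$, and $H(\mathrm{dDiv},\omega;\mathbb S):=\{\boldsymbol M\in L_2(\omega;\mathbb S):\operatorname{div}\operatorname{\mathbf{div}}\boldsymbol M\in L_2(\omega)\}$ with $\|\boldsymbol M\|_{\mathrm{dDiv},\omega}^2:=\|\boldsymbol M\|_{L_2(\omega)}^2+\|\operatorname{div}\operatorname{\mathbf{div}}\boldsymbol M\|_{L_2(\omega)}^2$; the index $\omega$ is dropped for $\omega=\Omega$. $H^2_0(\Omega)$ is the subspace of $H^2(\Omega)$ with vanishing trace and normal derivative on $\Gamma$. $\mathcal T$ is a regular (conforming) mesh of shape-regular triangles $T$ covering $\Omega$, with skeleton $\mathcal S=\bigcup_{T\in\mathcal T}\partial T$. $(\cdot,\cdot)_{\mathcal T}$ is the sum of elementwise $L_2$ inner products, with differential operators taken elementwise. $H^2(\mathcal T):=\prod_{T\in\mathcal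 T}H^2(T)$ (identified with piecewise functions in $L_2(\Omega)$), with $\|v\|_{2,\mathcal T}^2=\sum_{T}\|v\|_{2,T}^2$. Trace operator $\gamma_{\mathrm{dDiv}}:H(\mathrm{dDiv},\Omega;\mathbb S)\to H^2(\mathcal T)^*$, $\langle\gamma_{\mathrm{dDiv}}(\boldsymbol M),v\rangle_{\mathcal S}:=(\operatorname{div}\operatorname{\mathbf{div}}\boldsymbol M,v)-(\boldsymbol M,D^2v)_{\mathcal T}$. Trace space $H^{-3/2,-1/2}(\mathcal S):=\gamma_{\mathrm{dDiv}}(H(\mathrm{dDiv},\Omega;\mathbb S))$ with norm $\|\boldsymbol\eta\|_{-3/2,-1/2,\mathcal S}:=\inf\{\|\boldsymbol M\|_{\mathrm{dDiv}}:\gamma_{\mathrm{dDiv}}(\boldsymbol M)=\boldsymbol\eta\}$; $\langle\boldsymbol\eta,v\rangle_{\mathcal S}$ denotes the action of the functional $\boldsymbol\eta$ on $v\in H^2(\mathcal T)$. *)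

(* Defs.v *)
From HB Require Import structures.
From mathcomp Require Export all_boot all_order all_algebra.
From mathcomp Require Export all_classical all_reals all_analysis.
Export numFieldNormedType.Exports.

Set Implicit Arguments.
Unset Strict Implicit.
Unset Printing Implicit Defensive.

Export Order.TTheory GRing.Theory Num.Theory.

Global Open Scope classical_set_scope.
Global Open Scope ring_scope.

Section Plane.
Context {R : realType}.

Definition plane : Type := (R * R)%type.

(* The library norm on R * R is the max norm; it is used for topology only.
   Lengths and angles go through the Euclidean product below. *)
Definition dot (x y : plane) : R := x.1 * y.1 + x.2 * y.2.
Definition enorm (x : plane) : R := Num.sqrt (dot x x).

Definition lebesgue2 := (@lebesgue_measure R \x @lebesgue_measure R)%E.

Definition seg_pt (e : plane * plane) (t : R) : plane :=
  e.1 + t *: (e.2 - e.1).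

(* Exterior unit normal of an edge traversed with the domain on its left. *)
Definition edge_normal (e : plane * plane) : plane :=
  (enorm (e.2 - e.1))^-1 *: ((e.2 - e.1).2, - (e.2 - e.1).1).

End Plane.
Arguments plane : clear implicits.
Arguments lebesgue2 : clear implicits.

Section Domain.
Context {R : realType}.
Implicit Types (Omega : set (plane R)) (E : seq (plane R * plane R)).

Definition boundary Omega : set (plane R) := closure Omega `\` interior Omega.

Definition loops_contractible Omega : Prop :=
  forall c : R -> plane R,
    {within `[0, 1], continuous c} ->
    (forall t : R, t \in `[0, 1] -> Omega (c t)) -> c 0 = c 1 ->
    exists H : R * R -> plane R,
      [/\ {within `[0, 1] `*` `[0, 1], continuous H},
          forall s t : R, s \in `[0, 1] -> t \in `[0, 1] -> Omega (H (s, t)),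
          forall s : R, s \in `[0, 1] -> H (s, 0) = c s /\ H (s, 1) = c 0 &
          forall t : R, t \in `[0, 1] -> H (0, t) = c 0 /\ H (1, t) = c 0].

Definition simply_connected Omega : Prop :=
  connected Omega /\ loops_contractible Omega.

(* Near every boundary point, in suitable orthonormal coordinates (s, t)
   centred there, Omega is the part of a rectangle above the graph of a
   Lipschitz function. *)
Definition lipschitz_boundary Omega : Prop :=
  forall x, boundary Omega x ->
  exists (d d' : plane R) (r h : R) (g : R -> R),
    [/\ dot d d = 1, dot d' d' = 1, dot d d' = 0 & 0 < r /\ 0 < h] /\
    [lipschitz g s | s in setT] /\
    forall s t : R, `|s| < r -> `|t| < h ->
      (Omega (x + s *: d + t *: d') <-> g s < t).

(* E lists the boundary edges: nondegenerate, not overlapping, and oriented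
   so that edge_normal points out of Omega. *)
Definition boundary_edges Omega E : Prop :=
  [/\ boundary Omega =
        \bigcup_(e in [set` E]) [set seg_pt e t | t in `[0, 1]],
      forall e : plane R * plane R, e \in E -> e.1 != e.2,
      forall i j, (i < j < size E)%N ->
        [set seg_pt (nth (0, 0) E i) t | t in `]0, 1[] `&`
        [set seg_pt (nth (0, 0) E j) t | t in `]0, 1[] = set0 &
      forall (e : plane R * plane R) (t : R), e \in E -> t \in `]0, 1[ ->
        \forall s \near 0^'+,
          ~ Omega (seg_pt e t + s *: edge_normal e) /\
          Omega (seg_pt e t - s *: edge_normal e)].

Definition lipschitz_polygon Omega E : Prop :=
  [/\ open Omega /\ Omega !=set0, bounded_set Omega, simply_connected Omega,
      lipschitz_boundary Omega & boundary_edges Omega E].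

End Domain.

Section Mesh.
Context {R : realType}.

Definition triangle : Type := 'I_3 -> plane R.
Implicit Types T : triangle.

Definition det3 T : R :=
  (T 1 - T 0).1 * (T 2%:R - T 0).2 - (T 1 - T 0).2 * (T 2%:R - T 0).1.

Definition open_triangle T : set (plane R) :=
  [set x | exists l : 'I_3 -> R,
     [/\ forall i, 0 < l i, \sum_i l i = 1 & x = \sum_i l i *: T i]].

(* The closed face spanned by the vertices with index in I. *)
Definition face T (I : pred 'I_3) : set (plane R) :=
  [set x | exists l : 'I_3 -> R,
     [/\ forall i, 0 <= l i, forall i, ~~ I i -> l i = 0,
         \sum_i l i = 1 & x = \sum_i l i *: T i]].

Definition closed_triangle T : set (plane R) := face T xpredT.

(* Two different elements meet in a common proper face: a common edge, a
   common vertex, or (the face without vertices) not at all. *)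
Definition conforming_mesh (Omega : set (plane R)) N (T : 'I_N -> triangle)
    : Prop :=
  [/\ forall k, det3 (T k) != 0,
      \bigcup_(k in [set: 'I_N]) closed_triangle (T k) = closure Omega &
      forall k l, k != l -> exists I J : pred 'I_3,
        [/\ (#|I| < 3)%N, (#|J| < 3)%N, face (T k) I = face (T l) J &
            closed_triangle (T k) `&` closed_triangle (T l) = face (T k) I]].

(* The squared diameter is bounded by kappa times the area. *)
Definition shape_regular (kappa : R) N (T : 'I_N -> triangle) : Prop :=
  forall k i j,
    enorm (T k i - T k j) ^+ 2 <= kappa * (`|det3 (T k)| / 2).

End Mesh.
Arguments triangle : clear implicits.

Section Sobolev.
Context {R : realType}.
Local Notation pt := (plane R).
Local Notation mu := (lebesgue2 R).
Implicit Types (w : set pt) (v f g phi : pt -> R).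

(* Elements of L2(w), H2(w), ... are represented by functions on the whole
   plane whose values off w play no role, and are identified when they agree
   almost everywhere on w. *)
Definition L2 w f : Prop := (f \_ w) \in Lfun mu 2%:E.

Definition L2norm w f : R := fine ('N[mu]_2%:E [EFin \o (f \_ w)])%E.

Definition eqae w f g : Prop := f = g %[ae mu in w].

Definition basis (i : 'I_2) : pt := if i == 0 then (1, 0) else (0, 1).

Definition pd (i : 'I_2) phi : pt -> R := fun x => 'D_(basis i) phi x.

Definition pds (s : seq 'I_2) phi : pt -> R := foldr pd phi s.

Definition smooth phi : Prop :=
  forall s, continuous (pds s phi) /\
            forall i x, derivable (pds s phi) x (basis i).

Definition test_function w phi : Prop :=
  [/\ smooth phi, compact (closure [set x | phi x != 0]) &
      closure [set x | phi x != 0] `<=` w].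

Definition weak_derivative w (s : seq 'I_2) v g : Prop :=
  forall phi, test_function w phi ->
    \int[mu]_(x in w) (v x * pds s phi x) =
    (-1) ^+ size s * \int[mu]_(x in w) (g x * phi x).

(* The weak derivative as a function; unique up to null sets of w, and
   meaningful only when one exists in L2(w). *)
Definition wpd w (s : seq 'I_2) v : pt -> R :=
  xget (fun=> 0) [set g | L2 w g /\ weak_derivative w s v g].

Definition sobolev (m : nat) w v : Prop :=
  L2 w v /\ forall s : seq 'I_2, (size s <= m)%N ->
    exists g, L2 w g /\ weak_derivative w s v g.

Definition H1 := sobolev 1.
Definition H2 := sobolev 2.

End Sobolev.

Section Tensors.
Context {R : realType}.
Local Notation pt := (plane R).
Local Notation mu := (lebesgue2 R).
Implicit Types (w : set pt) (v f g phi : pt -> R) (M : pt -> 'M[R]_2).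

Definition frob (A B : 'M[R]_2) : R := \sum_i \sum_j A i j * B i j.

Definition sym (A : 'M[R]_2) : Prop := A^T = A.

Definition L2t w M : Prop := forall i j, L2 w (fun x => M x i j).

Definition L2tnorm w M : R :=
  Num.sqrt (\sum_i \sum_j L2norm w (fun x => M x i j) ^+ 2).

Definition classical_hess phi : pt -> 'M[R]_2 :=
  fun x => \matrix_(i, j) pds [:: i; j] phi x.

Definition hess w v : pt -> 'M[R]_2 :=
  fun x => \matrix_(i, j) wpd w [:: i; j] v x.

Definition H2norm w v : R :=
  Num.sqrt (L2norm w v ^+ 2 + L2tnorm w (hess w v) ^+ 2).

(* g is the distributional div Div M on w, Div being the row-wise divergence:
   the two integrations by parts give <div Div M, phi> = (M, D^2 phi). *)
Definition weak_dDiv w M g : Prop :=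
  forall phi, test_function w phi ->
    \int[mu]_(x in w) frob (M x) (classical_hess phi x) =
    \int[mu]_(x in w) (g x * phi x).

Definition HdDiv w : set (pt -> 'M[R]_2) :=
  [set M | [/\ L2t w M, \forall x \ae mu, w x -> sym (M x) &
               exists g, L2 w g /\ weak_dDiv w M g]].

Definition dDiv w M : pt -> R :=
  xget (fun=> 0) [set g | L2 w g /\ weak_dDiv w M g].

Definition dDivnorm w M : R :=
  Num.sqrt (L2tnorm w M ^+ 2 + L2norm w (dDiv w M) ^+ 2).

(* CC x matters only on symmetric matrices; a map given on these extends to
   all matrices, e.g. by composition with the symmetric part. *)
Definition elasticity_tensor w (CC : pt -> {linear 'M[R]_2 -> 'M[R]_2})
    : Prop :=
  [/\ forall A i j, sym A -> measurable_fun w (fun x => CC x A i j),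
      \forall x \ae mu, w x -> forall A, sym A -> sym (CC x A),
      \forall x \ae mu, w x -> forall A B, sym A -> sym B ->
        frob (CC x A) B = frob A (CC x B),
      exists2 alpha : R, 0 < alpha &
        \forall x \ae mu, w x -> forall A, sym A ->
          alpha * frob A A <= frob (CC x A) A &
      exists beta : R,
        \forall x \ae mu, w x -> forall A, sym A ->
          frob (CC x A) (CC x A) <= beta * frob A A].

Definition apply_tensor (CC : pt -> {linear 'M[R]_2 -> 'M[R]_2}) M :
  pt -> 'M[R]_2 := fun x => CC x (M x).

End Tensors.

Section BoundaryTraces.
Context {R : realType}.
Local Notation pt := (plane R).
Variables (Omega : set pt) (E : seq (pt * pt)).
Implicit Types (v f g : pt -> R).

Definition bL2 g : Prop :=
  forall e, e \in E ->
    ((g \o seg_pt e) \_ `[0, 1]) \in Lfun (@lebesgue_measure R) 2%:E.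

Definition bnorm g : R :=
  Num.sqrt (\sum_(e <- E) enorm (e.2 - e.1) *
    \int[@lebesgue_measure R]_(t in `[0, 1]) (g (seg_pt e t) ^+ 2)).

(* g is the trace of v on the boundary: the continuous extension to H1(Omega)
   of the restriction of smooth functions, with values in L2 of the boundary. *)
Definition has_trace v g : Prop :=
  [/\ H1 Omega v, bL2 g &
      exists phi : nat -> pt -> R,
        [/\ forall k, smooth (phi k),
            (fun k => L2norm Omega (phi k \- v)) @ \oo --> (0 : R),
            forall i, (fun k => L2norm Omega
              (pd i (phi k) \- wpd Omega [:: i] v)) @ \oo --> (0 : R) &
            (fun k => bnorm (phi k \- g)) @ \oo --> (0 : R)]].

(* The normal derivative n . grad v, with the traces of the components of
   grad v. *)
Definition has_normal_derivative v g : Prop :=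
  exists G1 G2 : pt -> R,
    [/\ has_trace (wpd Omega [:: 0] v) G1,
        has_trace (wpd Omega [:: 1] v) G2 &
        forall e, e \in E ->
          \forall t \ae (@lebesgue_measure R), t \in `[0, 1] ->
            g (seg_pt e t) =
            dot (edge_normal e) (G1 (seg_pt e t), G2 (seg_pt e t))].

Definition H20 v : Prop :=
  [/\ H2 Omega v, has_trace v (fun=> 0) & has_normal_derivative v (fun=> 0)].

Definition kirchhoff_love (CC : pt -> {linear 'M[R]_2 -> 'M[R]_2})
    f v (M : pt -> 'M[R]_2) : Prop :=
  [/\ H2 Omega v,
      HdDiv Omega M /\ eqae Omega (dDiv Omega M) f,
      \forall x \ae lebesgue2 R, Omega x -> M x = CC x (hess Omega v x),
      has_trace v (fun=> 0) &
      has_normal_derivative v (fun=> 0)].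

End BoundaryTraces.

Section Hybrid.
Context {R : realType}.
Local Notation pt := (plane R).
Local Notation mu := (lebesgue2 R).
Variables (Omega : set pt) (N : nat) (T : 'I_N -> triangle R).

Definition H2T : set (pt -> R) :=
  [set v | L2 Omega v /\ forall k, H2 (open_triangle (T k)) v].

Definition pwfun (v : H2T) : pt -> R := val v.

Definition H2Tnorm (v : pt -> R) : R :=
  Num.sqrt (\sum_k H2norm (open_triangle (T k)) v ^+ 2).

Definition gamma_dDiv (M : pt -> 'M[R]_2) : H2T -> R := fun v =>
  \int[mu]_(x in Omega) (dDiv Omega M x * pwfun v x) -
  (\sum_k \int[mu]_(x in open_triangle (T k))
    frob (M x) (hess (open_triangle (T k)) (pwfun v) x)).

(* The space H^{-3/2,-1/2}(S). *)
Definition trace_space : set (H2T -> R) :=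
  [set gamma_dDiv M | M in HdDiv Omega].

Definition tracenorm (eta : H2T -> R) : R :=
  inf [set dDivnorm Omega M |
        M in HdDiv Omega `&` [set M | gamma_dDiv M = eta]].

Definition hybrid_solution (CC : pt -> {linear 'M[R]_2 -> 'M[R]_2})
    (f : pt -> R) (u : H2T) (eta : H2T -> R) : Prop :=
  [/\ trace_space eta,
      forall du : H2T,
        (\sum_k \int[mu]_(x in open_triangle (T k))
           frob (CC x (hess (open_triangle (T k)) (pwfun u) x))
                (hess (open_triangle (T k)) (pwfun du) x)) + eta du =
        \int[mu]_(x in Omega) (f x * pwfun du x) &
      forall deta, trace_space deta -> deta u = 0].

End Hybrid.

(* Main.v *)
Require Import Defs.
From mathcomp Require Import measurable_realfun ring lra.

(* Test functions vanish near the boundary, so H^2_0 can be replaced by the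
   L2-closure of the test functions together with their derivatives of order at
   most two. Poincare's inequality for test functions and the coercivity of the
   tensor make (C D^2 u, D^2 v) a scalar product there, and the Riesz argument
   gives a weak solution p for every right-hand side f. Its moment tensor
   C D^2 p has div div = f, and gamma(M)(p) = 0 for every M in H(dDiv), both by
   passage to the limit from test functions; hence (p, gamma(C D^2 p)) solves the
   hybrid problem.
   Conversely, let (u, eta) be a hybrid solution. Since <gamma(M), u> = 0 for all
   M, testing with M = C(D^2_T u - D^2 p), whose div div vanishes weakly, gives
   D^2_T u = D^2 p; testing with the moment tensor of the solution with
   right-hand side u - p then gives u = p. All bounds come from the energy
   identity and Poincare's inequality on Omega, so the mesh does not enter the
   constant. *)

Set Implicit Arguments.
Unset Strict Implicit.
Unset Printing Implicit Defensive.

(** * Square integrable functions *)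

Section L2.
Context d (T : measurableType d) (R : realType) (mu : {measure set T -> \bar R}).
Implicit Types f g h : T -> R.

(** The obstacle is the constraint [<deta, u> = 0]. It ought to say that [u] lies in H^2_0, but
    reading this off directly calls for trace and density theorems on H(dDiv) over a broken mesh.
    Instead the constraint is tested with two tensors only, both of the form C times a symmetric
    field; they identify [u] with a function that is a limit of test functions by construction, and
    conformity, trace and normal derivative are then inherited from the approximants. The shape of
    the domain enters the mesh arguments twice: the boundary is a null set, and an open triangle
    inside the closure of Omega lies inside Omega, the Lipschitz charts ruling out a triangle that
    crosses a slit. Weak derivatives and div div are values of a choice operator, made anew on each
    element and on Omega. The fundamental lemma reconciles these choices almost everywhere, so most
    identities below are transported along almost everywhere equality. Fields are cut off by zero,
    so that every inner product is an integral over the whole plane. *)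

Lemma ae_imp (P Q : T -> Prop) : {ae mu, forall x, P x} ->
  (forall x, P x -> Q x) -> {ae mu, forall x, Q x}.
Proof. by move=> p H; exact: (@filterS _ _ (ae_filter_ringOfSetsType mu) _ _ H p). Qed.

Lemma ae_and (P Q : T -> Prop) : {ae mu, forall x, P x} ->
  {ae mu, forall x, Q x} -> {ae mu, forall x, P x /\ Q x}.
Proof. by move=> p q; exact: (@filterI _ _ (ae_filter_ringOfSetsType mu) _ _ p q). Qed.

Definition sqint : pred (T -> R) := Lfun mu 2%:E.

Definition ip f g : R := \int[mu]_x (f x * g x).

Lemma sqintP f : reflect
  (measurable_fun setT f /\ mu.-integrable setT (fun x => (f x ^+ 2)%:E))
  (sqint f).
Proof.
apply: (iffP idP) => [sf|[mf /integrableP[_ fi]]].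
  split; last exact: Lfun2_integrable_sqr.
  by move: sf => /andP[/[!inE]].
rewrite /sqint /=; apply/andP; split; rewrite inE//=.
rewrite /finite_norm (@lty_poweRy _ _ 2)// powR_Lnorm//.
apply: le_lt_trans fi.
rewrite le_eqVlt; apply/orP; left; apply/eqP; apply: eq_integral => x _.
by rewrite /= powR_mulrn// normrX.
Qed.

Lemma sqint_measurable f : sqint f -> measurable_fun setT f.
Proof. by case/sqintP. Qed.

Lemma sqintM f g : sqint f -> sqint g ->
  mu.-integrable setT (fun x => (f x * g x)%:E).
Proof. by move=> sf sg; apply/Lfun1_integrable; exact: Lfun2_mul_Lfun1. Qed.

Lemma sqintD f g : sqint f -> sqint g -> sqint (f \+ g).
Proof.
by move=> sf sg; apply: (Lfun_addr_closed mu (lee1n 2)).2.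
Qed.

Lemma sqintZ (k : R) f : sqint f -> sqint (fun x => k * f x).
Proof.
move=> sf; have := @Lfun_scale _ _ _ mu f k 2 (ler1n _ _) sf.
by under eq_fun do rewrite /= mulrC.
Qed.

Lemma sqint0 : sqint (fun=> 0).
Proof. exact: (Lfun_addr_closed mu (lee1n 2)).1. Qed.

Lemma sqintB f g : sqint f -> sqint g -> sqint (f \- g).
Proof.
move=> sf sg; have -> : f \- g = f \+ (fun x => -1 * g x).
  by apply/funext => x /=; rewrite mulN1r.
exact/sqintD/sqintZ.
Qed.

Lemma sqint_sum n (F : 'I_n -> T -> R) :
  (forall i, sqint (F i)) -> sqint (fun x => \sum_i F i x).
Proof.
elim: n F => [|n IH] F sF.
  by under eq_fun do rewrite big_ord0; exact: sqint0.
under eq_fun do rewrite big_ord_recl.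
by apply: sqintD => //; exact: IH.
Qed.

Lemma sqint_le f g : measurable_fun setT f -> sqint g ->
  {ae mu, forall x, f x ^+ 2 <= g x ^+ 2} -> sqint f.
Proof.
move=> mf /sqintP[mg /integrableP[mg2 ig]] fg; apply/sqintP; split => //.
apply/integrableP; split.
  by apply/measurable_EFinP; exact: measurable_funX.
apply: le_lt_trans ig; apply: ae_ge0_le_integral => //=.
- apply/measurable_EFinP; apply: measurableT_comp => //.
  exact: measurable_funX.
- apply/measurable_EFinP; apply: measurableT_comp => //.
  exact: measurable_funX.
- apply: filterS fg => x H _.
  by rewrite lee_fin !ger0_norm ?sqr_ge0.
Qed.

Lemma sqint_indic (B : set T) : measurable B -> (mu B < +oo)%E ->
  sqint (\1_B : T -> R).
Proof.
move=> mB Boo; have m1 : measurable_fun setT (\1_B : T -> R) by exact: measurable_indic.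
apply/sqintP; split => //; apply/integrableP; split.
  by apply/measurable_EFinP; exact: measurable_funX.
apply: le_lt_trans Boo.
have -> : (\int[mu]_x `|(\1_B x ^+ 2)%:E| = \int[mu]_x (\1_B x)%:E)%E.
  apply: eq_integral => x _; rewrite gee0_abs ?lee_fin ?sqr_ge0// indicE.
  by case: (_ \in _); rewrite ?expr1n ?expr0n.
by rewrite integral_indic// setIT.
Qed.

Lemma restrict_indicE f (B : set T) : f \_ B = f \* \1_B.
Proof.
by apply/funext => x /=; rewrite patchE indicE; case: ifP => _; rewrite ?mulr1 ?mulr0.
Qed.

Lemma sqint_restrict f (B : set T) : measurable B -> sqint f -> sqint (f \_ B).
Proof.
move=> mB sf; apply: (sqint_le (g := f)) => //.
  apply/(measurable_restrictT f mB); apply: measurable_funTS.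
  exact: sqint_measurable.
by apply: aeW => x; rewrite patchE; case: ifP => _ //; rewrite expr0n sqr_ge0.
Qed.

Lemma sqint_integrable_restrict f (B : set T) : measurable B -> (mu B < +oo)%E ->
  sqint f -> mu.-integrable setT (EFin \o (f \_ B)).
Proof. by move=> mB Boo sf; rewrite restrict_indicE; apply: sqintM => //; exact: sqint_indic. Qed.

Lemma ipC f g : ip f g = ip g f.
Proof. by apply: eq_Rintegral => x _; rewrite mulrC. Qed.

Lemma ipDl f g h : sqint f -> sqint g -> sqint h ->
  ip (f \+ g) h = ip f h + ip g h.
Proof.
move=> sf sg sh; rewrite /ip -RintegralD//; try exact: sqintM.
by apply: eq_Rintegral => x _; rewrite /= mulrDl.
Qed.

Lemma ipZl (k : R) f h : sqint f -> sqint h ->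
  ip (fun x => k * f x) h = k * ip f h.
Proof.
move=> sf sh; rewrite /ip -RintegralZl//; try exact: sqintM.
by apply: eq_Rintegral => x _; rewrite /= mulrA.
Qed.

Lemma ip0l h : ip (fun=> 0) h = 0.
Proof.
rewrite /ip; under eq_Rintegral do rewrite mul0r.
by rewrite Rintegral_cst// mul0r.
Qed.

Lemma ipBl f g h : sqint f -> sqint g -> sqint h ->
  ip (f \- g) h = ip f h - ip g h.
Proof.
move=> sf sg sh; have -> : f \- g = f \+ (fun x => -1 * g x).
  by apply/funext => x /=; rewrite mulN1r.
by rewrite ipDl ?ipZl ?mulN1r//; exact: sqintZ.
Qed.

Lemma ipDr f g h : sqint f -> sqint g -> sqint h ->
  ip h (f \+ g) = ip h f + ip h g.
Proof. by move=> *; rewrite ipC ipDl// !(ipC h). Qed.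

Lemma ipBr f g h : sqint f -> sqint g -> sqint h ->
  ip h (f \- g) = ip h f - ip h g.
Proof. by move=> *; rewrite ipC ipBl// !(ipC h). Qed.

Lemma ipZr (k : R) f h : sqint f -> sqint h ->
  ip h (fun x => k * f x) = k * ip h f.
Proof. by move=> *; rewrite ipC ipZl// (ipC h). Qed.

Lemma ip_ge0 f : 0 <= ip f f.
Proof. by apply: Rintegral_ge0 => x _; rewrite -expr2 sqr_ge0. Qed.

Lemma ip_CS f g : sqint f -> sqint g -> ip f g ^+ 2 <= ip f f * ip g g.
Proof.
move=> sf sg.
have H (t : R) : 0 <= ip f f - 2 * t * ip f g + t ^+ 2 * ip g g.
  have := ip_ge0 (f \- (fun x => t * g x)).
  have stg := sqintZ t sg.
  rewrite ipBl// ?ipBr//; try exact: sqintB.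
  rewrite !ipZl// !ipZr// (ipC g f).
  by congr (_ <= _); ring.
have := ip_ge0 g; rewrite le_eqVlt => /orP[/eqP g0|gp].
  rewrite -g0 mulr0.
  rewrite leNgt; apply/negP => fgp.
  have fg0 : ip f g != 0 by apply: contraTneq fgp => ->; rewrite expr0n/= ltxx.
  (* If [ip g g = 0], the quadratic in [t] is affine; this [t] gives it the value -1, which
     contradicts its sign. *)
  have := H ((ip f f + 1) / (2 * ip f g)).
  rewrite -g0 mulr0 addr0.
  have -> : 2 * ((ip f f + 1) / (2 * ip f g)) * ip f g = ip f f + 1 by field.
  by rewrite opprD addrA subrr add0r oppr_ge0 ler10.
(* The minimizer of the quadratic in [t]. *)
have := H (ip f g / ip g g).
have -> : ip f f - 2 * (ip f g / ip g g) * ip f g +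
  (ip f g / ip g g) ^+ 2 * ip g g = ip f f - ip f g ^+ 2 / ip g g.
  by field; rewrite gt_eqF.
by rewrite subr_ge0 ler_pdivrMr.
Qed.

Lemma ip_eq0 f : sqint f -> ip f f = 0 -> {ae mu, forall x, f x = 0}.
Proof.
move=> sf f0.
have fi := sqintM sf sf.
have : (\int[mu]_(x in setT) `|(f x * f x)%:E| = 0)%E.
  transitivity (\int[mu]_(x in setT) (f x * f x)%:E)%E.
    apply: eq_integral => x _; rewrite gee0_abs// lee_fin -expr2; exact: sqr_ge0.
  by rewrite -[LHS]fineK ?integrable_fin_num//; congr EFin.
move/(ae_eq_integral_abs _ measurableT (measurable_int mu fi)).
apply: filterS => x /(_ I) /= [] /eqP.
by rewrite -expr2 sqrf_eq0 => /eqP.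
Qed.

Definition cvg2 (F : nat -> T -> R) f :=
  [/\ forall n, sqint (F n), sqint f & ip (F n \- f) (F n \- f) @[n --> \oo] --> (0 : R)].

Lemma ip_cvgl F f g : cvg2 F f -> sqint g -> ip (F n) g @[n --> \oo] --> ip f g.
Proof.
move=> [sF sf Ff] sg; apply/cvgrPdist_le => e e0.
have K0 : 0 < ip g g + 1 by rewrite ltr_wpDl// ip_ge0.
move/cvgrPdist_le : Ff => /(_ (e ^+ 2 / (ip g g + 1))).
rewrite divr_gt0 ?exprn_gt0// => /(_ isT); apply: filterS => n.
rewrite sub0r normrN ger0_norm ?ip_ge0// => H.
rewrite distrC -ipBl//.
have e2 := ip_CS (sqintB (sF n) sf) sg.
rewrite -(ger0_norm (ltW e0)) -ler_sqr ?nnegrE// -!normrX !ger0_norm ?sqr_ge0//.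
rewrite (le_trans e2)// (@le_trans _ _ (e ^+ 2 / (ip g g + 1) * ip g g))//.
  by rewrite ler_wpM2r// ip_ge0.
rewrite -mulrA ler_piMr ?sqr_ge0// mulrC ler_pdivrMr// mul1r.
by rewrite lerDl.
Qed.

(** Parallelogram identity for [F n - f] and [f], with the square of [F n - 2 f] dropped. *)
Lemma cvg2_bounded F f : cvg2 F f -> exists2 N : nat,
  True & forall n, (N <= n)%N -> ip (F n) (F n) <= 2 * ip f f + 2.
Proof.
move=> [sF sf Ff]; move/cvgrPdist_le : Ff => /(_ 1 ltr01)[N _ HN].
exists N => // n Nn; have := HN n Nn.
rewrite sub0r normrN ger0_norm ?ip_ge0// => H.
have := ip_ge0 (F n \- f \- f); have sB := sqintB (sF n) sf.
have sBB := sqintB sB sf.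
move: H; rewrite !(ipBl, ipBr)// (ipC f (F n)) => H; nra.
Qed.

Lemma ip_cvg F G f g : cvg2 F f -> cvg2 G g ->
  ip (F n) (G n) @[n --> \oo] --> ip f g.
Proof.
move=> Ff Gg; have [sF sf Ffl] := Ff; have [sG sg Ggl] := Gg.
have -> : (fun n => ip (F n) (G n)) =
  (fun n => ip (F n) g + ip (F n) (G n \- g)).
  by apply/funext => n; rewrite ipBr// addrC subrK.
rewrite -[X in _ --> X]addr0; apply: cvgD; first exact: ip_cvgl.
have [N _ HN] := cvg2_bounded Ff.
set K := 2 * ip f f + 2 in HN.
have K0 : 0 < K by rewrite ltr_wpDl// mulr_ge0// ip_ge0.
apply/cvgrPdist_le => e e0.
move/cvgrPdist_le : Ggl => /(_ (e ^+ 2 / K)).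
rewrite divr_gt0 ?exprn_gt0// => /(_ isT) [N' _ HN'].
exists (maxn N N') => // n /=; rewrite geq_max => /andP[Nn N'n].
have {HN'} := HN' n N'n; rewrite !sub0r !normrN ger0_norm ?ip_ge0// => H.
have e2 := ip_CS (sF n) (sqintB (sG n) sg).
rewrite -(ger0_norm (ltW e0)) -ler_sqr ?nnegrE// -!normrX !ger0_norm ?sqr_ge0//.
rewrite (le_trans e2)// (@le_trans _ _ (K * (e ^+ 2 / K)))//.
  by apply: ler_pM; rewrite ?ip_ge0// HN.
by rewrite mulrC divfK// gt_eqF.
Qed.

Lemma cvg2D F G f g : cvg2 F f -> cvg2 G g ->
  cvg2 (fun n => F n \+ G n) (f \+ g).
Proof.
move=> [sF sf Ff] [sG sg Gg]; split; [by move=> n; exact: sqintD|exact: sqintD|].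
have H : (2 * ip (F n \- f) (F n \- f) + 2 * ip (G n \- g) (G n \- g)) @[n --> \oo] --> (0 : R).
  rewrite -[X in _ --> X](addr0 (0 : R)) -{1}[X in X + _](mulr0 (2 : R)) -[X in _ + X](mulr0 (2 : R)).
  by apply: cvgD; apply: cvgMr.
apply: (squeeze_cvgr _ (cvg_cst 0) H); near=> n; rewrite ip_ge0/=.
have s1 := sqintB (sF n) sf; have s2 := sqintB (sG n) sg.
have -> : F n \+ G n \- (f \+ g) = (F n \- f) \+ (G n \- g).
  by apply/funext => x /=; rewrite opprD addrACA.
have := ip_ge0 ((F n \- f) \- (G n \- g)).
have s3 := sqintB s1 s2; have s4 := sqintD s1 s2.
by rewrite (ipBl s1 s2 s3) (ipBr s1 s2 s1) (ipBr s1 s2 s2) (ipDl s1 s2 s4)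
  (ipDr s1 s2 s1) (ipDr s1 s2 s2) (ipC (G n \- g) (F n \- f)); lra.
Unshelve. all: by end_near.
Qed.

Lemma cvg2_cst f : sqint f -> cvg2 (fun=> f) f.
Proof.
move=> sf; split => //; have -> : f \- f = fun=> 0.
  by apply/funext => x /=; rewrite subrr.
by rewrite ip0l; exact: cvg_cst.
Qed.

Lemma cvg2Z F f (k : R) : cvg2 F f -> cvg2 (fun n x => k * F n x) (fun x => k * f x).
Proof.
move=> [sF sf Ff]; split; [by move=> n; exact: sqintZ|exact: sqintZ|].
have -> : (fun n => ip ((fun x => k * F n x) \- (fun x => k * f x))
   ((fun x => k * F n x) \- (fun x => k * f x))) =
   (fun n => k * (k * ip (F n \- f) (F n \- f))).
  apply/funext => n.
  have -> : (fun x => k * F n x) \- (fun x => k * f x) = fun x => k * (F n \- f) x.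
    by apply/funext => x /=; rewrite mulrBr.
  by have s := sqintB (sF n) sf; rewrite ipZl ?ipZr//; exact: sqintZ.
suff : k * (k * ip (F n \- f) (F n \- f)) @[n --> \oo] --> k * (k * 0).
  by rewrite !mulr0.
by do 2 apply: cvgMr.
Qed.

End L2.

(** * Completeness of L2 (Riesz-Fischer) *)

Lemma cvg_of_weighted_increments (R : realType) (a : R^nat) (C : R) :
  (forall k, 4 ^+ k * (a k.+1 - a k) ^+ 2 <= C) -> cvgn a.
Proof.
(* Since [C <= K ^+ 2], the increments are bounded by [K * 2 ^- k] without a square root. *)
move=> H; pose K := C + 1.
have C0 : 0 <= C by apply: le_trans (H 0%N); rewrite mulr_ge0// ?sqr_ge0// exprn_ge0.
have K0 : 0 <= K by rewrite addr_ge0.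
have d k : `|a k.+1 - a k| <= geometric K 2^-1 k.
  have p0 : (0 : R) < 2 ^+ k by rewrite exprn_gt0.
  rewrite /geometric /= exprVn ler_pdivlMr//.
  rewrite -ler_sqr ?nnegrE ?mulr_ge0 ?(ltW p0)//.
  rewrite exprMn real_normK ?num_real// mulrC -exprM mulnC exprM.
  have -> : (2 : R) ^+ 2 = 4 by ring.
  by apply: le_trans (H k) _; rewrite /K; nra.
rewrite (funext (eq_sum_telescope a)).
apply: is_cvgD; first exact: is_cvg_cst.
apply: normed_cvg.
apply: (@series_le_cvg _ _ (geometric K 2^-1)) => //.
- by move=> n; exact: normr_ge0.
- by move=> n; exact: le_trans (normr_ge0 _) (d n).
- by apply: is_cvg_geometric_series; rewrite ger0_norm// invf_lt1 ?ltr1n.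
Qed.

Section completeness.
Context d (T : measurableType d) (R : realType) (mu : {measure set T -> \bar R}).

(** The series of [4 ^+ k * (F k.+1 - F k) ^+ 2] has integral at most the sum of
    [4 ^+ k * 8 ^- k = 2 ^- k], that is 2; hence it is finite almost everywhere, and there the
    increments decay geometrically. *)
Lemma ae_cvg_of_fast_cauchy (F : nat -> T -> R) : (forall n, sqint mu (F n)) ->
  (forall n, ip mu (F n.+1 \- F n) (F n.+1 \- F n) <= 8 ^- n) ->
  {ae mu, forall x, cvgn (F ^~ x)}.
Proof.
move=> sF dF.
pose g k := F k.+1 \- F k.
have sg k : sqint mu (g k) by exact: sqintB.
pose h k x := (4 ^+ k * g k x ^+ 2)%:E.
have mh k : measurable_fun setT (h k).
  apply/measurable_EFinP; apply: measurable_funM => //.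
  by apply: measurable_funX; exact: sqint_measurable (sg k).
have h0 k x : (0 <= h k x)%E by rewrite lee_fin mulr_ge0 ?sqr_ge0 ?exprn_ge0.
have ih k : (\int[mu]_x h k x = (4 ^+ k * ip mu (g k) (g k))%:E)%E.
  rewrite /h; under eq_integral do rewrite EFinM.
  have gi := sqintM (sg k) (sg k); have [_ gi2] := elimT (sqintP _ _) (sg k).
  rewrite integralZl//.
  rewrite EFinM; congr (_ * _)%E; rewrite /ip /Rintegral fineK.
    by apply: eq_integral => x _; rewrite expr2.
  exact: integrable_fin_num.
have hsum : (\int[mu]_x (\sum_(0 <= k <oo) h k x) <= 2%:E)%E.
  rewrite integral_nneseries//; apply: lime_le.
    by apply: is_cvg_nneseries => k _ _; exact: integral_ge0.
  near=> n; under eq_bigr do rewrite ih.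
  rewrite sumEFin lee_fin; apply: (@le_trans _ _ (\sum_(0 <= k < n) 2 ^- k)).
    apply: ler_sum_nat => k _; apply: (@le_trans _ _ (4 ^+ k * 8 ^- k)).
      by apply: ler_wpM2l (dF k); rewrite exprn_ge0.
    by rewrite -exprVn -exprMn -exprVn; apply: lerXn2r; rewrite ?nnegrE; lra.
  suff -> : \sum_(0 <= k < n) 2 ^- k = 2 - 2 * 2 ^- n :> R.
    by rewrite gerBl// mulr_ge0// invr_ge0 exprn_ge0.
  elim: (n) => [|m IH]; first by rewrite big_geq// expr0 invr1 mulr1 subrr.
  by rewrite big_nat_recr//= IH exprS; field; rewrite expf_neq0.
have mS : measurable_fun setT (fun x => \sum_(0 <= k <oo) h k x)%E.
  exact: ge0_emeasurable_sum.
have iS : mu.-integrable setT (fun x => \sum_(0 <= k <oo) h k x)%E.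
  apply/integrableP; split => //; apply: le_lt_trans (ltry 2).
  apply: le_trans hsum; rewrite le_eqVlt; apply/orP; left; apply/eqP.
  by apply: eq_integral => x _; rewrite gee0_abs// nneseries_ge0.
apply: filterS (integrable_ae measurableT iS) => x /(_ I) Hx.
apply: (@cvg_of_weighted_increments _ _ (fine (\sum_(0 <= k <oo) h k x)%E)) => k.
rewrite -lee_fin fineK// (@le_trans _ _ (\sum_(0 <= j < k.+1) h j x)%E)//.
  by rewrite big_nat_recr//= leeDr// sume_ge0.
exact: nneseries_lim_ge.
Unshelve. all: by end_near.
Qed.

Lemma sqint_complete (F : nat -> T -> R) : (forall n, sqint mu (F n)) ->
  (forall e, 0 < e -> exists N, forall n m, (N <= n)%N -> (N <= m)%N ->
     ip mu (F n \- F m) (F n \- F m) <= e) ->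
  exists f, cvg2 mu F f.
Proof.
move=> sF cF.
have c8 k : (0 : R) < 8 ^- k by rewrite invr_gt0 exprn_gt0.
have /choice[N HN] : forall k, exists N, forall n m, (N <= n)%N -> (N <= m)%N ->
    ip mu (F n \- F m) (F n \- F m) <= 8 ^- k by move=> k; exact: cF.
(* The partial sums make [s] monotone and at least [N k]; the summand [k] makes it unbounded. *)
pose s k := (\sum_(i < k.+1) N i + k)%N.
have sN k : (N k <= s k)%N by rewrite /s big_ord_recr/= addnAC leq_addl.
have sS k : (s k <= s k.+1)%N.
  by rewrite /s [X in (_ <= X + _)%N]big_ord_recr/= leq_add// leq_addr.
have ks k : (k <= s k)%N by rewrite /s leq_addl.
have aeF : {ae mu, forall x, cvgn (fun k => F (s k) x)}.
  apply: (@ae_cvg_of_fast_cauchy (fun k => F (s k))) => // k.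
  by apply: HN => //; exact: leq_trans (sS k).
(* The upper limit is measurable without any convergence assumption and equals the limit wherever
   there is one. *)
pose f x := fine (limn_esup (fun k => (F (s k) x)%:E)).
have mf : measurable_fun setT f.
  apply: (measurableT_comp (fine_measurable measurableT)).
  by apply: measurable_fun_limn_esup => k; apply/measurable_EFinP;
    exact: sqint_measurable.
have fE : {ae mu, forall x, F (s k) x @[k --> \oo] --> f x}.
  apply: filterS aeF => x cx; suff -> : f x = limn (fun k => F (s k) x) by [].
  rewrite /f is_cvg_limn_esupE; last first.
    by apply/cvg_ex; exists (limn (fun k => F (s k) x))%:E; apply: cvg_EFin => //; exact: nearW.
  by rewrite (EFin_lim cx).
(* Fatou's lemma along the subsequence carries the Cauchy bound over to [f]. It serves twice: for
   the square integrability of [F n - f] and for the convergence. *)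
have fatou_bound n e : (forall m, (n <= m)%N ->
    ip mu (F n \- F m) (F n \- F m) <= e) ->
    (\int[mu]_x ((F n x - f x) ^+ 2)%:E <= e%:E)%E.
  move=> H.
  pose g k x := ((F n x - F (s k) x) ^+ 2)%:E.
  have mg k : measurable_fun setT (g k).
    apply/measurable_EFinP; apply: measurable_funX.
    by apply: measurable_funB; exact: sqint_measurable.
  have -> : (\int[mu]_x ((F n x - f x) ^+ 2)%:E =
     \int[mu]_x (limn_einf (g ^~ x)))%E.
    apply: ae_eq_integral => //.
    - apply/measurable_EFinP; apply: measurable_funX.
      by apply: measurable_funB => //; exact: sqint_measurable.
    - have -> : (fun x => limn_einf (g ^~ x)) =
          (fun x => - limn_esup (fun k => - g k x))%E.
        by apply/funext => x; rewrite (limn_esupN (g ^~ x)) oppeK.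
      apply: measurableT_comp => //; apply: measurable_fun_limn_esup => k.
      exact: measurableT_comp.
    - apply: filterS fE => x cx _.
      have : g k x @[k --> \oo] --> ((F n x - f x) ^+ 2)%:E.
        apply: cvg_EFin; first exact: nearW.
        under eq_cvg do rewrite /= expr2.
        by rewrite expr2; apply: cvgM; apply: cvgB => //; exact: cvg_cst.
      by move/cvg_limn_einf_sup => [->].
  apply: le_trans (fatou _ _ _ _) _ => //.
    by move=> k x _; rewrite lee_fin sqr_ge0.
  rewrite limn_einf_lim; apply: lime_le; first exact: is_cvg_einfs.
  near=> k.
  apply: (@le_trans _ _ (\int[mu]_x (g (maxn k n)) x)%E).
    by apply: ereal_inf_lbound => /=; exists (maxn k n); rewrite //= leq_maxl.
  have -> : (\int[mu]_x (g (maxn k n)) x)%E =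
     (ip mu (F n \- F (s (maxn k n))) (F n \- F (s (maxn k n))))%:E.
    have sB := sqintB (sF n) (sF (s (maxn k n))).
    rewrite /ip /Rintegral fineK; last exact/integrable_fin_num/sqintM.
    by apply: eq_integral => x _; rewrite /g expr2.
  rewrite lee_fin; apply: H; apply: leq_trans (ks _); exact: leq_maxr.
have sFf n : (exists e, forall m, (n <= m)%N ->
    ip mu (F n \- F m) (F n \- F m) <= e) -> sqint mu (F n \- f).
  move=> [e He]; apply/sqintP; split.
    by apply: measurable_funB => //; exact: sqint_measurable.
  apply/integrableP; split.
    apply/measurable_EFinP; apply: measurable_funX.
    by apply: measurable_funB => //; exact: sqint_measurable.
  apply: le_lt_trans (ltry e); apply: le_trans (fatou_bound n e He).
  rewrite le_eqVlt; apply/orP; left; apply/eqP; apply: eq_integral => x _.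
  by rewrite gee0_abs// lee_fin sqr_ge0.
have sf : sqint mu f.
  have [n Hn] := cF 1 ltr01.
  have -> : f = F n \- (F n \- f).
    by apply/funext => x /=; rewrite opprB addrCA subrr addr0.
  by apply: sqintB => //; apply: sFf; exists 1 => m nm; exact: Hn.
exists f; split => //.
apply/cvgrPdist_le => e e0; have [n Hn] := cF e e0; exists n => // m /= nm.
rewrite sub0r normrN ger0_norm ?ip_ge0// -lee_fin.
apply: le_trans (fatou_bound m e _); last first.
  by move=> m' mm'; apply: Hn => //; exact: leq_trans mm'.
rewrite /ip /Rintegral fineK; last by apply/integrable_fin_num/sqintM => //; exact: sqintB.
by rewrite le_eqVlt; apply/orP; left; apply/eqP; apply: eq_integral => x _; rewrite expr2.
Unshelve. all: by end_near.
Qed.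

End completeness.

(** * Minimizing sequences of quadratic functionals *)

Section riesz.
Context (R : realType) (V : lmodType R) (S : set V) (a : V -> V -> R) (l : V -> R).
Hypothesis S0 : S 0.
Hypothesis SZD : forall (k : R) u v, S u -> S v -> S (k *: u + v).
Hypothesis aC : forall u v, S u -> S v -> a u v = a v u.
Hypothesis aZD : forall (k : R) u v w, S u -> S v -> S w ->
  a (k *: u + v) w = k * a u w + a v w.
Hypothesis a_ge0 : forall u, S u -> 0 <= a u u.
Hypothesis lZD : forall (k : R) u v, S u -> S v -> l (k *: u + v) = k * l u + l v.
Variable K : R.
Hypothesis l_bounded : forall u, S u -> l u ^+ 2 <= K * a u u.

(* A minimizing sequence of [a u u - 2 * l u]: it is Cauchy for [a] by the
   parallelogram identity, and perturbing it along [v] gives the equation. *)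
Lemma riesz_sequence : exists u : nat -> V,
  [/\ forall n, S (u n),
      forall n m, a (u n - u m) (u n - u m) <= 2 / n.+1%:R + 2 / m.+1%:R &
      forall v, S v -> a (u n) v @[n --> \oo] --> l v].
Proof.
have SD u v : S u -> S v -> S (u + v).
  by move=> su sv; have := SZD 1 su sv; rewrite scale1r.
have SZ k u : S u -> S (k *: u).
  by move=> su; have := SZD k su S0; rewrite addr0.
have SB u v : S u -> S v -> S (u - v).
  by move=> su sv; have := SZD (-1) sv su; rewrite scaleN1r addrC.
have a0 w : S w -> a 0 w = 0.
  move=> sw; have := aZD 1 S0 S0 sw; rewrite scale1r addr0 mul1r => H.
  by apply: (addIr (a 0 w)); rewrite add0r -H.
have l0 : l 0 = 0.
  have := lZD 1 S0 S0; rewrite scale1r addr0 mul1r => H.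
  by apply: (addIr (l 0)); rewrite add0r -H.
have aD u v w : S u -> S v -> S w -> a (u + v) w = a u w + a v w.
  by move=> su sv sw; have := aZD 1 su sv sw; rewrite scale1r mul1r.
have aZ k u w : S u -> S w -> a (k *: u) w = k * a u w.
  by move=> su sw; have := aZD k su S0 sw; rewrite addr0 a0// addr0.
have lZ k u : S u -> l (k *: u) = k * l u.
  by move=> su; have := lZD k su S0; rewrite addr0 l0 addr0.
have lD u v : S u -> S v -> l (u + v) = l u + l v.
  by move=> su sv; have := lZD 1 su sv; rewrite scale1r mul1r.
have aZDsq k u v : S u -> S v ->
    a (v + k *: u) (v + k *: u) = a v v + 2 * k * a v u + k ^+ 2 * a u u.
  move=> su sv; have sku := SZ k u su; have sx := SD _ _ sv sku.
  rewrite aD// aZ// (aC sv sx) (aC su sx) !aD// !aZ// (aC su sv).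
  by ring.
pose J u := a u u - 2 * l u.
have J_lb u : S u -> - `|K| - 1 <= J u.
  move=> su; have h1 := a_ge0 su; have h2 := l_bounded su; have h3 := normr_ge0 K.
  have {h2}h2 : l u ^+ 2 <= `|K| * a u u.
    by apply: le_trans h2 _; rewrite ler_wpM2r// ler_norm.
  rewrite /J; set x := a u u in h1 h2 *; set y := l u in h2 *; set k := `|K| in h2 h3 *.
  (* [y ^+ 2 <= k * x] forces [2 * y <= x + k], the arithmetic mean dominating the geometric one. *)
  case: (leP (2 * y) (x + k)) => [|yk]; first by lra.
  have : (x + k) ^+ 2 < (2 * y) ^+ 2 by rewrite ltr_sqr ?nnegrE; lra.
  by have := sqr_ge0 (x - k); nra.
pose D := [set J u | u in S].
have D0 : has_inf D.
  split; first by exists (J 0), 0.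
  by exists (- `|K| - 1) => _ [u su <-]; exact: J_lb.
have n0 n : (0 : R) < n.+1%:R^-1 by rewrite invr_gt0 ltr0n.
have /choice[u Hu] : forall n, exists u, S u /\ J u < inf D + n.+1%:R^-1.
  move=> n; have [_ [u su <-] Ju] := inf_adherent (n0 n) D0.
  by exists u.
have su n : S (u n) := (Hu n).1.
have J_inf v : S v -> inf D <= J v.
  by move=> sv; apply: ge_inf => //; [exact: D0.2|exists v].
exists u; split => //.
- move=> n m; have sn := su n; have sm := su m.
  have snm := SD _ _ sn sm; have := J_inf _ (SZ 2^-1 _ snm).
  have := (Hu n).2; have := (Hu m).2.
  have -> : a (u n - u m) (u n - u m) = a (u n) (u n) - 2 * a (u n) (u m) + a (u m) (u m).
    by have := aZDsq (-1) _ _ sm sn; rewrite scaleN1r => ->; ring.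
  rewrite /J lZ// lD// aZ//; last exact: SZ.
  rewrite aC//; last exact: SZ.
  rewrite aZ//; have := aZDsq 1 _ _ sm sn; rewrite scale1r => ->.
  move: n.+1%:R^-1 m.+1%:R^-1 => q q'; rewrite expr1n mulr1 mul1r => h1 h2 h3; lra.
- move=> v sv; apply/cvgrPdist_le => e e0.
  have av := a_ge0 sv.
  have key n : (l v - a (u n) v) ^+ 2 <= (a v v + 1) * n.+1%:R^-1.
    have sn := su n; have hn := (Hu n).2; have np := n0 n.
    (* This step along [v] is the minimizing one up to the added 1, which covers [a v v = 0]. *)
    have := J_inf _ (SD _ _ sn (SZ ((l v - a (u n) v) / (a v v + 1)) _ sv)).
    rewrite /J aZDsq// lD ?lZ//; last exact: SZ.
    move: hn; rewrite /J; move: (a (u n) v) (l (u n)) (a (u n) (u n)) (inf D) (l v) => x y z i w.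
    move: n.+1%:R^-1 (a v v) np av => q c np av h1 h2.
    set t := (w - x) / (c + 1) in h2.
    have c1 : 0 < c + 1 by rewrite ltr_wpDl.
    have tE : w - x = t * (c + 1) by rewrite divfK// gt_eqF.
    have tt : 0 <= t ^+ 2 by exact: sqr_ge0.
    have h3 : 2 * t * (w - x) - t ^+ 2 * c < q by lra.
    rewrite tE in h3 *; rewrite exprMn.
    have h4 : t ^+ 2 * (c + 1) <= q by nra.
    by rewrite expr2 mulrA [X in _ <= X]mulrC ler_pM2r// ltW.
  have c1 : 0 < a v v + 1 by rewrite ltr_wpDl.
  have := near_infty_natSinv_lt (PosNum (divr_gt0 (exprn_gt0 2 e0) c1)).
  apply: filterS => n /= hn.
  rewrite -ler_sqr ?nnegrE ?(ltW e0)// real_normK ?num_real//.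
  apply: le_trans (key n) _; rewrite mulrC -ler_pdivlMr//; exact: ltW.
Qed.

End riesz.

(** * Smooth functions and test functions *)

Section smooth_functions.
Context {R : realType}.
Local Notation pt := (plane R).
Implicit Types phi psi : pt -> R.

Lemma pds_cat (s t : seq 'I_2) phi : pds (s ++ t) phi = pds s (pds t phi).
Proof. exact: foldr_cat. Qed.

(** [smooth] stratified by order. Induction on the order handles products, since [pd i] of a product
    is a sum of products of one order less. *)
Fixpoint Cdiff (n : nat) phi : Prop :=
  continuous phi /\
  (if n is m.+1 then
     forall i, (forall x, derivable phi x (basis i)) /\ Cdiff m (pd i phi)
   else True).

Lemma smooth_pds s phi : smooth phi -> smooth (pds s phi).
Proof. by move=> sp t; rewrite -pds_cat; exact: sp. Qed.

Lemma smooth_pd i phi : smooth phi -> smooth (pd i phi).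
Proof. exact: (@smooth_pds [:: i]). Qed.

Lemma smooth_continuous phi : smooth phi -> continuous phi.
Proof. by move=> /(_ [::])[]. Qed.

Lemma smooth_derivable phi i x : smooth phi -> derivable phi x (basis i).
Proof. by move=> /(_ [::])[]. Qed.

Lemma smoothP phi : smooth phi <-> forall n, Cdiff n phi.
Proof.
split=> [+ n|H].
  elim: n phi => [|n IH] phi sp; (split; first exact: smooth_continuous) => //.
  by move=> i; split=> [x|]; [exact: smooth_derivable|exact/IH/smooth_pd].
move=> s; have : forall n, Cdiff n (pds s phi).
  elim: s => //= i s IH n.
  by have [_ /(_ i)[]] := IH n.+1.
move=> Hs; split; first by have [] := Hs 0%N.
by move=> i x; have [_ /(_ i)[]] := Hs 1%N.
Qed.

Lemma CdiffW n phi : Cdiff n.+1 phi -> Cdiff n phi.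
Proof.
elim: n phi => [|n IH] phi; first by case.
by move=> [cp dp]; split => // i; have [d1 d2] := dp i; split => //; exact: IH.
Qed.

Lemma pdD i phi psi : (forall x, derivable phi x (basis i)) ->
  (forall x, derivable psi x (basis i)) ->
  pd i (phi \+ psi) = pd i phi \+ pd i psi.
Proof. by move=> dp dq; apply/funext => x; rewrite /pd deriveD. Qed.

Lemma pdZ i (k : R) phi : (forall x, derivable phi x (basis i)) ->
  pd i (fun x => k * phi x) = fun x => k * pd i phi x.
Proof. by move=> dp; apply/funext => x; rewrite /pd (@deriveZ _ _ _ phi k). Qed.

Lemma pdM i phi psi : (forall x, derivable phi x (basis i)) ->
  (forall x, derivable psi x (basis i)) ->
  pd i (phi \* psi) = (phi \* pd i psi) \+ (psi \* pd i phi).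
Proof. by move=> dp dq; apply/funext => x; rewrite /pd deriveM. Qed.

Lemma CdiffD n phi psi : Cdiff n phi -> Cdiff n psi -> Cdiff n (phi \+ psi).
Proof.
elim: n phi psi => [|n IH] phi psi [cp dp] [cq dq].
  by split => // x; apply: cvgD; [exact: cp|exact: cq].
split=> [x|i]; first by apply: cvgD; [exact: cp|exact: cq].
have [dpi ndp] := dp i; have [dqi ndq] := dq i.
by split=> [x|]; [exact: derivableD|rewrite pdD//; exact: IH].
Qed.

Lemma CdiffM n phi psi : Cdiff n phi -> Cdiff n psi -> Cdiff n (phi \* psi).
Proof.
elim: n phi psi => [|n IH] phi psi [cp dp] [cq dq].
  by split => // x; apply: cvgM; [exact: cp|exact: cq].
split=> [x|i]; first by apply: cvgM; [exact: cp|exact: cq].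
have [dpi ndp] := dp i; have [dqi ndq] := dq i.
split=> [x|]; first exact: derivableM.
rewrite pdM//; apply: CdiffD; apply: IH => //.
- exact: (@CdiffW n phi).
- exact: (@CdiffW n psi).
Qed.

Lemma Cdiff_cst n (k : R) : Cdiff n (fun=> k).
Proof.
elim: n k => [|n IH] k; (split; first by move=> x; exact: cvg_cst) => // i.
split=> [x|]; first exact: derivable_cst.
have -> : pd i (fun=> k) = fun=> 0 by apply/funext => x; rewrite /pd derive_cst.
exact: IH.
Qed.

Lemma smooth_cst (k : R) : smooth (fun _ : pt => k).
Proof. by apply/smoothP => n; exact: Cdiff_cst. Qed.

Lemma smoothD phi psi : smooth phi -> smooth psi -> smooth (phi \+ psi).
Proof. by move=> /smoothP p /smoothP q; apply/smoothP => n; exact: CdiffD. Qed.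

Lemma smoothM phi psi : smooth phi -> smooth psi -> smooth (phi \* psi).
Proof. by move=> /smoothP p /smoothP q; apply/smoothP => n; exact: CdiffM. Qed.

Lemma smoothZ (k : R) phi : smooth phi -> smooth (fun x => k * phi x).
Proof. exact/smoothM/smooth_cst. Qed.

Lemma pdsD s phi psi : smooth phi -> smooth psi ->
  pds s (phi \+ psi) = pds s phi \+ pds s psi.
Proof.
move=> sp sq; elim: s => //= i s ->.
by rewrite pdD// => x; apply/smooth_derivable/smooth_pds.
Qed.

Lemma pdsZ s (k : R) phi : smooth phi ->
  pds s (fun x => k * phi x) = fun x => k * pds s phi x.
Proof.
move=> sp; elim: s => //= i s ->.
by rewrite pdZ// => x; apply/smooth_derivable/smooth_pds.
Qed.

Lemma is_derive_line phi (x e : pt) (t : R) : derivable phi (x + t *: e) e ->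
  is_derive t 1 (fun s => phi (x + s *: e)) ('D_e phi (x + t *: e)).
Proof.
move=> dp.
have E : (fun h : R => h^-1 *: (((fun s => phi (x + s *: e)) \o shift t) (h *: 1) -
     phi (x + t *: e))) =
   (fun h => h^-1 *: ((phi \o shift (x + t *: e)) (h *: e) - phi (x + t *: e))).
  apply/funext => h /=; congr (_ *: (phi _ - _)).
  by rewrite scaler1 scalerDl addrCA.
by apply: DeriveDef; rewrite /derivable /derive E.
Qed.

End smooth_functions.

(** * Symmetry of second derivatives *)

Section schwarz.
Context {R : realType}.
Local Notation pt := (plane R).
Implicit Types phi psi : pt -> R.

Lemma mvt_line phi i (x : pt) (k : R) : smooth phi -> 0 < k ->
  exists2 c, 0 < c < k &
    phi (x + k *: basis i) - phi x = k * pd i phi (x + c *: basis i).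
Proof.
move=> sp k0; pose f s := phi (x + s *: basis i).
have df (t : R) : is_derive t 1 f (pd i phi (x + t *: basis i)).
  exact/is_derive_line/smooth_derivable.
have [|c ck Hc] := @MVT R f _ 0 k k0 (fun t _ => df t).
- apply: derivable_within_continuous => t _; exact: (@ex_derive _ _ _ _ _ _ _ (df t)).
- exists c; first by rewrite in_itv in ck.
  by move: Hc; rewrite /f scale0r addr0 subr0 mulrC.
Qed.

(** The increment in direction [j] is a function of the shift along [i]; the mean value theorem is
    applied to it, and then once more along [j]. *)
Lemma second_difference phi i j (x : pt) (k : R) : smooth phi -> 0 < k ->
  exists c d, [/\ 0 < c < k, 0 < d < k &
    phi (x + k *: basis i + k *: basis j) - phi (x + k *: basis i)
      - phi (x + k *: basis j) + phi x =
    k ^+ 2 * pd j (pd i phi) (x + c *: basis i + d *: basis j)].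
Proof.
move=> sp k0.
pose tp : pt -> R := phi \o shift (k *: basis j).
have tpE y l : derivable tp y (basis l) /\ pd l tp y = pd l phi (y + k *: basis j).
  have E : (fun h : R => h^-1 *: ((tp \o shift y) (h *: basis l) - tp y)) =
    (fun h => h^-1 *: ((phi \o shift (y + k *: basis j)) (h *: basis l) - phi (y + k *: basis j))).
    by apply/funext => h /=; rewrite addrA.
  split; first by rewrite /derivable E; exact: smooth_derivable.
  by rewrite /pd /derive E.
pose g := tp \- phi.
pose f s := g (x + s *: basis i).
have df (t : R) : is_derive t 1 f (pd i phi (x + t *: basis i + k *: basis j) - pd i phi (x + t *: basis i)).
  have [dtp tpe] := tpE (x + t *: basis i) i.
  have dphi := @smooth_derivable R phi i (x + t *: basis i) sp.
  have := @is_derive_line R g x (basis i) t (derivableB dtp dphi).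
  have Dg : 'D_(basis i) g (x + t *: basis i) =
      pd i tp (x + t *: basis i) - pd i phi (x + t *: basis i).
    exact: (deriveB dtp dphi).
  by rewrite Dg tpe.
have [|c ck Hc] := @MVT R f _ 0 k k0 (fun t _ => df t).
  apply: derivable_within_continuous => t _; exact: (@ex_derive _ _ _ _ _ _ _ (df t)).
have ck' : 0 < c < k by rewrite in_itv in ck.
have [d dk Hd] := mvt_line j (x + c *: basis i) (smooth_pd i sp) k0.
exists c, d; split => //.
move: Hc; rewrite Hd /f /g /tp /= scale0r addr0 subr0 => Hc.
rewrite expr2 -mulrA [RHS]mulrC -Hc; ring.
Qed.

Lemma norm_basis i : `|basis i : pt| = 1.
Proof.
rewrite /basis; case: ifP => _; rewrite prod_normE /= normr1 normr0.
  by rewrite max_l.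
by rewrite max_r.
Qed.

Lemma ball_shift_basis (x : pt) (r s t : R) i j :
  0 < s < r / 2 -> 0 < t < r / 2 -> ball x r (x + s *: basis i + t *: basis j).
Proof.
move=> /andP[s0 sr] /andP[t0 tr].
rewrite -ball_normE /ball_ /= -addrA opprD addrA subrr add0r normrN.
apply: le_lt_trans (ler_normD _ _) _.
rewrite !normrZ !norm_basis !mulr1 (gtr0_norm s0) (gtr0_norm t0) (splitr r).
exact: ltrD.
Qed.

(** The second difference over a square of side [r / 2] is symmetric in [i] and [j]. Divided by the
    area it equals a mixed derivative in either order at some point near [x], and both mixed
    derivatives vary by at most [e / 2] there. *)
Lemma pdC phi i j : smooth phi -> pd i (pd j phi) = pd j (pd i phi).
Proof.
move=> sp; apply/funext => x; apply/eqP; rewrite -subr_eq0 -normr_le0.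
apply/ler_addgt0Pr => e e0; rewrite add0r.
have e20 : 0 < e / 2 by rewrite divr_gt0.
have cij l m : \forall y \near x, `|pd l (pd m phi) x - pd l (pd m phi) y| <= e / 2.
  have c := smooth_continuous (smooth_pd l (smooth_pd m sp)).
  exact: (@cvgr_dist_le _ _ _ _ _ _ _ (c x) _ e20).
have [r /= r0 Hr] := proj1 (nbhs_ballP x _)
  (@filterI _ _ (nbhs_filter x) _ _ (cij i j) (cij j i)).
have r20 : 0 < r / 2 by exact: divr_gt0.
have [c [d [cr dr H1]]] := second_difference i j x sp r20.
have [c' [d' [c'r d'r H2]]] := second_difference j i x sp r20.
have [_ A] := Hr _ (ball_shift_basis x i j cr dr).
have [B _] := Hr _ (ball_shift_basis x j i c'r d'r).
clear Hr cij.
rewrite (addrAC x) in H2.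
have E : pd j (pd i phi) (x + c *: basis i + d *: basis j) =
         pd i (pd j phi) (x + c' *: basis j + d' *: basis i).
  have r2 : (r / 2) ^+ 2 != 0 by exact/expf_neq0/lt0r_neq0.
  apply: (mulfI r2); apply: etrans (esym H1) _; apply: etrans H2.
  by congr (_ + _); exact: addrAC.
rewrite E in A; move: A B {H1 H2 E}.
move: (pd i (pd j phi) (_ + _)) (pd i (pd j phi) x) (pd j (pd i phi) x) => z a b A B.
have -> : a - b = (a - z) - (b - z) by ring.
by rewrite (splitr e); apply: le_trans (ler_normB _ _) (lerD _ _).
Qed.

End schwarz.

(** * Test functions *)

Section test_functions.
Context {R : realType}.
Local Notation pt := (plane R).
Implicit Types (phi psi : pt -> R) (w : set pt).

(** Any compact set outside which [phi] vanishes may replace the support; such sets are easy to name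
    for sums, products and derivatives. *)
Lemma test_functionP w phi : test_function w phi <->
  smooth phi /\ exists K, [/\ compact K, K `<=` w & forall x, ~ K x -> phi x = 0].
Proof.
split=> [[sp cp sw]|[sp [K [cK Kw p0]]]].
  split => //; exists (closure [set x | phi x != 0]); split => // x.
  by move=> nx; apply/eqP/negP => p0; apply: nx; apply: subset_closure; apply/negP.
have sub : closure [set x | phi x != 0] `<=` K.
  have cK' : closed K by apply: compact_closed => //; exact: norm_hausdorff.
  rewrite (proj1 (closure_id K) cK'); apply: closure_subset => x /eqP px.
  by apply: contrapT => /p0.
split => //; last exact: subset_trans Kw.
by apply: subclosed_compact cK sub; exact: closed_closure.
Qed.

Lemma test_function_smooth w phi : test_function w phi -> smooth phi.
Proof. by case. Qed.

Lemma test_function_off w phi x : test_function w phi -> ~ w x -> phi x = 0.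
Proof.
by move=> /test_functionP[_ [K [_ Kw p0]]] wx; apply: p0 => /Kw.
Qed.

Lemma test_function0 w : test_function w (fun=> 0).
Proof.
apply/test_functionP; split; first exact: smooth_cst.
by exists set0; split => //; exact: compact0.
Qed.

Lemma test_functionD w phi psi : test_function w phi -> test_function w psi ->
  test_function w (phi \+ psi).
Proof.
move=> /test_functionP[sp [K [cK Kw pK]]] /test_functionP[sq [K' [cK' K'w qK']]].
apply/test_functionP; split; first exact: smoothD.
exists (K `|` K'); split; first exact: compactU.
- by move=> x [/Kw|/K'w].
- by move=> x /not_orP[/pK + /qK'] /= => -> ->; rewrite addr0.
Qed.

Lemma test_functionM w phi psi : smooth phi -> test_function w psi ->
  test_function w (phi \* psi).
Proof.
move=> sp /test_functionP[sq [K [cK Kw qK]]]; apply/test_functionP.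
split; first exact: smoothM.
by exists K; split => // x /qK /= ->; rewrite mulr0.
Qed.

Lemma test_functionZ w (k : R) phi : test_function w phi ->
  test_function w (fun x => k * phi x).
Proof. exact/test_functionM/smooth_cst. Qed.

Lemma test_functionB w phi psi : test_function w phi -> test_function w psi ->
  test_function w (phi \- psi).
Proof.
move=> tp tq; have -> : phi \- psi = phi \+ (fun x => -1 * psi x).
  by apply/funext => x /=; rewrite mulN1r.
by apply: test_functionD => //; exact: test_functionZ.
Qed.

Lemma pd_near0 i phi (x : pt) : nbhs x [set y | phi y = 0] -> pd i phi x = 0.
Proof.
move=> H; rewrite /pd /derive; apply: cvg_lim => //.
have H0 : nbhs (0 : R) [set h | phi (h *: basis i + x) = 0].
  have : (fun h : R => h *: basis i + x) @ (0 : R) --> (0 : R) *: basis i + x.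
    by apply: cvgD; [apply: cvgZr_tmp; exact: cvg_id|exact: cvg_cst].
  by rewrite scale0r add0r => /(_ _ H).
have px : phi x = 0 := nbhs_singleton H.
apply: cvg_near_cst; apply: (@nbhs_dnbhs R 0).
by apply: filterS H0 => h /= ph; rewrite ph px subrr scaler0.
Qed.

Lemma test_function_pd w i phi : test_function w phi -> test_function w (pd i phi).
Proof.
move=> /test_functionP[sp [K [cK Kw pK]]].
apply/test_functionP; split; first exact: smooth_pd.
exists K; split => // x Kx; apply: pd_near0.
have cK' : closed K by apply: compact_closed => //; exact: norm_hausdorff.
by apply: filterS (open_nbhs_nbhs (conj (closed_openC cK') Kx)) => y /pK.
Qed.

Lemma test_function_pds w s phi : test_function w phi -> test_function w (pds s phi).
Proof. by move=> tp; elim: s => //= i s; exact: test_function_pd. Qed.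

Lemma test_function_vanish w phi : test_function w phi ->
  exists2 L : R, 0 < L & forall x : pt, L <= `|x| -> phi x = 0.
Proof.
move=> /test_functionP[_ [K [/compact_bounded[M [_ HM]] _ pK]]].
exists (`|M| + 2) => [|x xL]; first by rewrite ltr_wpDl.
apply: pK => Kx; have := HM (`|M| + 1) _ x Kx.
rewrite (le_lt_trans (ler_norm M)) ?ltrDl// => /(_ isT) /= H.
by have := le_trans xL H; rewrite lerD2l; lra.
Qed.

End test_functions.

(** * Integration on the plane *)

Section plane_measure.
Context {R : realType}.
Local Notation pt := (plane R).
Local Notation mu := (lebesgue2 R).
Implicit Types (a b x : pt) (w A : set pt) (f g : pt -> R).

Definition rect a b : set pt := `]a.1, b.1[ `*` `]a.2, b.2[.
Definition crect a b : set pt := `[a.1, b.1] `*` `[a.2, b.2].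

Lemma measurable_rect a b : measurable (rect a b).
Proof. exact: measurableX. Qed.

Lemma measurable_crect a b : measurable (crect a b).
Proof. exact: measurableX. Qed.

(** Rational corners make the family countable. The closed rectangles stay inside [A] because the
    bump functions below have their supports there. *)
Lemma open_rect_cover A : open A -> exists F : nat -> pt * pt,
  (forall n, crect (F n).1 (F n).2 `<=` A) /\
  A `<=` \bigcup_n rect (F n).1 (F n).2.
Proof.
move=> oA.
pose q2p (q : rat * rat) : pt := (ratr q.1, ratr q.2).
pose F n : pt * pt := if unpickle n is Some q then
  if pselect (crect (q2p q.1) (q2p q.2) `<=` A) then (q2p q.1, q2p q.2)
  else ((1, 1), (0, 0)) else ((1, 1), (0, 0)).
(* The default pair has its corners in the wrong order, so its closed rectangle is empty. *)
have E0 : crect (1, 1) (0, 0) `<=` A.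
  move=> [y z] [/=]; rewrite in_itv /= => /andP[h1 h2].
  by have := le_trans h1 h2; rewrite ler10.
exists F; split=> [n|x Ax].
  by rewrite /F; case: (unpickle n) => // q; case: pselect.
have [r /= r0 Hr] := proj1 (nbhs_ballP x A) (open_nbhs_nbhs (conj oA Ax)).
have ex (t : R) : exists q : rat * rat, [/\ t - r < ratr q.1, ratr q.1 < t,
    t < ratr q.2 & ratr q.2 < t + r].
  have [q] : exists q : rat, ratr q \in `]t - r, t[ by apply: rat_in_itvoo; rewrite gtrBl.
  have [q'] : exists q : rat, ratr q \in `]t, t + r[ by apply: rat_in_itvoo; rewrite ltrDl.
  by rewrite !in_itv /= => /andP[h1 h2] /andP[h3 h4]; exists (q, q').
have [[q1 q2] /= [h1 h2 h3 h4]] := ex x.1.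
have [[q3 q4] /= [h5 h6 h7 h8]] := ex x.2.
pose q : (rat * rat) * (rat * rat) := ((q1, q3), (q2, q4)).
have qA : crect (q2p q.1) (q2p q.2) `<=` A.
  move=> y [/=]; rewrite !in_itv /= => /andP[k1 k2] /andP[k3 k4]; apply: Hr.
  by split; rewrite /= -ball_normE /ball_ /= ltr_norml; apply/andP; split; lra.
exists (pickle q) => //; rewrite /F pickleK; case: pselect => [?|//].
by split; rewrite /= in_itv /=; apply/andP.
Qed.

Lemma rect_sub a b : rect a b `<=` crect a b.
Proof. by move=> x [h1 h2]; split; exact: subset_itv_oo_cc. Qed.

Lemma open_measurable_plane A : open A -> measurable A.
Proof.
move=> /open_rect_cover[F [FA AF]].
rewrite (_ : A = \bigcup_n rect (F n).1 (F n).2).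
  by apply: bigcup_measurable => n _; exact: measurable_rect.
by apply/seteqP; split => // x [n _ /rect_sub]; exact: FA.
Qed.

Lemma closed_measurable_plane A : closed A -> measurable A.
Proof.
by move=> cA; rewrite -(setCK A); apply: measurableC; apply: open_measurable_plane;
  exact: closed_openC.
Qed.

Lemma continuous_measurable_plane f : continuous f -> measurable_fun setT f.
Proof.
move=> /continuousP cf; apply: (measurability _ (RGenOpens.measurableE R)).
move=> _ [_ [a [b ->] <-]]; rewrite setTI; apply: open_measurable_plane.
by apply: cf; exact: interval_open.
Qed.

Lemma compact_crect a b : compact (crect a b).
Proof. by apply: compact_setX; exact: segment_compact. Qed.

Lemma crect_finite a b : (mu (crect a b) < +oo)%E.
Proof.
rewrite /lebesgue2 /crect product_measure1E//.
have fin (c d : R) : (lebesgue_measure `[c, d]%classic < +oo)%E.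
  by rewrite lebesgue_measure_itv/=; case: ifP => _; rewrite ?EFinN -?EFinD ltry.
apply: lte_mul_pinfty; [by []| |exact: fin].
by rewrite ge0_fin_numE; [exact: fin|].
Qed.

Definition cbox (L : R) : set pt := crect (- L, - L) (L, L).

Lemma cboxP L x : cbox L x <-> `|x| <= L.
Proof.
by rewrite /cbox /crect prod_normE /= ge_max; split;
  rewrite !in_itv /= -!ler_norml => /andP.
Qed.

Lemma continuous_bounded_cbox f L : continuous f ->
  exists2 M : R, 0 < M & forall x, cbox L x -> `|f x| <= M.
Proof.
move=> cf; have : compact (f @` cbox L).
  by apply: continuous_compact; [exact: continuous_subspaceT|exact: compact_crect].
move=> /compact_bounded[M [_ HM]]; exists (`|M| + 1); first by rewrite ltr_wpDl.
move=> x bx; apply: (HM (`|M| + 1)); last by exists x.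
by rewrite (le_lt_trans (ler_norm M))// ltrDl.
Qed.

Lemma integrable_bounded_cbox f L M : measurable_fun setT f ->
  (forall x, ~ cbox L x -> f x = 0) -> (forall x, `|f x| <= M) ->
  mu.-integrable setT (EFin \o f).
Proof.
move=> mf f0 fM.
have mb : measurable (cbox L) by exact: measurable_crect.
have ib : mu.-integrable setT (fun x => (M * \1_(cbox L) x)%:E).
  under eq_fun do rewrite EFinM.
  apply: integrableZl => //; apply/integrableP; split.
    exact/measurable_EFinP.
  under eq_integral do rewrite gee0_abs ?lee_fin//.
  by rewrite integral_indic// setIT; exact: crect_finite.
apply: le_integrable ib => //; first exact/measurable_EFinP.
move=> x _ /=; rewrite lee_fin; have [bx|bx] := pselect (cbox L x).
  by rewrite indicE mem_set// mulr1 (le_trans (fM x))// ler_norm.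
by rewrite f0// normr0.
Qed.

Lemma sqint_bounded_cbox f L M : measurable_fun setT f ->
  (forall x, ~ cbox L x -> f x = 0) -> (forall x, `|f x| <= M) ->
  sqint mu f.
Proof.
move=> mf f0 fM; apply/sqintP; split => //.
apply: (@integrable_bounded_cbox (fun x => f x ^+ 2) L (M ^+ 2)).
- exact: measurable_funX.
- by move=> x /f0 ->; rewrite expr0n.
- move=> x; rewrite normrX lerXn2r ?nnegrE//; exact: le_trans (fM x).
Qed.

Lemma continuous_vanish_bounded f L : continuous f ->
  (forall x, L <= `|x| -> f x = 0) ->
  (forall x, ~ cbox L x -> f x = 0) /\ exists M, forall x, `|f x| <= M.
Proof.
move=> cf f0; have f0' x : ~ cbox L x -> f x = 0.
  by move=> /cboxP/negP; rewrite -ltNge => /ltW; exact: f0.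
split => //; have [M M0 HM] := continuous_bounded_cbox L cf; exists M => x.
have [/HM//|/f0' ->] := pselect (cbox L x); by rewrite normr0 ltW.
Qed.

Lemma integrable_continuous_vanish f L : continuous f ->
  (forall x, L <= `|x| -> f x = 0) -> mu.-integrable setT (EFin \o f).
Proof.
move=> cf /(continuous_vanish_bounded cf)[f0 [M fM]].
by apply: integrable_bounded_cbox f0 fM; exact: continuous_measurable_plane.
Qed.

Lemma sqint_continuous_vanish f L : continuous f ->
  (forall x, L <= `|x| -> f x = 0) -> sqint mu f.
Proof.
move=> cf /(continuous_vanish_bounded cf)[f0 [M fM]].
by apply: sqint_bounded_cbox f0 fM; exact: continuous_measurable_plane.
Qed.

Lemma sqint_test w f : test_function w f -> sqint mu f.
Proof.
move=> tf; have [L _ fL] := test_function_vanish tf.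
by apply: sqint_continuous_vanish fL; exact/smooth_continuous/(test_function_smooth tf).
Qed.

End plane_measure.

(** * Integration by parts and Poincare's inequality *)

Section by_parts.
Context {R : realType}.
Local Notation pt := (plane R).
Local Notation mu := (lebesgue2 R).
Implicit Types (phi psi h : pt -> R) (w : set pt).

Lemma integral_derivative_vanish (F f : R -> R) (L : R) : 0 < L ->
  (forall t : R, is_derive t 1 F (f t)) -> continuous f ->
  (forall t, L <= `|t| -> F t = 0) -> (forall t, L < `|t| -> f t = 0) ->
  (\int[@lebesgue_measure R]_t (f t)%:E = 0)%E.
Proof.
move=> L0 dF cf F0 f0.
have LL : - L < L by rewrite gtrN.
transitivity (\int[@lebesgue_measure R]_(t in `[(- L)%R, L]) (f t)%:E)%E.
  rewrite [RHS]integral_mkcond; apply: eq_integral => t _.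
  rewrite patchE; case: ifPn => // /negP tL.
  rewrite f0// ltNge; apply/negP => tL'; apply: tL.
  by rewrite inE /= in_itv /= -ler_norml.
have cF : continuous F.
  by move=> t; apply: differentiable_continuous; apply/derivable1_diffP;
    exact: (@ex_derive _ _ _ _ _ _ _ (dF t)).
rewrite (@continuous_FTC2 R f F (- L) L LL).
- by rewrite !F0 ?normrN ?gtr0_norm// subee.
- exact: continuous_subspaceT.
- split; first by move=> t _; exact: (@ex_derive _ _ _ _ _ _ _ (dF t)).
  + by apply: cvg_at_right_filter; exact: cF.
  + by apply: cvg_at_left_filter; exact: cF.
- by move=> t _; rewrite derive1E; exact: (@derive_val _ _ _ _ _ _ _ (dF t)).
Qed.

Lemma cvg_pairl (t y : R) : (fun s : R => ((s, y) : pt)) @ t --> ((t, y) : pt).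
Proof.
have H : (fun s : R => (s, y)) @ t --> (t, y).
apply: (@cvg_pair _ _ _ _ (nbhs t) (nbhs y)); [exact: cvg_id|exact: cvg_cst].
exact: H.
Qed.
Lemma cvg_pairr (t y : R) : (fun s : R => ((y, s) : pt)) @ t --> ((y, t) : pt).
Proof.
have H : (fun s : R => (y, s)) @ t --> (y, t).
apply: (@cvg_pair _ _ _ _ (nbhs y) (nbhs t)); [exact: cvg_cst|exact: cvg_id].
exact: H.
Qed.

(** Fubini with the inner integral taken along direction [i]: on each line the fundamental theorem
    of calculus gives zero. *)
Lemma integral_pd_eq0 i h L : 0 < L -> (forall x, derivable h x (basis i)) ->
  continuous (pd i h) -> (forall x, L <= `|x| -> h x = 0) ->
  \int[mu]_x pd i h x = 0.
Proof.
move=> L0 dh ch h0.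
have ph0 x : L < `|x| -> pd i h x = 0.
  move=> Lx; apply: pd_near0.
  have : \forall y \near x, L < `|y|.
    exact: (cvgr_gt _ (@norm_continuous _ _ x) _ Lx).
  by apply: filterS => y /ltW; exact: h0.
have iph : mu.-integrable setT (EFin \o pd i h).
  apply: (@integrable_continuous_vanish _ _ (L + 1)) => // x Lx.
  by apply: ph0; rewrite (lt_le_trans _ Lx)// ltrDl.
have norm1 (x : pt) : `|x.1| <= `|x| by rewrite [leRHS]prod_normE le_max lexx.
have norm2 (x : pt) : `|x.2| <= `|x| by rewrite [leRHS]prod_normE le_max lexx orbT.
rewrite /Rintegral.
have [i0|i0] := eqVneq i 0.
- rewrite -(integral21_prod_meas1 iph) integral0_eq// => y _.
  rewrite /fubini_G; apply: (@integral_derivative_vanish (fun t => h (t, y))) L0 _ _ _ _.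
  + move=> t; have e (s : R) : (s, y) = (0, y) + s *: basis i :> pt.
      by rewrite i0 /basis eqxx; congr pair => /=; rewrite ?add0r /GRing.scale/= ?mulr1 ?mulr0 ?addr0.
    have := @is_derive_line R h (0, y) (basis i) t (dh _).
    by rewrite -e; under eq_fun do rewrite -e.
  + move=> t; apply: (@cvg_comp _ _ _ (fun s : R => ((s, y) : pt)) (pd i h) (nbhs t) _ _ _ (ch (t, y))).
    exact: cvg_pairl.
  + by move=> t Lt; apply: h0; exact: le_trans Lt (norm1 (t, y)).
  + by move=> t Lt; apply: ph0; exact: lt_le_trans Lt (norm1 (t, y)).
- rewrite -(integral12_prod_meas1 iph) integral0_eq// => y _.
  rewrite /fubini_F; apply: (@integral_derivative_vanish (fun t => h (y, t))) L0 _ _ _ _.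
  + move=> t; have e (s : R) : (y, s) = (y, 0) + s *: basis i :> pt.
      by rewrite /basis (negbTE i0); congr pair => /=; rewrite ?add0r /GRing.scale/= ?mulr1 ?mulr0 ?addr0.
    have := @is_derive_line R h (y, 0) (basis i) t (dh _).
    by rewrite -e; under eq_fun do rewrite -e.
  + move=> t; apply: (@cvg_comp _ _ _ (fun s : R => ((y, s) : pt)) (pd i h) (nbhs t) _ _ _ (ch (y, t))).
    exact: cvg_pairr.
  + by move=> t Lt; apply: h0; exact: le_trans Lt (norm2 (y, t)).
  + by move=> t Lt; apply: ph0; exact: lt_le_trans Lt (norm2 (y, t)).
Qed.

Lemma integrable_test w phi : test_function w phi ->
  mu.-integrable setT (EFin \o phi).
Proof.
move=> tf; have [L _ fL] := test_function_vanish tf.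
by apply: integrable_continuous_vanish fL;
  exact/smooth_continuous/(test_function_smooth tf).
Qed.

Lemma ip_pd w i phi psi : smooth phi -> test_function w psi ->
  ip mu phi (pd i psi) = - ip mu (pd i phi) psi.
Proof.
move=> sp tq; have sq := test_function_smooth tq.
have [L L0 qL] := test_function_vanish tq.
have tpq := test_functionM sp tq; have spq := test_function_smooth tpq.
have := @integral_pd_eq0 i (phi \* psi) L L0
  (fun x => @smooth_derivable _ _ i x spq) (smooth_continuous (smooth_pd i spq)).
have -> : pd i (phi \* psi) = (phi \* pd i psi) \+ (pd i phi \* psi).
  have -> : (pd i phi \* psi) = psi \* pd i phi by apply/funext => x /=; rewrite mulrC.
  by apply: pdM => x; exact: smooth_derivable.
have i1 := integrable_test (test_functionM sp (test_function_pd i tq)).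
have i2 := integrable_test (test_functionM (smooth_pd i sp) tq).
rewrite RintegralD// => /(_ _)/eqP; rewrite addr_eq0 => H; apply/eqP/H => x Lx.
by rewrite /= qL// mulr0.
Qed.

Lemma ip_pds w s phi psi : smooth phi -> test_function w psi -> (size s <= 2)%N ->
  ip mu phi (pds s psi) = (-1) ^+ size s * ip mu (pds s phi) psi.
Proof.
move=> sp tq; case: s => [|i [|j [|//]]] _ /=.
- by rewrite expr0 mul1r.
- by rewrite expr1 mulN1r; exact: ip_pd tq.
- rewrite sqrrN expr1n mul1r (ip_pd _ sp (test_function_pd j tq)).
  by rewrite (ip_pd _ (smooth_pd i sp) tq) opprK (pdC j i sp).
Qed.

Lemma smooth_fst : smooth (fun x : pt => x.1) /\ pd 0 (fun x : pt => x.1) = fun=> 1.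
Proof.
have E (x : pt) i : (fun h : R => h^-1 *: (((fun x : pt => x.1) \o shift x) (h *: basis i) - x.1))
    @ 0^' --> ((i == 0)%:R : R).
  apply: cvg_near_cst; near=> h => /=.
  rewrite addrK /basis; case: ifP => _ /=; last by rewrite !scaler0.
  rewrite /GRing.scale /= mulr1 mulVf//; near: h; exact: nbhs_dnbhs_neq.
have d (x : pt) i : derivable (fun x : pt => x.1) x (basis i).
  by apply/cvg_ex; exists ((i == 0)%:R : R); exact: E.
have e i : pd i (fun x : pt => x.1) = fun=> ((i == 0)%:R : R).
  by apply/funext => x; apply: cvg_lim => //; exact: E.
split; last by rewrite e eqxx.
apply/smoothP => -[|n]; (split; first by move=> x; exact: cvg_fst) => // i.
by split => //; rewrite e; exact: Cdiff_cst.
Unshelve. all: by end_near.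
Qed.

(* Integrating [pd 0 (x.1 * phi ^+ 2)], whose integral vanishes. *)
Lemma poincare w phi L : test_function w phi ->
  (forall x, w x -> `|x| <= L) ->
  ip mu phi phi <= 4 * L ^+ 2 * ip mu (pd 0 phi) (pd 0 phi).
Proof.
move=> tp wL; have [s1 d1] := smooth_fst.
have sp := test_function_smooth tp.
have txp := test_functionM s1 tp.
have H := ip_pd 0 (test_function_smooth txp) tp.
have E : ip mu (pd 0 ((fun x : pt => x.1) \* phi)) phi =
    ip mu phi phi + ip mu ((fun x : pt => x.1) \* pd 0 phi) phi.
  rewrite pdM; [|by move=> x; exact: smooth_derivable..].
  have -> : phi \* pd 0 (fun x : pt => x.1) = phi.
    by rewrite d1; apply/funext => x /=; rewrite mulr1.
  rewrite addrC ipDl//; try exact: sqint_test tp.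
  exact: sqint_test (test_functionM s1 (test_function_pd 0 tp)).
have tdp := test_function_pd 0 tp.
have E2 : ip mu ((fun x : pt => x.1) \* pd 0 phi) phi =
    ip mu ((fun x : pt => x.1) \* phi) (pd 0 phi).
  by apply: eq_Rintegral => x _ /=; ring.
rewrite E E2 in H.
have sqx := sqint_test txp; have sqd := sqint_test tdp; have sqp := sqint_test tp.
have CS := ip_CS sqx sqd.
have xb : ip mu ((fun x : pt => x.1) \* phi) ((fun x : pt => x.1) \* phi) <=
    L ^+ 2 * ip mu phi phi.
  have i1 := sqintM sqx sqx.
  rewrite /ip -RintegralZl//; last exact: sqintM.
  apply: le_Rintegral => //.
    exact: (integrableZl measurableT (L ^+ 2) (sqintM sqp sqp)).
  move=> x _ /=; rewrite mulrACA; have [wx|wx] := pselect (w x); last first.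
    by rewrite (test_function_off tp wx) !mulr0.
  rewrite ler_wpM2r// -?expr2 ?sqr_ge0//.
  rewrite -(real_normK (num_real x.1)) lerXn2r ?nnegrE// ?(le_trans _ (wL x wx))//.
  by rewrite prod_normE le_max lexx.
move: H CS xb (ip_ge0 mu phi) (ip_ge0 mu (pd 0 phi)) (ip_ge0 mu ((fun x : pt => x.1) \* phi)).
move: (ip mu phi phi) (ip mu (pd 0 phi) (pd 0 phi))
  (ip mu ((fun x : pt => x.1) \* phi) (pd 0 phi))
  (ip mu ((fun x : pt => x.1) \* phi) ((fun x : pt => x.1) \* phi)) => a b c e.
move=> H CS xb a0 b0 e0.
(* With [c ^+ 2 <= e * b] and [e <= L ^+ 2 * a] this gives [a ^+ 2 <= 4 * L ^+ 2 * a * b]; a factor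
   [a] is then cancelled. *)
have {H}H : a = - 2 * c by lra.
have H2 : a ^+ 2 <= 4 * L ^+ 2 * a * b.
  have -> : a ^+ 2 = 4 * c ^+ 2 by rewrite H; ring.
  have := ler_wpM2r b0 xb; nra.
have [a00|a1] := leP a 0.
  have -> : a = 0 by apply/eqP; rewrite eq_le a00.
  by rewrite mulr_ge0// mulr_ge0// sqr_ge0.
by rewrite -(ler_pM2r a1); rewrite -expr2; apply: le_trans H2 _; rewrite mulrAC.
Qed.

End by_parts.

(** * Functions flat at the origin *)

Section flat_functions.
Context {R : realType}.
Implicit Types (P : {poly R}) (s t : R).

(* Polynomials in [1/t] make the family [P(1/t) exp(-1/t)] stable under derivation. *)
Definition flat P t : R := if 0 < t then P.[t^-1] * expR (- t^-1) else 0.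

(** With [s = 1/t], the derivative of [P(s) exp(-s)] in [t] is [s^2 (P(s) - P'(s)) exp(-s)]. *)
Definition flat_deriv P : {poly R} := 'X^2 * (P - P^`()).

(** For positive [n], [expR s] is the [n]-th power of [expR (s / n)], which is at least [s / n]. *)
Lemma exprn_expRN_le (n : nat) s : 0 <= s -> s ^+ n * expR (- s) <= n%:R ^+ n.
Proof.
move=> s0; rewrite expRN ler_pdivrMr ?expR_gt0//.
case: n => [|n]; first by rewrite !expr0 mul1r -expR0 ler_expR.
have n0 : (0 : R) < n.+1%:R by rewrite ltr0n.
have -> : expR s = expR (s / n.+1%:R) ^+ n.+1.
  by rewrite -expRM_natl mulrC divfK// gt_eqF.
rewrite -exprMn lerXn2r ?nnegrE ?mulr_ge0 ?expR_ge0 ?(ltW n0)//.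
rewrite mulrC -ler_pdivrMr//; apply: le_trans (expR_ge1Dx _).
by rewrite lerDr.
Qed.

Lemma poly_expRN_bounded P : exists2 M : R, 0 <= M &
  forall s, 0 <= s -> `|P.[s] * expR (- s)| <= M.
Proof.
exists (\sum_(i < size P) `|P`_i| * i%:R ^+ i).
  by apply: sumr_ge0 => i _; rewrite mulr_ge0// exprn_ge0.
move=> s s0; rewrite horner_coef mulr_suml (le_trans (ler_norm_sum _ _ _))//.
apply: ler_sum => i _; rewrite -mulrA normrM ler_wpM2l//.
by rewrite ger0_norm ?exprn_expRN_le// mulr_ge0 ?expR_ge0// exprn_ge0.
Qed.

Lemma is_derive_flat P t : is_derive t 1 (flat P) (flat (flat_deriv P) t).
Proof.
have [t0|t0|<-] := ltgtP 0 t.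
- pose g s := P.[s^-1] * expR (- s^-1).
  have t1 : t != 0 by rewrite gt_eqF.
  have dg : is_derive t 1 g (flat (flat_deriv P) t).
    have dV : is_derive t 1 (fun s : R => s^-1) (- t ^- 2).
      have := @is_deriveV R id t 1 1 t1 (is_derive_id _ _).
      by move/is_derive_eq; apply; rewrite /GRing.scale /= mulr1.
    have dP : is_derive t 1 (fun s : R => P.[s^-1]) (- t ^- 2 * P^`().[t^-1]).
      have := @is_derive1_comp R (horner P) (fun s : R => s^-1) t _ _ (is_derive_poly P t^-1) dV.
      by move/is_derive_eq; apply; rewrite mulrC.
    have dE : is_derive t 1 (fun s : R => expR (- s^-1)) (t ^- 2 * expR (- t^-1)).
      have dN := is_deriveN dV.
      have := @is_derive1_comp R expR (fun s : R => - s^-1) t _ _ (is_derive_expR (- t^-1)) dN.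
      by move/is_derive_eq; apply; rewrite opprK mulrC.
    have := is_deriveM dP dE; move/is_derive_eq; apply.
    rewrite /flat t0 /flat_deriv /GRing.scale /= !hornerE exprVn.
    move: (t ^- 2) (expR _) P.[_] (P^`()).[_] => a b c d'; rewrite -[LHS]/(c * a * b + b * (- a) * d'); ring.
  have fg : {near t, g =1 flat P}.
    apply: filterS (cvgr_gt t (@cvg_id _ (nbhs t)) 0 t0) => s s0.
    by rewrite /flat s0.
  exact: near_eq_is_derive fg dg.
- have fg : {near t, (fun _ : R => 0 : R) =1 flat P}.
    apply: filterS (cvgr_lt t (@cvg_id _ (nbhs t)) 0 t0) => s s0.
    by rewrite /flat (lt_gtF s0).
  have := near_eq_is_derive fg (@is_derive_cst R R R 0 t 1).
  by rewrite /flat (lt_gtF t0).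
(* At 0 the difference quotient is [h] times a bounded function: the factor ['X^2] absorbs the
   missing [h ^- 2]. *)
- have [M M0 HM] := poly_expRN_bounded ('X^2 * P).
  have lim : (fun h : R => h^-1 *: ((flat P \o shift 0) (h *: 1) - flat P 0)) @ 0^' --> (0 : R).
    apply/cvgrPdist_le => e e0.
    near=> h; rewrite sub0r normrN.
    rewrite /flat ltxx subr0 /= addr0 scaler1 -[_ *: _]/(_ * _).
    case: ifP => h0; last by rewrite mulr0 normr0 ltW.
    have hn : h != 0 by rewrite gt_eqF.
    have hV : 0 <= h^-1 by rewrite invr_ge0 ltW.
    have H := HM _ hV; rewrite hornerM hornerXn in H.
    have -> : h^-1 * (P.[h^-1] * expR (- h^-1)) =
       h * (h^-1 ^+ 2 * P.[h^-1] * expR (- h^-1)) by field.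
    rewrite normrM (gtr0_norm h0).
    apply: (@le_trans _ _ (h * (M + 1))).
      by rewrite ler_wpM2l ?(ltW h0)// (le_trans H)// lerDl.
    rewrite -ler_pdivlMr ?ltr_wpDl//.
    rewrite -(gtr0_norm h0); near: h.
    by apply: dnbhs0_le; rewrite divr_gt0// ltr_wpDl.
  apply: DeriveDef; first by apply/cvg_ex; exists 0.
  by rewrite /derive (cvg_lim _ lim)// /flat ltxx.
Unshelve. all: by end_near.
Qed.

Lemma flat_le0 P t : t <= 0 -> flat P t = 0.
Proof. by rewrite /flat leNgt => /negbTE ->. Qed.

Lemma flat1_gt0 t : 0 < t -> flat 1 t = expR (- t^-1).
Proof. by rewrite /flat => ->; rewrite hornerC mul1r. Qed.

Lemma flat1_bound t : 0 <= flat 1 t <= 1.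
Proof.
rewrite /flat; case: ifP => t0; last by rewrite lexx ler01.
by rewrite hornerC mul1r expR_ge0/= -expR0 ler_expR oppr_le0 invr_ge0 ltW.
Qed.

Lemma flat1_scaled_cvg t : 0 < t -> flat 1 (n.+1%:R * t) @[n --> \oo] --> (1 : R).
Proof.
move=> t0.
have -> : (fun n => flat 1 (n.+1%:R * t)) = (fun n => expR (- (t^-1 * n.+1%:R^-1))).
  by apply/funext => n; rewrite flat1_gt0 ?mulr_gt0 ?ltr0n// invfM mulrC.
rewrite -[X in _ --> X]expR0 -[X in _ --> expR X]oppr0 -(mulr0 t^-1).
apply: continuous_cvg; first exact: continuous_expR.
by apply: cvgN; apply: cvgMr; exact: cvg_harmonic.
Qed.

End flat_functions.

(** * Smooth functions of one coordinate *)

Section coordinates.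
Context {R : realType}.
Local Notation pt := (plane R).

Definition coord (i : 'I_2) (x : pt) : R := if i == 0 then x.1 else x.2.

Lemma coord_basis i j (x : pt) (h : R) :
  coord i (h *: basis j + x) = h * (i == j)%:R + coord i x.
Proof.
rewrite /coord /basis.
case: i => [[|[|i]] hi] //; case: j => [[|[|j]] hj] //=.
Qed.

Lemma coord_continuous i : continuous (coord i).
Proof.
have -> : coord i = if i == 0 then fun x : pt => x.1 else fun x : pt => x.2.
  by apply/funext => x; rewrite /coord; case: ifP.
by case: ifP => _ x; [exact: cvg_fst|exact: cvg_snd].
Qed.

Lemma pd_coord (F f : R -> R) i j : (forall t : R, is_derive t 1 F (f t)) ->
  (forall x, derivable (F \o coord i) x (basis j)) /\
  pd j (F \o coord i) = if i == j then f \o coord i else fun=> 0.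
Proof.
move=> dF.
have E (x : pt) : (fun h : R => h^-1 *: ((F \o coord i \o shift x) (h *: basis j) - (F \o coord i) x))
    @ 0^' --> (if i == j then f (coord i x) else 0).
  case: ifP => ij.
    have := (@ex_derive _ _ _ _ _ _ _ (dF (coord i x))).
    have := (@derive_val _ _ _ _ _ _ _ (dF (coord i x))).
    rewrite /derive /derivable => <- /cvg_ex[l Hl]; rewrite (cvg_lim _ Hl)//.
    apply: cvg_trans Hl; apply: near_eq_cvg; near=> h => /=.
    by rewrite coord_basis ij.
  apply: cvg_near_cst; near=> h => /=.
  by rewrite coord_basis ij mulr0 add0r subrr scaler0.
split=> [x|]; first by apply/cvg_ex; eexists; exact: E.
by apply/funext => x; rewrite /pd /derive (cvg_lim _ (E x))//; case: ifP.
Unshelve. all: by end_near.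
Qed.

(** Smoothness by stability: when a family of functions of one variable is closed under derivation,
    no higher derivative has to be computed. *)
Lemma smooth_coord (S : set (R -> R)) i :
  (forall F, S F -> exists2 f, S f & forall t : R, is_derive t 1 F (f t)) ->
  forall F, S F -> smooth (F \o coord i).
Proof.
move=> HS; suff H n : forall F, S F -> Cdiff n (F \o coord i).
  by move=> F SF; apply/smoothP => n; exact: H.
have cF F : S F -> continuous (F \o coord i).
  move=> /HS[f _ dF] x; apply: continuous_comp; first exact: coord_continuous.
  by apply: differentiable_continuous; apply/derivable1_diffP;
    exact: (@ex_derive _ _ _ _ _ _ _ (dF (coord i x))).
elim: n => [|n IH] F SF; (split; first exact: cF) => // j.
have [f Sf dF] := HS F SF; have [d ->] := pd_coord i j dF; split => //.
by case: ifP => _; [exact: IH|exact: Cdiff_cst].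
Qed.

Lemma smooth_flat_coord i (c d : R) : smooth (fun x => flat 1 (c * coord i x + d)).
Proof.
pose S := [set F : R -> R | exists k P, F = fun t => k * flat P (c * t + d)].
apply: (@smooth_coord S i _ (fun t => flat 1 (c * t + d))); last first.
  by exists 1, 1; apply/funext => t; rewrite mul1r.
move=> _ [k [P ->]]; exists (fun t => k * c * flat (flat_deriv P) (c * t + d)).
  by exists (k * c), (flat_deriv P).
move=> t.
have dl : is_derive t 1 (fun t : R => c * t + d) c.
  have := is_deriveD (is_deriveZ c (is_derive_id t (1 : R))) (is_derive_cst d t (1 : R)).
  by move/is_derive_eq; apply; rewrite /GRing.scale /= mulr1 addr0.
have := is_deriveZ k (@is_derive1_comp R (flat P) _ t _ _ (is_derive_flat P _) dl).
by move/is_derive_eq; apply; rewrite /GRing.scale /=; ring.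
Qed.

End coordinates.

(** * The fundamental lemma of the calculus of variations *)

Section fundamental_lemma.
Context {R : realType}.
Local Notation pt := (plane R).
Local Notation mu := (lebesgue2 R).
Implicit Types (a b x : pt) (w A : set pt) (f g phi : pt -> R).

(** A product of [flat 1] at the distances to the four sides, scaled by [n.+1]. The scaling leaves
    the zero set unchanged while the values inside tend to 1. The support touches the sides, hence
    the closed rectangle in the first clause. *)
Lemma bump_sequence a b : exists phi : nat -> pt -> R,
  [/\ forall n w, crect a b `<=` w -> test_function w (phi n),
      forall n x, 0 <= phi n x <= 1,
      forall n x, ~ rect a b x -> phi n x = 0 &
      forall x, rect a b x -> phi n x @[n --> \oo] --> (1 : R)].
Proof.
pose r (n : nat) : R := n.+1%:R.
pose e (n : nat) i x := flat 1 (r n * (coord i x - coord i a)) *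
                        flat 1 (r n * (coord i b - coord i x)).
have r0 n : 0 < r n by rewrite ltr0n.
pose phi n x := e n 0 x * e n 1 x.
have se n i : smooth (e n i).
  have s1 := @smooth_flat_coord R i (r n) (- (r n * coord i a)).
  have s2 := @smooth_flat_coord R i (- r n) (r n * coord i b).
  have -> : e n i = (fun x => flat 1 (r n * coord i x + - (r n * coord i a))) \*
                    (fun x => flat 1 (- r n * coord i x + r n * coord i b)).
    apply/funext => x; rewrite /e /=; congr (flat _ _ * flat _ _); ring.
  exact: smoothM.
have e01 n i x : 0 <= e n i x <= 1.
  have /andP[h1 h2] := flat1_bound (r n * (coord i x - coord i a)).
  have /andP[h3 h4] := flat1_bound (r n * (coord i b - coord i x)).
  by rewrite mulr_ge0//= mulr_ile1.
have e0 n i x : ~ (coord i a < coord i x < coord i b) -> e n i x = 0.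
  move=> /negP; rewrite negb_and -!leNgt /e => /orP[h|h].
    by rewrite flat_le0 ?mul0r// pmulr_rle0// subr_le0.
  by rewrite [X in _ * X]flat_le0 ?mulr0// pmulr_rle0// subr_le0.
have rectE x : rect a b x <-> forall i : 'I_2, coord i a < coord i x < coord i b.
  split=> [[/=]|H].
    by rewrite !in_itv /= => h1 h2 [[|[|i]] hi].
  by split; rewrite /= in_itv /=; [exact: (H 0)|exact: (H 1)].
have off n x : ~ rect a b x -> phi n x = 0.
  move=> /rectE; rewrite /phi => H.
  have [h0|/e0 ->] := pselect (coord 0 a < coord 0 x < coord 0 b); last by rewrite mul0r.
  have [h1|/e0 ->] := pselect (coord 1 a < coord 1 x < coord 1 b); last by rewrite mulr0.
  exfalso; apply: H => i; case: i => [[|[|i]] hi] //.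
exists phi; split => //.
- move=> n w cw; apply/test_functionP; split; first exact: smoothM.
  exists (crect a b); split => //; first exact: compact_crect.
  by move=> x cx; apply: off => /rect_sub.
- move=> n x; have /andP[h1 h2] := e01 n 0 x; have /andP[h3 h4] := e01 n 1 x.
  by rewrite mulr_ge0//= mulr_ile1.
- move=> x /rectE H.
  have ec i : e n i x @[n --> \oo] --> (1 : R).
    have /andP[h1 h2] := H i; rewrite -[X in _ --> X]mulr1.
    by apply: cvgM; apply: flat1_scaled_cvg; rewrite subr_gt0.
  by rewrite -[X in _ --> X]mulr1; apply: cvgM.
Qed.

(** Dominated convergence along the bump functions; [g] times the indicator of the closed rectangle
    dominates in absolute value and is integrable because both factors are square integrable. *)
Lemma integral_rect_eq0 w g a b : crect a b `<=` w -> sqint mu g ->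
  (forall phi, test_function w phi -> ip mu g phi = 0) ->
  (\int[mu]_(x in rect a b) (g x)%:E = 0)%E.
Proof.
move=> cw sg H; have [phi [tphi b01 off lim]] := bump_sequence a b.
have tphi' n : test_function w (phi n) by exact: tphi.
have mg := sqint_measurable sg.
have i0 n : (\int[mu]_x (g x * phi n x)%:E = 0)%E.
  transitivity ((ip mu g (phi n))%:E); last by rewrite H.
  rewrite /ip /Rintegral fineK//; apply: integrable_fin_num => //.
  by apply: sqintM => //; exact: sqint_test (tphi' n).
have m1r : measurable_fun setT (\1_(rect a b) : pt -> R).
  by apply: measurable_indic; exact: measurable_rect.
have ch : sqint mu (\1_(crect a b) : pt -> R).
  by apply: sqint_indic; [exact: measurable_crect|exact: crect_finite].
have ig := integrable_abse (sqintM sg ch).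
rewrite integral_mkcond.
have -> : ((fun x => (g x)%:E) \_ (rect a b) = fun x => (g x * \1_(rect a b) x)%:E)%E.
  by rewrite -[LHS]/((EFin \o g) \_ _) restrict_EFin restrict_indicE.
have [] := @dominated_convergence _ _ _ mu setT measurableT
  (fun n x => (g x * phi n x)%:E) (fun x => (g x * \1_(rect a b) x)%:E) _ _ _ _ ig _.
- move=> n; apply/measurable_EFinP; apply: measurable_funM => //.
  exact/sqint_measurable/(sqint_test (tphi' n)).
- apply/measurable_EFinP; exact: measurable_funM.
- apply: aeW => x _; apply: cvg_EFin; first exact: nearW.
  apply: cvgMr; rewrite indicE; have [rx|rx] := pselect (rect a b x).
    by rewrite mem_set//; exact: lim.
  by rewrite memNset//; apply: cvg_near_cst; apply: nearW => n; exact: off.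
- apply: aeW => x n _; rewrite /= lee_fin !normrM ler_wpM2l//.
  have /andP[h1 h2] := b01 n x.
  have [cx|cx] := pselect (crect a b x).
    by rewrite indicE mem_set//= normr1 ger0_norm.
  by rewrite off ?normr0// => /rect_sub.
- move=> _ _; rewrite (_ : [sequence _]_n = fun=> 0%E).
    by move=> /cvg_lim <-//; exact: lim_cst.
  by apply/funext => n; exact: i0.
Qed.

(** Open strips are unions of rectangles of growing length, which puts all cylinders, and then all
    products, into the generated sigma-algebra. *)
Lemma measurable_plane_rect : @measurable _ (measurableTypeR R * measurableTypeR R)%type =
  <<s [set A : set pt | exists a b, A = rect a b] >>.
Proof.
set S := <<s _ >>.
have sS : sigma_algebra setT S := smallest_sigma_algebra _ _.
have [S0 SC SU] := sS.
have SCT A : S A -> S (~` A) by move=> /SC; rewrite setTD.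
have Sr a b : S (rect a b) by apply: sub_sigma_algebra; exists a, b.
rewrite eqEsubset; split; last first.
  by apply: smallest_sub; [exact: sigma_algebra_measurable|move=> _ [a [b ->]]; exact: measurable_rect].
have big (t : R) : exists n : nat, - n%:R < t < n%:R.
  exists (Num.truncn `|t|).+1; rewrite -ltr_norml; exact: truncnS_gt.
have SX (A : set R) : measurable A -> S (A `*` setT).
  suff sub : (@RGenOpens.G R).-sigma.-measurable `<=` [set A : set R | S (A `*` setT)].
    by move=> mA; apply: sub; rewrite -RGenOpens.measurableE.
  apply: smallest_sub.
    split=> /=; first by rewrite set0X.
    - move=> C SCC; have -> : (setT `\` C) `*` setT = ~` (C `*` setT) :> set pt.
        by apply/seteqP; split=> -[y z] /=; [move=> [[_ h] _] [h' _]|move=> h; split => //; split => // h'; exact: h].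
      exact: SCT.
    - move=> F SF; have -> : \bigcup_k F k `*` setT = \bigcup_k (F k `*` setT) :> set pt.
        by apply/seteqP; split=> [[y z] [[n _ h] _]|[y z] [n _ [h _]]]; [exists n|split => //; exists n].
      exact: SU.
  move=> _ [y [z ->]] /=.
  have -> : `]y, z[ `*` setT = \bigcup_n rect (y, - n%:R) (z, n%:R) :> set pt.
    apply/seteqP; split=> [[s t] [h _]|[s t] [n _ [h _]]] //.
    by have [n hn] := big t; exists n => //; split => //=; rewrite in_itv.
  exact: SU.
have SX' (B : set R) : measurable B -> S (setT `*` B).
  suff sub : (@RGenOpens.G R).-sigma.-measurable `<=` [set B : set R | S (setT `*` B)].
    by move=> mB; apply: sub; rewrite -RGenOpens.measurableE.
  apply: smallest_sub.
    split=> /=; first by rewrite setX0.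
    - move=> C SCC; have -> : setT `*` (setT `\` C) = ~` (setT `*` C) :> set pt.
        by apply/seteqP; split=> -[y z] /=; [move=> [_ [_ h]] [_ h']|move=> h; split => //; split => // h'; exact: h].
      exact: SCT.
    - move=> F SF; have -> : setT `*` \bigcup_k F k = \bigcup_k (setT `*` F k) :> set pt.
        by apply/seteqP; split=> [[y z] [_ [n _ h]]|[y z] [n _ [_ h]]]; [exists n|split => //; exists n].
      exact: SU.
  move=> _ [y [z ->]] /=.
  have -> : setT `*` `]y, z[ = \bigcup_n rect (- n%:R, y) (n%:R, z) :> set pt.
    apply/seteqP; split=> [[s t] [_ h]|[s t] [n _ [_ h]]] //.
    by have [n hn] := big s; exists n => //; split => //=; rewrite in_itv.
  exact: SU.
rewrite measurable_prod_measurableType; apply: smallest_sub => // _ [A mA [B mB <-]].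
have -> : A `*` B = ~` (~` (A `*` setT) `|` ~` (setT `*` B)) :> set pt.
  by rewrite setCU !setCK; apply/seteqP; split=> -[y z] [] // => -[h _] [_ h'].
apply: (SCT); have -> : ~` (A `*` setT) `|` ~` (setT `*` B) =
   \bigcup_n (if n is 0 then ~` (A `*` setT) else ~` (setT `*` B)) :> set pt.
  apply/seteqP; split=> [x [h|h]|x [[|n] _ h]].
  - by exists 0%N.
  - by exists 1%N.
  - by left.
  - by right.
by apply: SU => -[|n]; apply: SCT; [exact: SX|exact: SX'].
Qed.

(** The sets over which [g] has integral zero form a Dynkin system, the total integral being zero;
    rectangles are stable under intersection, so every measurable set belongs to it. *)
Lemma integrable_rects_eq0 g : mu.-integrable setT (EFin \o g) ->
  (\int[mu]_x (g x)%:E = 0)%E ->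
  (forall a b, (\int[mu]_(x in rect a b) (g x)%:E = 0)%E) ->
  {ae mu, forall x, g x = 0}.
Proof.
move=> ig i0 ir.
have mg : measurable_fun setT g by apply/measurable_EFinP; exact: (measurable_int mu).
pose Z := [set A : set pt | measurable A /\ (\int[mu]_(x in A) (g x)%:E = 0)%E].
have dZ : dynkin Z.
  split.
  - by split.
  - move=> A [mA A0]; split; first exact: measurableC.
    have : (\int[mu]_(x in A `|` ~` A) (g x)%:E = 0)%E by rewrite setUv.
    rewrite integral_setU_EFin ?A0 ?add0e//; first exact: measurableC.
      by rewrite setUv.
    by apply/disj_setPS; rewrite setICr.
  - move=> F tF HF; split; first by apply: bigcup_measurable => n _; have [] := HF n.
    rewrite integral_bigcup//; [|by move=> n; have [] := HF n|].
      by apply: eseries0 => n _ _; have [] := HF n.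
    apply: integrableS ig => //; apply: bigcup_measurable => n _; have [] := HF n => //.
pose G := [set A : set pt | exists a b, A = rect a b].
have GI : setI_closed G.
  move=> _ _ [a [b ->]] [c [d ->]].
  exists (Num.max a.1 c.1, Num.max a.2 c.2), (Num.min b.1 d.1, Num.min b.2 d.2).
  apply/seteqP; split=> -[y z]; rewrite /rect /= !in_itv /=.
    move=> [[/andP[h1 h2] /andP[h3 h4]] [/andP[h5 h6] /andP[h7 h8]]].
    by rewrite !gt_max !lt_min h1 h2 h3 h4 h5 h6 h7 h8.
  rewrite !gt_max !lt_min => -[/andP[/andP[h1 h2] /andP[h3 h4]] /andP[/andP[h5 h6] /andP[h7 h8]]].
  by rewrite h1 h2 h3 h4 h5 h6 h7 h8.
have GZ : @measurable _ (measurableTypeR R * measurableTypeR R)%type `<=` Z.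
  rewrite measurable_plane_rect -(setI_closed_g_dynkin_g_sigma_algebra GI).
  apply: smallest_sub => // _ [a [b ->]]; split; [exact: measurable_rect|exact: ir].
have := integral_ae_eq measurableT (g := fun=> 0%E) ig.
move=> /(_ _ _) H; have {H} : ae_eq mu setT (EFin \o g) (fun=> 0%E).
  by apply: H => // A _ mA; rewrite integral0; have [] := GZ _ mA.
by apply: filterS => x /(_ I) [].
Qed.

Lemma EFin_restrict g A x : ((g \_ A) x)%:E = ((EFin \o g) \_ A) x.
Proof. by rewrite !patchE; case: ifP. Qed.

Lemma fundamental_lemma w g : open w -> sqint mu g ->
  (forall phi, test_function w phi -> ip mu g phi = 0) ->
  {ae mu, forall x, w x -> g x = 0}.
Proof.
move=> ow sg H.
have [F [Fw wF]] := open_rect_cover ow.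
have mr a b : measurable (rect a b) by exact: measurable_rect.
have sub : forall n, {ae mu, forall x, (g \_ (rect (F n).1 (F n).2)) x = 0}.
  move=> n; set Q := rect _ _.
  have Qoo : (mu Q < +oo)%E.
    apply: le_lt_trans (crect_finite (F n).1 (F n).2).
    apply: le_measure; rewrite ?inE; [exact: measurable_rect|exact: measurable_crect|].
    exact: rect_sub.
  apply: integrable_rects_eq0.
  - by apply: sqint_integrable_restrict => //; exact: mr.
  - under eq_integral do rewrite EFin_restrict.
    rewrite -integral_mkcond.
    exact: integral_rect_eq0 H.
  - move=> a b; under eq_integral do rewrite EFin_restrict.
    rewrite -integral_mkcondr.
    (* The intersection is again a rectangle, and its closed version lies in that of [Q], hence in
       [w]. *)
    have -> : rect a b `&` Q = rect (Num.max a.1 (F n).1.1, Num.max a.2 (F n).1.2)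
        (Num.min b.1 (F n).2.1, Num.min b.2 (F n).2.2).
      apply/seteqP; split=> -[y z]; rewrite /Q /rect /= !in_itv /=.
        move=> [[/andP[h1 h2] /andP[h3 h4]] [/andP[h5 h6] /andP[h7 h8]]].
        by rewrite !gt_max !lt_min h1 h2 h3 h4 h5 h6 h7 h8.
      rewrite !gt_max !lt_min => -[/andP[/andP[h1 h2] /andP[h3 h4]] /andP[/andP[h5 h6] /andP[h7 h8]]].
      by rewrite h1 h2 h3 h4 h5 h6 h7 h8.
    apply: integral_rect_eq0 H => //; apply: subset_trans (Fw n) => -[y z].
    rewrite /crect /= !in_itv /= !ge_max !le_min.
    by move=> [/andP[/andP[_ h1] /andP[_ h2]] /andP[/andP[_ h3] /andP[_ h4]]]; rewrite h1 h2 h3 h4.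
apply: filterS (ae_foralln sub) => x Hx /wF[n _ rx].
by have := Hx n; rewrite patchE mem_set.
Qed.

End fundamental_lemma.

(** * Null sets and triangles *)

Section null_sets.
Context {R : realType}.
Local Notation pt := (plane R).
Local Notation mu := (lebesgue2 R).

Lemma affine_continuous (a b c : R) : continuous (fun x : pt => a * x.1 + b * x.2 + c).
Proof.
move=> x; apply: cvgD; last exact: cvg_cst.
by apply: cvgD; apply: cvgM; [exact: cvg_cst|exact: cvg_fst|exact: cvg_cst|exact: cvg_snd].
Qed.

(** A vertical line is a product with a singleton; any other line has singletons as vertical
    sections. *)
Lemma negligible_line (a b c : R) : (a != 0) || (b != 0) ->
  {ae mu, forall x, a * x.1 + b * x.2 + c != 0}.
Proof.
move=> ab; pose Z := [set x : pt | a * x.1 + b * x.2 + c = 0].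
have mZ : measurable Z.
  apply: closed_measurable_plane.
  have -> : Z = (fun x : pt => a * x.1 + b * x.2 + c) @^-1` [set 0] by [].
  by apply: closed_comp => // x _; exact: affine_continuous.
suff Z0 : mu Z = 0.
  exists Z; split => // x /= /negP; rewrite negbK => /eqP//.
have [b0|b0] := eqVneq b 0.
  have a0 : a != 0 by move: ab; rewrite b0 eqxx orbF.
  have ZE : Z = [set - c / a] `*` setT.
    apply/seteqP; split=> -[s t]; rewrite /Z /= b0 mul0r addr0.
      move=> /eqP; rewrite addr_eq0 => /eqP H; split => //.
      by rewrite -H mulrAC mulfV// mul1r.
    by move=> [-> _]; rewrite mulrC divfK// addNr.
  rewrite ZE /lebesgue2 product_measure1E//.
  by rewrite [X in (X * _)%E]lebesgue_measure_set1 mul0e.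
rewrite /lebesgue2 /product_measure1 /= integral0_eq// => s _.
have -> : xsection Z s = [set - (c + a * s) / b].
  apply/seteqP; split=> t; rewrite /xsection /= inE /Z /=.
    move=> /eqP; rewrite addrAC addr_eq0 => /eqP H.
    by apply: (mulfI b0); rewrite [RHS]mulrC divfK// addrC H opprK.
  by move=> ->; rewrite [b * _]mulrC divfK//; ring.
exact: lebesgue_measure_set1.
Qed.

Lemma ae_all_seq (I : eqType) (s : seq I) (P : I -> pt -> Prop) :
  (forall i, i \in s -> {ae mu, forall x, P i x}) ->
  {ae mu, forall x, forall i, i \in s -> P i x}.
Proof.
elim: s => [|i s IH] H; first by apply: aeW => x i; rewrite in_nil.
have Hi := H i (mem_head _ _).
have Hs := IH (fun j js => H j (@mem_behead _ (i :: s) j js)).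
apply: ae_imp (ae_and Hi Hs) _ => x [Pi Ps] j; rewrite inE => /orP[/eqP ->//|]; exact: Ps.
Qed.

Lemma ae_all_fin (I : finType) (P : I -> pt -> Prop) :
  (forall i, {ae mu, forall x, P i x}) -> {ae mu, forall x, forall i, P i x}.
Proof.
move=> H; have := @ae_all_seq _ (enum I) P (fun i _ => H i).
by move/ae_imp; apply => x Hx i; apply: Hx; rewrite mem_enum.
Qed.

Lemma ae_not_boundary (Omega : set pt) (E : seq (pt * pt)) :
  boundary_edges Omega E -> {ae mu, forall x, ~ boundary Omega x}.
Proof.
move=> [-> Ene _ _].
have : {ae mu, forall x, forall e, e \in E ->
    ~ [set seg_pt e t | t in `[0, 1]%classic] x}.
  apply: ae_all_seq => e /Ene e12.
  pose d := e.2 - e.1.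
  have d0 : (- d.2 != 0) || (d.1 != 0).
    rewrite oppr_eq0 -negb_and; apply: contra e12 => /andP[/eqP h1 /eqP h2].
    by rewrite eq_sym -subr_eq0; apply/eqP; apply/eqP; rewrite xpair_eqE; apply/andP; split; apply/eqP.
  have := negligible_line (d.2 * e.1.1 - d.1 * e.1.2) d0.
  move/ae_imp; apply => x /eqP H [t _ xE]; apply: H.
  rewrite -xE /seg_pt -/d /= /GRing.scale /=; ring.
by move/ae_imp; apply => x H [e eE]; exact: H.
Qed.

End null_sets.

(** * Barycentric coordinates *)

Section barycentric.
Context {R : realType}.
Local Notation pt := (plane R).
Local Notation mu := (lebesgue2 R).
Implicit Types (T : triangle R) (x : pt).

Lemma ord3P (P : 'I_3 -> Prop) : P 0 -> P 1 -> P 2%:R -> forall i, P i.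
Proof.
move=> P0 P1 P2 [[|[|[|i]]] hi] //.
- by rewrite (_ : Ordinal hi = 0)//; exact/val_inj.
- by rewrite (_ : Ordinal hi = 1)//; exact/val_inj.
- by rewrite (_ : Ordinal hi = 2%:R)//; exact/val_inj.
Qed.

Lemma sum3 (V : zmodType) (F : 'I_3 -> V) : \sum_i F i = F 0 + F 1 + F 2%:R.
Proof.
rewrite !big_ord_recl big_ord0 addr0 addrA; congr (F _ + F _ + F _); exact/val_inj.
Qed.

(** Cramer's rule for the coordinates of indices 1 and 2; the one of index 0 completes the sum to
    1. *)
Definition bary T (i : 'I_3) x : R :=
  let l1 := ((x - T 0).1 * (T 2%:R - T 0).2 - (x - T 0).2 * (T 2%:R - T 0).1) / det3 T in
  let l2 := ((T 1 - T 0).1 * (x - T 0).2 - (T 1 - T 0).2 * (x - T 0).1) / det3 T in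
  if i == 0 then 1 - l1 - l2 else if i == 1 then l1 else l2.

Lemma bary_sum T x : \sum_i bary T i x = 1.
Proof. by rewrite sum3 /bary /=; ring. Qed.

Lemma pairZ (k u v : R) : k *: ((u, v) : pt) = (k * u, k * v). Proof. by []. Qed.
Lemma pairD (u v u' v' : R) : ((u, v) : pt) + (u', v') = (u + u', v + v'). Proof. by []. Qed.

Lemma bary_comb T x : det3 T != 0 -> x = \sum_i bary T i x *: T i.
Proof.
rewrite sum3 /bary /det3 /=.
move: (T 0) (T 1) (T 2%:R) x => [a0 b0] [a1 b1] [a2 b2] [x y].
rewrite /= => d0; rewrite !pairZ !pairD.
by congr pair => /=; field; exact: d0.
Qed.

Lemma bary_unique T (l : 'I_3 -> R) x : det3 T != 0 -> \sum_i l i = 1 ->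
  x = \sum_i l i *: T i -> forall i, l i = bary T i x.
Proof.
move=> d0; rewrite !sum3 => l1 ->.
have {l1}l0 : l 0 = 1 - l 1 - l 2%:R by rewrite -l1; ring.
suff [h1 h2] : l 1 = bary T 1 (l 0 *: T 0 + l 1 *: T 1 + l 2%:R *: T 2%:R) /\
    l 2%:R = bary T 2%:R (l 0 *: T 0 + l 1 *: T 1 + l 2%:R *: T 2%:R).
  apply: ord3P => //; move: h1 h2; set y := (_ + _ : plane R) => h1 h2.
  have -> : bary T 0 y = 1 - bary T 1 y - bary T 2%:R y by [].
  by rewrite -h1 -h2.
move: d0; rewrite /bary /det3 /= l0.
move: (T 0) (T 1) (T 2%:R) => [a0 b0] [a1 b1] [a2 b2].
rewrite /= => d0; rewrite -![_ *: _]/(_ * _).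
by split; field.
Qed.

(** Not constant, since it is 1 at the vertex [T i] and 0 at the next one, [i + 1] being cyclic in
    ['I_3]. Its zero set is therefore a line. *)
Lemma bary_affine T i : det3 T != 0 -> exists a b c : R,
  (a != 0) || (b != 0) /\ forall x, bary T i x = a * x.1 + b * x.2 + c.
Proof.
move=> d0.
have [a [b [c E]]] : exists a b c : R, forall x, bary T i x = a * x.1 + b * x.2 + c.
  have [a1 [b1 [c1 E1]]] : exists a b c : R, forall x, bary T 1 x = a * x.1 + b * x.2 + c.
    exists ((T 2%:R - T 0).2 / det3 T), (- (T 2%:R - T 0).1 / det3 T),
      (((T 0).2 * (T 2%:R - T 0).1 - (T 0).1 * (T 2%:R - T 0).2) / det3 T) => x.
    by rewrite /bary /=; field.
  have [a2 [b2 [c2 E2]]] : exists a b c : R, forall x, bary T 2%:R x = a * x.1 + b * x.2 + c.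
    exists (- (T 1 - T 0).2 / det3 T), ((T 1 - T 0).1 / det3 T),
      (((T 0).1 * (T 1 - T 0).2 - (T 0).2 * (T 1 - T 0).1) / det3 T) => x.
    by rewrite /bary /=; field.
  move: i; apply: ord3P; [|by exists a1, b1, c1|by exists a2, b2, c2].
  exists (- a1 - a2), (- b1 - b2), (1 - c1 - c2) => x.
  have -> : bary T 0 x = 1 - bary T 1 x - bary T 2%:R x by [].
  by rewrite E1 E2; ring.
exists a, b, c; split => //.
have V j : bary T i (T j) = (i == j)%:R.
  symmetry; apply: (@bary_unique T (fun k => (k == j)%:R)) => //.
    by rewrite (bigD1 j)//= eqxx big1 ?addr0// => k /negbTE ->.
  by rewrite (bigD1 j)//= eqxx scale1r big1 ?addr0// => k /negbTE ->; rewrite scale0r.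
apply/negPn; rewrite negb_or !negbK; apply/negP => /andP[/eqP a0 /eqP b0].
have Vi := V i; have Vj := V (i + 1).
rewrite E a0 b0 !mul0r !add0r eqxx in Vi.
rewrite E a0 b0 !mul0r !add0r in Vj.
have ij : i == i + 1 = false by move: i {E V Vi Vj}; apply: ord3P.
by move: Vi; rewrite Vj ij => /eqP; rewrite eq_sym oner_eq0.
Qed.

Lemma ae_bary T i : det3 T != 0 -> {ae mu, forall x, bary T i x != 0}.
Proof.
move=> d0; have [a [b [c [ab E]]]] := bary_affine i d0.
by apply: ae_imp (negligible_line c ab) _ => x; rewrite E.
Qed.

Lemma open_triangleE T : det3 T != 0 ->
  open_triangle T = [set x | forall i, 0 < bary T i x].
Proof.
move=> d0; apply/seteqP; split=> x.
  by move=> [l [lp l1 xl]] i; rewrite -(bary_unique d0 l1 xl).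
by move=> H; exists (bary T ^~ x); split; [|exact: bary_sum|exact: bary_comb].
Qed.

Lemma open_open_triangle T : det3 T != 0 -> open (open_triangle T).
Proof.
move=> d0; rewrite (open_triangleE d0).
have -> : [set x | forall i, 0 < bary T i x] =
  [set x | 0 < bary T 0 x] `&` [set x | 0 < bary T 1 x] `&` [set x | 0 < bary T 2%:R x].
  apply/seteqP; split=> [x H|x [[h0 h1] h2]]; last exact: ord3P.
  by split; [split; exact: H|exact: H].
have op i : open [set x | 0 < bary T i x].
  have [a [b [c [_ E]]]] := bary_affine i d0.
  rewrite (_ : [set x | _] = (fun x : pt => a * x.1 + b * x.2 + c) @^-1` [set y | 0 < y]).
    by apply: open_comp => [x _|]; [exact: affine_continuous|exact: open_gt].
  by apply/seteqP; split=> x /=; rewrite E.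
by apply: openI => //; exact: openI.
Qed.

Lemma face_bary T (I : pred 'I_3) x i : det3 T != 0 -> face T I x -> ~~ I i ->
  bary T i x = 0.
Proof. by move=> d0 [l [_ lI l1 xl]] /lI; rewrite (bary_unique d0 l1 xl). Qed.

Lemma closed_triangle_bary T x i : det3 T != 0 -> closed_triangle T x ->
  0 <= bary T i x.
Proof. by move=> d0 [l [lp _ l1 xl]]; rewrite -(bary_unique d0 l1 xl). Qed.

Lemma open_sub_closed_triangle T : open_triangle T `<=` closed_triangle T.
Proof. by move=> x [l [lp l1 xl]]; exists l; split => // i; exact: ltW. Qed.

End barycentric.

(** Away from the zero lines of all barycentric coordinates and from the boundary, closed and open
    triangles contain the same points. Such a point lies in at most one triangle: the common face of
    two triangles is proper, so some coordinate vanishes on it. *)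
Lemma mesh_indicator {R : realType} (Omega : set (plane R))
    (E : seq (plane R * plane R)) (N : nat) (T : 'I_N -> triangle R) :
  open Omega -> boundary_edges Omega E -> conforming_mesh Omega T ->
  {ae lebesgue2 R, forall x,
     \sum_k \1_(open_triangle (T k)) x = \1_Omega x :> R}.
Proof.
move=> oO bE [d0 cov conf].
have h1 : {ae lebesgue2 R, forall x, forall (ki : 'I_N * 'I_3), bary (T ki.1) ki.2 x != 0}.
  by apply: ae_all_fin => ki; apply: ae_bary.
apply: ae_imp (ae_and h1 (ae_not_boundary bE)) _ => x [Hx Bx].
have xc k : closed_triangle (T k) x -> open_triangle (T k) x.
  move=> c; rewrite open_triangleE// => i.
  by rewrite lt_neqAle eq_sym (Hx (k, i)) closed_triangle_bary.
have [Ox|Ox] := pselect (Omega x).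
  have : (\bigcup_(k in [set: 'I_N]) closed_triangle (T k)) x.
    by rewrite cov; exact: subset_closure.
  move=> [k _ /[dup] ck /xc ok].
  rewrite (bigD1 k)//= big1 => [|l lk]; first by rewrite !indicE !mem_set// addr0.
  rewrite indicE memNset// => /open_sub_closed_triangle cl.
  have kl : k != l by rewrite eq_sym.
  have [I [J [I3 _ _ IJ]]] := conf k l kl.
  have fx : face (T k) I x by rewrite -IJ.
  have [i nI] : exists i, ~~ I i.
    apply/existsP; rewrite -negb_forall; apply: contraTN I3 => /forallP aI.
    by rewrite (eq_card (B := predT)) ?card_ord// => i; rewrite inE; exact: aI.
  by have := Hx (k, i); rewrite /= (face_bary (d0 k) fx nI) eqxx.
rewrite big1 => [|k _]; first by rewrite indicE memNset.
rewrite indicE memNset// => /open_sub_closed_triangle cl.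
apply: Bx; split.
  by rewrite -cov; exists k.
by move=> /interior_subset.
Qed.

(** * Integrals up to null sets *)

Section ip_ae.
Context d (T : measurableType d) (R : realType) (mu : {measure set T -> \bar R}).
Implicit Types f g h : T -> R.

Lemma Rintegral_ae_eq f g : mu.-integrable setT (EFin \o f) ->
  mu.-integrable setT (EFin \o g) -> {ae mu, forall x, f x = g x} ->
  \int[mu]_x f x = \int[mu]_x g x.
Proof.
move=> fi gi fg; congr fine; apply: ae_eq_integral => //.
- exact: (measurable_int mu).
- exact: (measurable_int mu).
- by apply: ae_imp fg _ => x -> _.
Qed.

Lemma Rintegral_ae_ge0 f : mu.-integrable setT (EFin \o f) ->
  {ae mu, forall x, 0 <= f x} -> 0 <= \int[mu]_x f x.
Proof.
move=> fi f0.
rewrite (@Rintegral_ae_eq f (fun x => `|f x|))//.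
- exact: Rintegral_ge0.
- by have := integrable_abse fi.
- by apply: ae_imp f0 _ => x /ger0_norm ->.
Qed.

Lemma Rintegral_ae_le f g : mu.-integrable setT (EFin \o f) ->
  mu.-integrable setT (EFin \o g) -> {ae mu, forall x, f x <= g x} ->
  \int[mu]_x f x <= \int[mu]_x g x.
Proof.
move=> fi gi fg; rewrite -subr_ge0 -RintegralB//; apply: Rintegral_ae_ge0.
  by have := integrableB measurableT gi fi.
by apply: ae_imp fg _ => x; rewrite subr_ge0.
Qed.

Lemma sqint_dom f h : measurable_fun setT f -> mu.-integrable setT (EFin \o h) ->
  {ae mu, forall x, f x ^+ 2 <= h x} -> sqint mu f.
Proof.
move=> mf /integrableP[mh ih] fh; apply/sqintP; split => //; apply/integrableP; split.
  by apply/measurable_EFinP; exact: measurable_funX.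
apply: le_lt_trans ih; apply: ae_ge0_le_integral => //.
- by apply/measurable_EFinP; apply: measurableT_comp => //; exact: measurable_funX.
- exact: measurableT_comp.
- apply: ae_imp fh _ => x H _.
  by rewrite /= lee_fin ger0_norm ?sqr_ge0// (le_trans H)// ler_norm.
Qed.

Lemma ip_ae f f' g g' : sqint mu f -> sqint mu f' -> sqint mu g -> sqint mu g' ->
  {ae mu, forall x, f x = f' x} -> {ae mu, forall x, g x = g' x} ->
  ip mu f g = ip mu f' g'.
Proof.
move=> sf sf' sg sg' ff gg; apply: Rintegral_ae_eq; [exact: sqintM|exact: sqintM|].
by apply: ae_imp (ae_and ff gg) _ => x [-> ->].
Qed.

Lemma ip_sumr n (F : 'I_n -> T -> R) g : sqint mu g ->
  (forall k, sqint mu (F k)) ->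
  ip mu g (fun x => \sum_k F k x) = \sum_k ip mu g (F k).
Proof.
move=> sg; elim: n F => [|n IH] F sF.
  by rewrite big_ord0 ipC; under eq_fun do rewrite big_ord0; rewrite ip0l.
rewrite big_ord_recl -IH// -ipDr//; last exact: sqint_sum.
by congr (ip _ _ _); apply/funext => x; rewrite big_ord_recl.
Qed.

Lemma ip_restrict f g (w : set T) : ip mu (f \_ w) (g \_ w) = ip mu (f \_ w) g.
Proof.
by apply: eq_Rintegral => x _; rewrite !patchE; case: ifP => //; rewrite !mul0r.
Qed.

Lemma Rintegral_ip f g (w : set T) :
  \int[mu]_(x in w) (f x * g x) = ip mu (f \_ w) g.
Proof.
rewrite Rintegral_mkcond; apply: eq_Rintegral => x _.
by rewrite !patchE; case: ifP => //; rewrite mul0r.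
Qed.

Lemma cvg2_restrict (F : nat -> T -> R) f (w : set T) : measurable w ->
  (forall n x, ~ w x -> F n x = 0) -> cvg2 mu F f -> cvg2 mu F (f \_ w).
Proof.
move=> mw F0 [sF sf Ff].
have sfw := sqint_restrict mw sf.
split => //; apply: (squeeze_cvgr _ (cvg_cst 0) Ff); near=> n; rewrite ip_ge0/=.
have -> : F n \- f \_ w = (F n \- f) \_ w.
  apply/funext => x; rewrite /= !patchE; case: ifPn => // /negP xw.
  by rewrite F0 ?subrr// => wx; apply: xw; rewrite inE.
have sB := sqintB (sF n) sf.
apply: le_Rintegral => //.
- by apply: sqintM; exact: sqint_restrict.
- exact: sqintM.
- by move=> x _; rewrite patchE; case: ifP => _ //; rewrite mul0r -expr2 sqr_ge0.
Unshelve. all: by end_near.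
Qed.

Lemma cvg2B F G f g : cvg2 mu F f -> cvg2 mu G g ->
  cvg2 mu (fun n => F n \- G n) (f \- g).
Proof.
move=> Ff Gg; have := cvg2D Ff (cvg2Z (-1) Gg).
have E (a b : T -> R) : a \+ (fun x => -1 * b x) = a \- b.
  by apply/funext => x /=; rewrite mulN1r.
by rewrite E; under eq_fun do rewrite E.
Qed.

End ip_ae.

(** * Weak derivatives *)

Section weak_derivatives.
Context {R : realType}.
Local Notation pt := (plane R).
Local Notation mu := (lebesgue2 R).
Implicit Types (w : set pt) (f g v phi : pt -> R).

Lemma L2P w f : L2 w f <-> sqint mu (f \_ w).
Proof. by []. Qed.

Lemma L2normE w f : L2 w f -> L2norm w f = Num.sqrt (ip mu (f \_ w) (f \_ w)).
Proof.
move=> sf; have sf' : sqint mu (f \_ w) by exact/L2P.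
have i0 := ip_ge0 mu (f \_ w).
rewrite /L2norm -[LHS]ger0_norm; last by rewrite fine_ge0// Lnorm_ge0.
rewrite -sqrtr_sqr; congr Num.sqrt.
have fin : ('N[mu]_2%:E [EFin \o f \_ w] \is a fin_num)%E.
  rewrite ge0_fin_numE ?Lnorm_ge0//.
  by move: sf; rewrite /L2 inE => /andP[_]; rewrite inE.
rewrite -powR_mulrn ?fine_ge0 ?Lnorm_ge0//.
apply: EFin_inj; rewrite -poweR_EFin fineK// powR_Lnorm//.
rewrite /ip /Rintegral fineK; last by apply: integrable_fin_num => //; exact: sqintM.
by apply: eq_integral => x _; rewrite /= powR_mulrn// -expr2 real_normK ?num_real.
Qed.

Lemma weak_derivativeE w s v g : weak_derivative w s v g <->
  forall phi, test_function w phi ->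
    ip mu (v \_ w) (pds s phi) = (-1) ^+ size s * ip mu (g \_ w) phi.
Proof. by split=> H phi /H; rewrite !Rintegral_ip. Qed.

Lemma restrict_ae w f g : {ae mu, forall x, w x -> f x = g x} ->
  {ae mu, forall x, (f \_ w) x = (g \_ w) x}.
Proof.
by move=> fg; apply: ae_imp fg _ => x H; rewrite !patchE; case: ifP => //; rewrite inE => /H.
Qed.

Lemma eqae_ip0 w f g : open w -> L2 w f -> L2 w g ->
  (forall phi, test_function w phi -> ip mu (f \_ w) phi = ip mu (g \_ w) phi) ->
  {ae mu, forall x, w x -> f x = g x}.
Proof.
move=> ow sf sg H.
have := @fundamental_lemma R w (f \_ w \- g \_ w) ow (sqintB sf sg).
have H' phi : test_function w phi -> ip mu (f \_ w \- g \_ w) phi = 0.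
  by move=> tp; rewrite ipBl ?(sqint_test tp)// H// subrr.
move=> /(_ H') H0; apply: ae_imp H0 _ => x Hx wx.
by have := Hx wx; rewrite /= !patchE mem_set// => /eqP; rewrite subr_eq0 => /eqP.
Qed.

Lemma weak_derivative_unique w s v g g' : open w -> L2 w g -> L2 w g' ->
  weak_derivative w s v g -> weak_derivative w s v g' ->
  {ae mu, forall x, w x -> g x = g' x}.
Proof.
move=> ow sg sg' /weak_derivativeE H /weak_derivativeE H'.
apply: eqae_ip0 => // phi tp; have := H _ tp; rewrite (H' _ tp).
by move=> /(mulfI _) ->//; rewrite signr_eq0.
Qed.

Lemma wpdP w s v : (exists g, L2 w g /\ weak_derivative w s v g) ->
  L2 w (wpd w s v) /\ weak_derivative w s v (wpd w s v).
Proof. by move=> H; apply: (@xgetPex _ (fun=> 0) [set g | L2 w g /\ weak_derivative w s v g]). Qed.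

Lemma wpd_ae w s v g : open w -> L2 w g -> weak_derivative w s v g ->
  {ae mu, forall x, w x -> wpd w s v x = g x}.
Proof.
move=> ow sg vg; have [h1 h2] := @wpdP w s v (ex_intro _ g (conj sg vg)).
exact: weak_derivative_unique h2 vg.
Qed.

Lemma weak_derivativeC w i j v g :
  weak_derivative w [:: i; j] v g -> weak_derivative w [:: j; i] v g.
Proof.
move=> /weak_derivativeE vg; apply/weak_derivativeE => phi tp.
have E : pds [:: j; i] phi = pds [:: i; j] phi.
  exact: (@pdC R phi j i (test_function_smooth tp)).
by rewrite E; exact: (vg phi tp).
Qed.

(** The two sets of candidates coincide, so the choice operator returns the same function: the
    equality holds everywhere. *)
Lemma wpdC w i j v : wpd w [:: i; j] v = wpd w [:: j; i] v.
Proof.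
pose S s := [set g | L2 w g /\ weak_derivative w s v g].
have E : S [:: i; j] = S [:: j; i].
  by apply/seteqP; split=> g [sg vg]; (split; first exact: sg); exact: weak_derivativeC.
exact: (congr1 (xget (fun=> 0)) E).
Qed.

Lemma weak_derivative_ae w s v v' g : measurable w -> L2 w v -> L2 w v' ->
  {ae mu, forall x, w x -> v x = v' x} ->
  weak_derivative w s v g -> weak_derivative w s v' g.
Proof.
move=> mw sv sv' vv /weak_derivativeE H; apply/weak_derivativeE => phi tp.
rewrite -H//; apply: ip_ae => //.
- exact/(sqint_test (test_function_pds s tp)).
- exact/(sqint_test (test_function_pds s tp)).
- by apply/restrict_ae; apply: ae_imp vv _ => x H' /H' ->.
- by apply: aeW.
Qed.

End weak_derivatives.

(** * Symmetric matrices of size two *)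

Lemma sum2 (V : zmodType) (F : 'I_2 -> V) : \sum_i F i = F 0 + F 1.
Proof. by rewrite !big_ord_recl big_ord0 addr0; congr (F _ + F _); exact/val_inj. Qed.

Lemma ord2P (P : 'I_2 -> Prop) : P 0 -> P 1 -> forall i, P i.
Proof.
move=> P0 P1 [[|[|i]] hi] //.
- by rewrite (_ : Ordinal hi = 0)//; exact/val_inj.
- by rewrite (_ : Ordinal hi = 1)//; exact/val_inj.
Qed.

Section symmetric_matrices.
Context {R : realType}.
Implicit Types A B : 'M[R]_2.

(** The tensor is measurable by assumption on symmetric arguments only, so fields are expanded in
    symmetric units and not in [delta_mx]. *)
Definition sym_unit (k l : 'I_2) : 'M[R]_2 := 2^-1 *: (delta_mx k l + delta_mx l k).

Lemma sym_unit_sym k l : sym (sym_unit k l).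
Proof. by rewrite /sym /sym_unit linearZ linearD /= !trmx_delta addrC. Qed.

Lemma sym_decomposition A : sym A -> A = \sum_k \sum_l A k l *: sym_unit k l.
Proof.
move=> sA; have s10 : A 1 0 = A 0 1 by rewrite -{1}sA mxE.
apply/matrixP => i j; rewrite !sum2 !mxE.
move: i j; apply: ord2P; apply: ord2P => /=; rewrite ?s10; lra.
Qed.

Lemma frob_ge0 A : 0 <= frob A A.
Proof. by apply: sumr_ge0 => i _; apply: sumr_ge0 => j _; rewrite -expr2 sqr_ge0. Qed.

Lemma entry_le_sum (q : 'I_2 -> 'I_2 -> R) i j : (forall k l, 0 <= q k l) ->
  q i j <= q 0 0 + q 0 1 + (q 1 0 + q 1 1).
Proof.
move=> h; have := h 0 0; have := h 0 1; have := h 1 0; have := h 1 1.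
by move: i j; apply: ord2P; apply: ord2P; lra.
Qed.

Lemma frob_entry A i j : A i j ^+ 2 <= frob A A.
Proof.
rewrite /frob !sum2 -!expr2.
by apply: (@entry_le_sum (fun k l => A k l ^+ 2)) => k l; exact: sqr_ge0.
Qed.

End symmetric_matrices.

(** * Tensor fields *)

Section tensor_fields.
Context {R : realType}.
Local Notation pt := (plane R).
Local Notation mu := (lebesgue2 R).
Implicit Types (M N P : 'I_2 -> 'I_2 -> pt -> R).

(** Fields are stored as families of scalar entries, to which the L2 calculus applies one by one;
    [mx] returns to matrices where the tensor acts. *)
Definition mx M (x : pt) : 'M[R]_2 := \matrix_(i, j) M i j x.
Definition sqt M := forall i j, sqint mu (M i j).
Definition symt M := forall i j, M i j = M j i.
Definition ipt M N : R := \sum_i \sum_j ip mu (M i j) (N i j).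
Definition addt M N : 'I_2 -> 'I_2 -> pt -> R := fun i j => M i j \+ N i j.
Definition scalet (k : R) M : 'I_2 -> 'I_2 -> pt -> R := fun i j x => k * M i j x.
Definition subt M N : 'I_2 -> 'I_2 -> pt -> R := fun i j => M i j \- N i j.

Lemma mx_sym M x : symt M -> sym (mx M x).
Proof. by move=> sM; apply/matrixP => i j; rewrite !mxE sM. Qed.

Lemma frob_mx M N x : frob (mx M x) (mx N x) = \sum_i \sum_j M i j x * N i j x.
Proof. by apply: eq_bigr => i _; apply: eq_bigr => j _; rewrite !mxE. Qed.

Lemma ipt_int M N : sqt M -> sqt N ->
  mu.-integrable setT (fun x => (frob (mx M x) (mx N x))%:E) /\
  ipt M N = \int[mu]_x frob (mx M x) (mx N x).
Proof.
move=> sM sN; have i2 i j := sqintM (sM i j) (sN i j).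
have iD (f g : pt -> R) : mu.-integrable setT (EFin \o f) -> mu.-integrable setT (EFin \o g) ->
  mu.-integrable setT (EFin \o (f \+ g)) by move=> h1 h2; exact: (integrableD measurableT h1 h2).
pose r i x := M i 0 x * N i 0 x + M i 1 x * N i 1 x.
have ir i : mu.-integrable setT (EFin \o r i) by exact: iD (i2 i 0) (i2 i 1).
have E : (fun x => frob (mx M x) (mx N x)) = (fun x => r 0 x + r 1 x).
  by apply/funext => x; rewrite frob_mx !sum2.
split.
  have := iD _ _ (ir 0) (ir 1).
  by congr (is_true (integrable _ _ _)); apply/funext => x /=; rewrite -(congr1 (fun f => f x) E).
rewrite [RHS](_ : _ = \int[mu]_x (r 0 x + r 1 x)); last by congr (Rintegral _ _ _).
rewrite RintegralD//; rewrite /ipt !sum2 /ip.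
by congr (_ + _); rewrite RintegralD//; exact: i2.
Qed.

Lemma iptC M N : ipt M N = ipt N M.
Proof. by apply: eq_bigr => i _; apply: eq_bigr => j _; rewrite ipC. Qed.

Lemma iptDl M N P : sqt M -> sqt N -> sqt P -> ipt (addt M N) P = ipt M P + ipt N P.
Proof.
move=> sM sN sP; rewrite /ipt -big_split; apply: eq_bigr => i _ /=.
by rewrite -big_split; apply: eq_bigr => j _ /=; rewrite ipDl.
Qed.

Lemma iptZl k M N : sqt M -> sqt N -> ipt (scalet k M) N = k * ipt M N.
Proof.
move=> sM sN; rewrite /ipt mulr_sumr; apply: eq_bigr => i _ /=.
by rewrite mulr_sumr; apply: eq_bigr => j _ /=; rewrite ipZl.
Qed.

Lemma iptBl M N P : sqt M -> sqt N -> sqt P -> ipt (subt M N) P = ipt M P - ipt N P.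
Proof.
move=> sM sN sP; rewrite /ipt -sumrB; apply: eq_bigr => i _ /=.
by rewrite -sumrB; apply: eq_bigr => j _ /=; rewrite ipBl.
Qed.

Lemma iptBr M N P : sqt M -> sqt N -> sqt P -> ipt P (subt M N) = ipt P M - ipt P N.
Proof. by move=> *; rewrite iptC iptBl// !(iptC P). Qed.

Lemma ipt_ge0 M : 0 <= ipt M M.
Proof. by apply: sumr_ge0 => i _; apply: sumr_ge0 => j _; exact: ip_ge0. Qed.

Lemma ipt_entry M i j : ip mu (M i j) (M i j) <= ipt M M.
Proof.
rewrite /ipt !sum2.
by apply: (@entry_le_sum R (fun k l => ip mu (M k l) (M k l))) => k l; exact: ip_ge0.
Qed.

Lemma ipt_ae M M' N N' : sqt M -> sqt M' -> sqt N -> sqt N' ->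
  (forall i j, {ae mu, forall x, M i j x = M' i j x}) ->
  (forall i j, {ae mu, forall x, N i j x = N' i j x}) -> ipt M N = ipt M' N'.
Proof.
by move=> *; apply: eq_bigr => i _; apply: eq_bigr => j _; exact: ip_ae.
Qed.

Lemma ipt_cvgr (F : nat -> 'I_2 -> 'I_2 -> pt -> R) M N : sqt N ->
  (forall i j, cvg2 mu (fun n => F n i j) (M i j)) ->
  ipt N (F n) @[n --> \oo] --> ipt N M.
Proof.
move=> sN FM; rewrite /ipt; under eq_cvg do rewrite !sum2; rewrite !sum2.
have c i j : ip mu (N i j) (F n i j) @[n --> \oo] --> ip mu (N i j) (M i j).
  under eq_cvg do rewrite ipC; rewrite ipC; exact: ip_cvgl.
by apply: cvgD; apply: cvgD; exact: c.
Qed.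

Lemma ipt_cvg (F G : nat -> 'I_2 -> 'I_2 -> pt -> R) M N :
  (forall i j, cvg2 mu (fun n => F n i j) (M i j)) ->
  (forall i j, cvg2 mu (fun n => G n i j) (N i j)) ->
  ipt (F n) (G n) @[n --> \oo] --> ipt M N.
Proof.
move=> FM GN; rewrite /ipt; under eq_cvg do rewrite !sum2; rewrite !sum2.
have c i j : ip mu (F n i j) (G n i j) @[n --> \oo] --> ip mu (M i j) (N i j).
  exact: ip_cvg (FM i j) (GN i j).
by apply: cvgD; apply: cvgD; exact: c.
Qed.

Lemma sqtB M N : sqt M -> sqt N -> sqt (subt M N).
Proof. by move=> sM sN i j; exact: sqintB. Qed.

Lemma symtB M N : symt M -> symt N -> symt (subt M N).
Proof. by move=> sM sN i j; rewrite /subt sM sN. Qed.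

Lemma mxB M N x : mx (subt M N) x = mx M x - mx N x.
Proof. by apply/matrixP => i j; rewrite !mxE. Qed.

End tensor_fields.

(** * The elasticity tensor acting on fields *)

Section elasticity.
Context {R : realType}.
Local Notation pt := (plane R).
Local Notation mu := (lebesgue2 R).
Variables (Omega : set pt) (CC : pt -> {linear 'M[R]_2 -> 'M[R]_2}).
Hypothesis mO : measurable Omega.
Hypothesis HE : elasticity_tensor Omega CC.
Implicit Types (M N P : 'I_2 -> 'I_2 -> pt -> R).

(** Cut off outside [Omega], where nothing is known about [CC]; integrals over the plane are then
    integrals over [Omega]. *)
Definition stress M : 'I_2 -> 'I_2 -> pt -> R :=
  fun i j => (fun x => CC x (mx M x) i j) \_ Omega.

Lemma mx_stress M x : mx (stress M) x = if x \in Omega then CC x (mx M x) else 0.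
Proof. by apply/matrixP => i j; rewrite mxE /stress patchE; case: ifP => _; rewrite ?[in RHS]mxE. Qed.

Lemma stressB M N : stress (subt M N) = subt (stress M) (stress N).
Proof.
apply/funext => i; apply/funext => j; apply/funext => x.
rewrite /stress /subt /= !patchE; case: ifP => _; last by rewrite subrr.
by rewrite -/(subt M N) mxB linearB !mxE.
Qed.

Lemma stressZD k M N :
  stress (addt (scalet k M) N) = addt (scalet k (stress M)) (stress N).
Proof.
apply/funext => i; apply/funext => j; apply/funext => x.
rewrite /stress /addt /scalet /= !patchE; case: ifP => _; last by rewrite mulr0 addr0.
have -> : mx (fun i j => (fun x => k * M i j x) \+ N i j) x = k *: mx M x + mx N x.
  by apply/matrixP => p q; rewrite !mxE.
by rewrite linearP !mxE.
Qed.

Lemma stress_eq M N x : (forall i j, M i j x = N i j x) ->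
  forall i j, stress M i j x = stress N i j x.
Proof.
move=> MN i j; rewrite /stress !patchE; case: ifP => // _.
by congr (CC x _ i j); apply/matrixP => k l; rewrite !mxE.
Qed.

Lemma stress_ae M N : (forall i j, {ae mu, forall x, M i j x = N i j x}) ->
  forall i j, {ae mu, forall x, stress M i j x = stress N i j x}.
Proof.
move=> MN i j.
have h : {ae mu, forall x, forall kl : 'I_2 * 'I_2, M kl.1 kl.2 x = N kl.1 kl.2 x}.
  by apply: ae_all_fin => kl; exact: MN.
by apply: ae_imp h _ => x H; apply: stress_eq => k l; exact: (H (k, l)).
Qed.

Lemma stress_measurable M i j : sqt M -> symt M -> measurable_fun setT (stress M i j).
Proof.
move=> sM symM; have [mC _ _ _ _] := HE; apply/(measurable_restrictT _ mO).
have -> : (fun x => CC x (mx M x) i j) =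
    (fun x => \sum_k \sum_l M k l x * CC x (sym_unit k l) i j).
  apply/funext => x; rewrite {1}(sym_decomposition (mx_sym x symM)) linear_sum summxE.
  apply: eq_bigr => k _; rewrite linear_sum summxE; apply: eq_bigr => l _.
  by rewrite linearZ !mxE.
have mt k l : measurable_fun Omega (fun x => M k l x * CC x (sym_unit k l) i j).
  apply: measurable_funM; last by apply: mC; exact: sym_unit_sym.
  exact: (measurable_funTS (sqint_measurable (sM k l))).
have -> : (fun x => \sum_k \sum_l M k l x * CC x (sym_unit k l) i j) =
  (fun x => (M 0 0 x * CC x (sym_unit 0 0) i j + M 0 1 x * CC x (sym_unit 0 1) i j) +
            (M 1 0 x * CC x (sym_unit 1 0) i j + M 1 1 x * CC x (sym_unit 1 1) i j)).
  by apply/funext => x; rewrite !sum2.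
by apply: measurable_funD; apply: measurable_funD.
Qed.

Lemma stress_bound : exists2 beta : R, 0 <= beta & forall M, symt M ->
  {ae mu, forall x, frob (mx (stress M) x) (mx (stress M) x) <=
                    beta * frob (mx M x) (mx M x)}.
Proof.
have [_ _ _ _ [beta Hb]] := HE; exists `|beta| => // M symM.
apply: ae_imp Hb _ => x Hx; rewrite mx_stress; case: ifPn => [|_].
  rewrite inE => /Hx H; apply: le_trans (H _ (mx_sym x symM)) _.
  by rewrite ler_wpM2r ?frob_ge0// ler_norm.
rewrite /frob big1 ?mulr_ge0 ?frob_ge0// => k _; rewrite big1// => l _.
by rewrite !mxE mulr0.
Qed.

Lemma stress_sqint M : sqt M -> symt M -> sqt (stress M).
Proof.
move=> sM symM i j; have [beta b0 Hb] := stress_bound.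
have [ii _] := ipt_int sM sM.
have h : {ae mu, forall x, stress M i j x ^+ 2 <= beta * frob (mx M x) (mx M x)}.
  apply: ae_imp (Hb M symM) _ => x; apply: le_trans.
  by have := frob_entry (mx (stress M) x) i j; rewrite mxE.
have ib := integrableZl measurableT beta ii.
exact: (@sqint_dom _ _ _ mu _ (fun x => beta * frob (mx M x) (mx M x))
  (stress_measurable i j sM symM) ib h).
Qed.

Lemma stress_ipt_le : exists2 beta : R, 0 <= beta & forall M, sqt M -> symt M ->
  ipt (stress M) (stress M) <= beta * ipt M M.
Proof.
have [beta b0 Hb] := stress_bound; exists beta => // M sM symM.
have sC := stress_sqint sM symM.
have [i1 ->] := ipt_int sC sC; have [i2 ->] := ipt_int sM sM.
rewrite -RintegralZl//; apply: Rintegral_ae_le => //; last exact: Hb.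
exact: (integrableZl measurableT beta i2).
Qed.

Lemma stress_sym M : symt M ->
  {ae mu, forall x, Omega x -> sym (CC x (mx M x))}.
Proof.
move=> symM; have [_ Hs _ _ _] := HE; apply: ae_imp Hs _ => x H Ox.
exact/H/mx_sym.
Qed.

Lemma ipt_stressC M N : sqt M -> symt M -> sqt N -> symt N ->
  ipt (stress M) N = ipt (stress N) M.
Proof.
move=> sM symM sN symN; have [_ _ Hs _ _] := HE.
have [i1 ->] := ipt_int (stress_sqint sM symM) sN.
have [i2 ->] := ipt_int (stress_sqint sN symN) sM.
apply: Rintegral_ae_eq => //; apply: ae_imp Hs _ => x Hx.
rewrite !mx_stress; case: ifPn => [|_].
  rewrite inE => Ox; rewrite Hx//; try exact: mx_sym.
  by apply: eq_bigr => i _; apply: eq_bigr => j _; rewrite mulrC.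
by apply: eq_bigr => i _; apply: eq_bigr => j _; rewrite !mxE !mul0r.
Qed.

(** [ipt M M] is taken over the whole plane while the stress is zero outside [Omega], so [M] has to
    vanish there as well. *)
Lemma stress_coercive : exists2 alpha : R, 0 < alpha & forall M, sqt M -> symt M ->
  (forall i j x, ~ Omega x -> M i j x = 0) ->
  alpha * ipt M M <= ipt (stress M) M.
Proof.
have [_ _ _ [alpha a0 Ha] _] := HE; exists alpha => // M sM symM M0.
have [i1 ->] := ipt_int (stress_sqint sM symM) sM; have [i2 ->] := ipt_int sM sM.
rewrite -RintegralZl//; apply: Rintegral_ae_le => //.
  exact: (integrableZl measurableT alpha i2).
apply: ae_imp Ha _ => x Hx; rewrite mx_stress; case: ifPn => [|xO].
  by rewrite inE => Ox; apply: Hx => //; exact: mx_sym.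
rewrite /frob !sum2 !mxE !M0 ?mulr0 ?addr0 ?mulr0//; move: xO; by rewrite notin_setE.
Qed.

End elasticity.

(** * The clamped plate problem *)

Section closure_of_test_functions.
Context {R : realType}.
Local Notation pt := (plane R).
Local Notation mu := (lebesgue2 R).
Variable Omega : set pt.
Hypothesis mO : measurable Omega.
Implicit Types (w : set pt) (phi psi : pt -> R) (D : seq 'I_2 -> pt -> R).

Definition hessc phi : 'I_2 -> 'I_2 -> pt -> R := fun i j => pds [:: i; j] phi.
Definition hessD D : 'I_2 -> 'I_2 -> pt -> R := fun i j => D [:: i; j].

(* An element of the closure of the test functions in H2, carried as the family
   of its derivatives [D s]; the values for [size s > 2] are junk. *)
Definition test_limit D : Prop :=
  [/\ exists phi : nat -> pt -> R, (forall n, test_function Omega (phi n)) /\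
        forall s, (size s <= 2)%N -> cvg2 mu (fun n => pds s (phi n)) (D s),
      forall s x, ~ Omega x -> D s x = 0 &
      forall i j, D [:: i; j] = D [:: j; i]].

Lemma hessc_sqt w phi : test_function w phi -> sqt (hessc phi).
Proof. by move=> tp i j; exact: sqint_test (test_function_pds [:: i; j] tp). Qed.

Lemma hessc_symt w phi : test_function w phi -> symt (hessc phi).
Proof. by move=> tp i j; exact: (pdC i j (test_function_smooth tp)). Qed.

Lemma hesscZD w k phi psi : test_function w phi -> test_function w psi ->
  hessc ((fun x => k * phi x) \+ psi) = addt (scalet k (hessc phi)) (hessc psi).
Proof.
move=> /test_function_smooth sp /test_function_smooth sq.
apply/funext => i; apply/funext => j; rewrite /hessc pdsD//; last exact: smoothZ.
by rewrite pdsZ.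
Qed.

Lemma test_limit_sqint D s : test_limit D -> (size s <= 2)%N -> sqint mu (D s).
Proof. by move=> [[phi [_ Hphi]] _ _] /Hphi[]. Qed.

Lemma test_limit_sqt D : test_limit D -> sqt (hessD D).
Proof. by move=> tD i j; exact: test_limit_sqint. Qed.

Lemma test_limit_symt D : test_limit D -> symt (hessD D).
Proof. by move=> [_ _ H] i j; exact: H. Qed.

Lemma test_limit_off D s : test_limit D -> D s \_ Omega = D s.
Proof.
move=> [_ H _]; apply/funext => x; rewrite patchE; case: ifPn => // /negP xO.
by rewrite H// => Ox; apply: xO; rewrite inE.
Qed.

Lemma test_limit_test phi : test_function Omega phi -> test_limit (fun s => pds s phi).
Proof.
move=> tp; split.
- exists (fun=> phi); split => // s _; apply: cvg2_cst.
  exact: sqint_test (test_function_pds s tp).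
- by move=> s x Ox; exact: test_function_off (test_function_pds s tp) Ox.
- by move=> i j; exact: (pdC i j (test_function_smooth tp)).
Qed.

Lemma pdsB s phi psi : smooth phi -> smooth psi ->
  pds s (phi \- psi) = pds s phi \- pds s psi.
Proof.
move=> sp sq; have E (a b : pt -> R) : a \- b = a \+ (fun x => -1 * b x).
  by apply/funext => x /=; rewrite mulN1r.
by rewrite E pdsD//; [rewrite pdsZ// -E|exact: smoothZ].
Qed.

Lemma test_limitB D D' : test_limit D -> test_limit D' ->
  test_limit (fun s => D s \- D' s).
Proof.
move=> [[phi [tp cp]] D0 Ds] [[psi [tq cq]] D'0 D's]; split.
- exists (fun n => phi n \- psi n); split=> [n|s s2]; first exact: test_functionB.
  have -> : (fun n => pds s (phi n \- psi n)) = fun n => pds s (phi n) \- pds s (psi n).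
    by apply/funext => n; apply: pdsB; exact: test_function_smooth.
  by apply: cvg2B; [exact: cp|exact: cq].
- by move=> s x Ox /=; rewrite D0// D'0// subrr.
- by move=> i j; rewrite Ds D's.
Qed.

(** Classical integration by parts for the approximants; both sides are pairings with a fixed square
    integrable function and pass to the limit. Working on a part [w] is harmless because [psi]
    vanishes outside it. *)
Lemma test_limit_weak D w s t : test_limit D -> measurable w ->
  (size s + size t <= 2)%N -> weak_derivative w s (D t) (D (s ++ t)).
Proof.
move=> [[phi [tp cp]] _ _] mw st; apply/weak_derivativeE => psi tpsi.
have rE f u : ip mu (f \_ w) (pds u psi) = ip mu f (pds u psi).
  apply: eq_Rintegral => x _; rewrite patchE; case: ifPn => // /negP xw.
  rewrite (test_function_off (test_function_pds u tpsi)) ?mulr0// => wx.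
  by apply: xw; rewrite inE.
rewrite rE; have -> : ip mu (D (s ++ t) \_ w) psi = ip mu (D (s ++ t)) psi := rE _ [::].
have s2 : (size s <= 2)%N by apply: leq_trans st; exact: leq_addr.
have t2 : (size t <= 2)%N by apply: leq_trans st; exact: leq_addl.
have h1 := ip_cvgl (cp t t2) (sqint_test (test_function_pds s tpsi)).
have st2 : (size (s ++ t) <= 2)%N by rewrite size_cat.
have h2 : (-1) ^+ size s * ip mu (pds (s ++ t) (phi n)) psi @[n --> \oo] -->
    (-1) ^+ size s * ip mu (D (s ++ t)) psi.
  by apply: cvgMr; exact: (ip_cvgl (cp (s ++ t) st2) (sqint_test tpsi)).
have E n : ip mu (pds t (phi n)) (pds s psi) =
    (-1) ^+ size s * ip mu (pds (s ++ t) (phi n)) psi.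
  by rewrite pds_cat (ip_pds (smooth_pds t (test_function_smooth (tp n))) tpsi s2).
rewrite (funext E) in h1.
exact: (cvg_unique (@Rhausdorff R) h1 h2).
Qed.

Lemma bounded_setP (w : set pt) : bounded_set w -> exists L : R, forall x, w x -> `|x| <= L.
Proof.
move=> [M [_ HM]]; exists (`|M| + 1) => x wx; apply: (HM (`|M| + 1)) => //.
by rewrite (le_lt_trans (ler_norm M))// ltrDl.
Qed.

(** Each use of Poincare's inequality costs [c] and adds a derivative [pd 0]. Orders 0, 1 and 2 need
    two, one and no uses, and [1 + c + c ^+ 2] covers all three. *)
Lemma poincare_hess : bounded_set Omega -> exists2 K : R, 0 <= K &
  forall phi s, test_function Omega phi -> (size s <= 2)%N ->
    ip mu (pds s phi) (pds s phi) <= K * ipt (hessc phi) (hessc phi).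
Proof.
move=> /bounded_setP[L HL]; pose c := 4 * L ^+ 2.
have c0 : 0 <= c by rewrite mulr_ge0// sqr_ge0.
exists (1 + c + c ^+ 2); first by rewrite !addr_ge0// sqr_ge0.
move=> phi s tp s2.
have h0 := ipt_ge0 (hessc phi).
have P psi : test_function Omega psi -> ip mu psi psi <= c * ip mu (pd 0 psi) (pd 0 psi).
  by move=> tq; exact: poincare tq HL.
have e i j : ip mu (pds [:: i; j] phi) (pds [:: i; j] phi) <= ipt (hessc phi) (hessc phi).
  exact: (ipt_entry (hessc phi)).
case: s s2 => [|i [|j [|//]]] _.
- apply: le_trans (P _ tp) _; apply: le_trans (ler_wpM2l c0 (P _ (test_function_pd 0 tp))) _.
  have := ler_wpM2l c0 (ler_wpM2l c0 (e 0 0)); rewrite /=; nra.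
- apply: le_trans (P _ (test_function_pd i tp)) _.
  have := ler_wpM2l c0 (e 0 i); have := sqr_ge0 c; rewrite /=; nra.
- apply: le_trans (e i j) _; have := sqr_ge0 c; nra.
Qed.

Lemma poincare_limit K D :
  (forall phi s, test_function Omega phi -> (size s <= 2)%N ->
    ip mu (pds s phi) (pds s phi) <= K * ipt (hessc phi) (hessc phi)) ->
  test_limit D -> ip mu (D [::]) (D [::]) <= K * ipt (hessD D) (hessD D).
Proof.
move=> HK [[phi [tp cp]] _ _].
have c0 := cp [::] isT.
have c2 i j := cp [:: i; j] isT.
have h1 := ip_cvg c0 c0.
have h2 : K * ipt (hessc (phi n)) (hessc (phi n)) @[n --> \oo] --> K * ipt (hessD D) (hessD D).
  by apply: cvgMr; exact: (ipt_cvg c2 c2).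
apply: (ler_cvg_to h1 h2); apply: nearW => n; exact: (HK _ [::] (tp n) isT).
Qed.

End closure_of_test_functions.

(** * Existence of weak solutions *)

Section weak_solution.
Context {R : realType}.
Local Notation pt := (plane R).
Local Notation mu := (lebesgue2 R).
Variables (Omega : set pt) (CC : pt -> {linear 'M[R]_2 -> 'M[R]_2}).
Hypothesis mO : measurable Omega.
Hypothesis bO : bounded_set Omega.
Hypothesis HE : elasticity_tensor Omega CC.

Definition weak_solution (f : pt -> R) (D : seq 'I_2 -> pt -> R) : Prop :=
  test_limit Omega D /\ forall phi, test_function Omega phi ->
    ipt (stress Omega CC (hessD D)) (hessc phi) = ip mu f phi.

Lemma hessc_off phi i j x : test_function Omega phi -> ~ Omega x -> hessc phi i j x = 0.
Proof. by move=> tp Ox; exact: test_function_off (test_function_pds [:: i; j] tp) Ox. Qed.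

(** The test functions are not complete for the energy, so the Riesz argument delivers only a
    sequence; coercivity and Poincare's inequality make it Cauchy in every derivative of order at
    most two. *)
Lemma weak_solution_exists (f : pt -> R) : sqint mu f -> exists D, weak_solution f D.
Proof.
move=> sf; have [K K0 HK] := poincare_hess bO.
have [alpha a0 Ha] := stress_coercive mO HE.
pose a (u v : pt -> R) := ipt (stress Omega CC (hessc u)) (hessc v).
pose l (u : pt -> R) := ip mu f u.
have Ha' u : test_function Omega u -> ipt (hessc u) (hessc u) <= alpha^-1 * a u u.
  move=> tu; rewrite -ler_pdivrMl ?invr_gt0// invrK; apply: Ha.
  - exact: hessc_sqt tu.
  - exact: hessc_symt tu.
  - by move=> i j x Ox; exact: hessc_off.
have Ssq u : test_function Omega u -> sqt (stress Omega CC (hessc u)).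
  by move=> tu; exact: (stress_sqint mO HE (hessc_sqt tu) (hessc_symt tu)).
have aC u v : test_function Omega u -> test_function Omega v -> a u v = a v u.
  move=> tu tv; exact: (ipt_stressC mO HE (hessc_sqt tu) (hessc_symt tu)
    (hessc_sqt tv) (hessc_symt tv)).
have [|||||||u [tu cu lu]] := @riesz_sequence R (pt -> R) (test_function Omega) a l _ _ _ _ _ _
    (ip mu f f * (K * alpha^-1)).
- exact: test_function0.
- by move=> k u v tu tv; exact: test_functionD (test_functionZ k tu) tv.
- exact: aC.
- move=> k u v w tu tv tw; rewrite /a.
  have -> : hessc (k *: u + v) = addt (scalet k (hessc u)) (hessc v) := hesscZD k tu tv.
  have sw := hessc_sqt tw; have su := Ssq u tu; have sv := Ssq v tv.
  have sku : sqt (scalet k (stress Omega CC (hessc u))).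
    by move=> i j; apply: sqintZ; exact: su.
  by rewrite stressZD (iptDl sku sv sw) (iptZl k su sw).
- move=> u tu; have := Ha' u tu; have := ipt_ge0 (hessc u).
  by rewrite ler_pdivlMl// => h1 h2; apply: le_trans h2; rewrite mulr_ge0// ltW.
- move=> k u v tu tv; rewrite /l [RHS]addrC.
  have := ipDr (sqint_test (test_functionZ k tu)) (sqint_test tv) sf.
  by rewrite ipZr ?(sqint_test tu)// addrC.
- move=> u tu; apply: le_trans (ip_CS sf (sqint_test tu)) _.
  rewrite -mulrA ler_wpM2l ?ip_ge0//; apply: le_trans (HK u [::] tu isT) _.
  by rewrite -mulrA ler_wpM2l// Ha'.
pose F s n := pds s (u n).
have sF s n : sqint mu (F s n) := sqint_test (test_function_pds s (tu n)).
have cF s : (size s <= 2)%N -> exists g, cvg2 mu (F s) g.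
  move=> s2; apply: sqint_complete => // e e0.
  have Kp : 0 < K * alpha^-1 * 4 + 1 by rewrite ltr_wpDl// !mulr_ge0// invr_ge0 ltW.
  have [N _ HN] := near_infty_natSinv_lt (PosNum (divr_gt0 e0 Kp)).
  exists N => n m nN mN.
  have tB : test_function Omega (u n - u m) := test_functionB (tu n) (tu m).
  have -> : F s n \- F s m = pds s (u n - u m).
    by rewrite [RHS]pdsB//; exact: test_function_smooth (tu _).
  apply: le_trans (HK _ s tB s2) _; apply: le_trans (ler_wpM2l K0 (Ha' _ tB)) _.
  rewrite mulrA; have Ka : 0 <= K * alpha^-1 by rewrite mulr_ge0// invr_ge0 ltW.
  apply: le_trans (ler_wpM2l Ka (cu n m)) _.
  have /= := HN n nN; have /= := HN m mN.
  rewrite !ltr_pdivlMr//.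
  have q0 k : (0 : R) < k.+1%:R^-1 by rewrite invr_gt0 ltr0n.
  move: (q0 n) (q0 m); move: n.+1%:R^-1 m.+1%:R^-1 => q q' q1 q'1 h1 h2; nra.
pose lim (G : nat -> pt -> R) := xget (fun=> 0) [set g | cvg2 mu G g].
have limP s : (size s <= 2)%N -> cvg2 mu (F s) (lim (F s)).
  by move=> s2; apply: (@xgetPex _ (fun=> 0) [set g | cvg2 mu (F s) g]); exact: cF.
pose D s := lim (F s) \_ Omega.
have tD : test_limit Omega D.
  split.
  - exists u; split => // s s2; apply: cvg2_restrict => //; last exact: limP.
    by move=> n x Ox; exact: test_function_off (test_function_pds s (tu n)) Ox.
  - by move=> s x Ox; rewrite /D patchE memNset.
  - move=> i j; rewrite /D; suff -> : F [:: i; j] = F [:: j; i] by [].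
    by apply/funext => n; exact: (pdC i j (test_function_smooth (tu n))).
exists D; split => // psi tpsi.
have spsi := hessc_sqt tpsi; have mpsi := hessc_symt tpsi.
(* By symmetry the tensor is moved to the fixed [psi], and only the convergence of the Hessians of
   [u n] is used. *)
rewrite (ipt_stressC mO HE (test_limit_sqt tD) (test_limit_symt tD) spsi mpsi).
have h1 : ipt (stress Omega CC (hessc psi)) (hessc (u n)) @[n --> \oo] -->
    ipt (stress Omega CC (hessc psi)) (hessD D).
  apply: ipt_cvgr; first exact: Ssq.
  move=> i j; apply: cvg2_restrict => //; last exact: (limP [:: i; j]).
  by move=> n x Ox; exact: hessc_off.
have E n : ipt (stress Omega CC (hessc psi)) (hessc (u n)) = a (u n) psi := aC _ _ tpsi (tu n).
rewrite (funext E) in h1.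
exact: (cvg_unique (@Rhausdorff R) h1 (lu psi tpsi)).
Qed.

End weak_solution.

(** * Lipschitz domains and meshes *)

Section regular_domain.
Context {R : realType}.
Local Notation pt := (plane R).
Implicit Types (Omega U : set pt) (x y z d : pt).

Lemma orthonormal_expansion d d' z : dot d d = 1 -> dot d' d' = 1 -> dot d d' = 0 ->
  z = dot z d *: d + dot z d' *: d'.
Proof.
case: d d' z => [a b] [a' b'] [u v]; rewrite /dot /= => h1 h2 h3.
(* Lagrange's identity. The expansion is then checked after multiplication by this nonzero
   determinant. *)
have D2 : (a * b' - b * a') ^+ 2 = 1.
  have -> : (a * b' - b * a') ^+ 2 = (a * a + b * b) * (a' * a' + b' * b') - (a * a' + b * b') ^+ 2.
    by ring.
  by rewrite h1 h2 h3 mulr1 expr0n subr0.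
have D0 : a * b' - b * a' != 0.
  by apply/eqP => D0; move/eqP: D2; rewrite D0 expr0n eq_sym oner_eq0.
rewrite !pairZ pairD; congr pair => /=; apply: (mulfI D0); apply/eqP; rewrite -subr_eq0.
- have -> : (a * b' - b * a') * u -
    (a * b' - b * a') * ((u * a + v * b) * a + (u * a' + v * b') * a') =
    b' * (u * a + v * b) * (1 - (a * a + b * b)) - b * (u * a' + v * b') * (1 - (a' * a' + b' * b'))
    + (b * (u * a + v * b) - b' * (u * a' + v * b')) * (a * a' + b * b') by ring.
  by rewrite h1 h2 h3 subrr !mulr0 subrr addr0.
- have -> : (a * b' - b * a') * v -
    (a * b' - b * a') * ((u * a + v * b) * b + (u * a' + v * b') * b') =
    - a' * (u * a + v * b) * (1 - (a * a + b * b)) + a * (u * a' + v * b') * (1 - (a' * a' + b' * b'))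
    + (a' * (u * a' + v * b') - a * (u * a + v * b)) * (a * a' + b * b') by ring.
  by rewrite h1 h2 h3 subrr !mulr0 !addr0.
Qed.

Lemma dot_continuous d : continuous (fun z : pt => dot z d).
Proof.
move=> z; apply: cvgD; (apply: cvgM; last exact: cvg_cst); [exact: cvg_fst|exact: cvg_snd].
Qed.

Lemma dotBl x y d : dot (x - y) d = dot x d - dot y d.
Proof. by case: x y d => [a b] [a' b'] [u v]; rewrite /dot /=; ring. Qed.

Lemma dotZl (k : R) x d : dot (k *: x) d = k * dot x d.
Proof. by case: x d => [a b] [u v]; rewrite pairZ /dot /=; ring. Qed.

Lemma dotC x y : dot x y = dot y x.
Proof. by rewrite /dot mulrC [_.2 * _]mulrC. Qed.

(* Points just below the Lipschitz graph are not in the closure of [Omega]. *)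
Lemma open_sub_closure_lipschitz Omega U : open Omega -> lipschitz_boundary Omega ->
  open U -> U `<=` closure Omega -> U `<=` Omega.
Proof.
move=> oO lO oU UO x Ux; apply: contrapT => Ox.
have [|d [d' [r [h [g [[dd d'd' dd' [r0 h0]] [gl H]]]]]]] := lO x.
  split; first exact: UO.
  by move=> /interior_subset.
(* [x] has chart coordinates (0, 0) and is not in [Omega], so it does not lie above the graph. *)
have g0 : 0 <= g 0.
  rewrite leNgt; apply/negP => g0; apply: Ox.
  by have := (H 0 0); rewrite !normr0 !scale0r !addr0 => /(_ r0 h0) [_]; apply.
have [M0 [_ HM]] := gl; pose k := `|M0| + 1.
have k0 : 0 < k by rewrite ltr_wpDl.
have gk s : `|g 0 - g s| <= k * `|s|.
  have M0k : M0 < k by rewrite (le_lt_trans (ler_norm M0))// ltrDl.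
  by have /= := HM k M0k (0, s) (conj I I); rewrite sub0r normrN.
have [e /= e0 He] := proj1 (nbhs_ballP x U) (open_nbhs_nbhs (conj oU Ux)).
have d1 : 0 < 1 + `|d'| by rewrite ltr_pwDl.
(* The first bound keeps [y = x - t0 *: d'] inside [U], the second keeps the points near [y] inside
   the chart. *)
pose t0 := Num.min (e / (1 + `|d'|)) (h / 2).
have t00 : 0 < t0 by rewrite lt_min !divr_gt0.
have t0h : t0 <= h / 2 by rewrite ge_min lexx orbT.
have t0e : t0 * `|d'| < e.
  have : t0 * (1 + `|d'|) <= e by rewrite -ler_pdivlMr// ge_min lexx.
  by apply: lt_le_trans; rewrite ltr_pM2l// ltrDr.
pose y := x - t0 *: d'.
have Uy : U y.
  apply: He; rewrite -ball_normE /ball_ /= /y opprB addrC subrK normrZ gtr0_norm//.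
have Oy : closure Omega y by exact: UO.
(* On [B] the chart coordinates satisfy [t < - t0 / 2] and [k * |s| < t0 / 2], so
   [g s >= g 0 - k * |s| > t]; yet a point of [Omega] would need [g s < t]. *)
pose B := [set z : pt | `|dot z d - dot x d| < Num.min r (t0 / (2 * k)) /\
                        `|dot z d' - dot x d' + t0| < t0 / 2].
have yB : nbhs y B.
  have m0 : 0 < Num.min r (t0 / (2 * k)) by rewrite lt_min r0 divr_gt0// mulr_gt0.
  have yd : dot y d = dot x d.
    by rewrite /y dotBl dotZl [dot d' d]dotC dd' mulr0 subr0.
  have yd' : dot y d' = dot x d' - t0.
    by rewrite /y dotBl dotZl d'd' mulr1.
  have t02 : 0 < t0 / 2 by rewrite divr_gt0.
  have c1 : nbhs y [set z | `|dot y d - dot z d| < Num.min r (t0 / (2 * k))].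
    exact: (@cvgr_dist_lt _ _ _ _ _ _ _ (@dot_continuous d y) _ m0).
  have c2 : nbhs y [set z | `|dot y d' - dot z d'| < t0 / 2].
    exact: (@cvgr_dist_lt _ _ _ _ _ _ _ (@dot_continuous d' y) _ t02).
  have := @filterI _ _ (nbhs_filter y) _ _ c1 c2.
  apply: (@filterS _ _ (nbhs_filter y)) => z [] /=; rewrite yd yd' => z1 z2.
  by split; [rewrite distrC|rewrite -normrN; move: z2; congr (`|_| < _); ring].
have [z [Oz [z1 z2]]] := Oy B yB.
pose s := dot (z - x) d; pose t := dot (z - x) d'.
have sE : s = dot z d - dot x d by rewrite /s dotBl.
have tE : t = dot z d' - dot x d' by rewrite /t dotBl.
have zE : z = x + s *: d + t *: d'.
  by rewrite -addrA -(orthonormal_expansion (z - x) dd d'd' dd') addrC subrK.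
move: z1; rewrite -sE lt_min => /andP[sr sk]; move: z2; rewrite -tE => z2.
have th : `|t| < h.
  move: z2; rewrite ltr_norml => /andP[a1 a2].
  by rewrite ltr_norml; apply/andP; split; lra.
have gst : g s < t by apply: (proj1 (H s t sr th)); rewrite -zE.
have := gk s; rewrite ler_norml => /andP[_ g1].
move: sk; rewrite ltr_pdivlMr ?mulr_gt0// => sk.
move: z2; rewrite ltr_norml => /andP[_ a2].
by nra.
Qed.

End regular_domain.

(** * Restricted tensor fields and their weak div div *)

Section tensor_restriction.
Context {R : realType}.
Local Notation pt := (plane R).
Local Notation mu := (lebesgue2 R).
Implicit Types (w : set pt) (A B : pt -> 'M[R]_2).

Definition rt w A : 'I_2 -> 'I_2 -> pt -> R := fun i j => (fun x => A x i j) \_ w.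

Lemma Rintegral_frob w A B : sqt (rt w A) -> sqt (rt w B) ->
  \int[mu]_(x in w) frob (A x) (B x) = ipt (rt w A) (rt w B).
Proof.
move=> sA sB; have [_ ->] := ipt_int sA sB.
rewrite Rintegral_mkcond; apply: eq_Rintegral => x _.
rewrite frob_mx patchE /rt; case: ifPn => xw.
  by apply: eq_bigr => i _; apply: eq_bigr => j _; rewrite !patchE xw.
by rewrite big1 // => i _; rewrite big1 // => j _; rewrite !patchE (negbTE xw) mul0r.
Qed.

Lemma rt_classical_hess w phi : test_function w phi -> rt w (classical_hess phi) = hessc phi.
Proof.
move=> tp; apply/funext => i; apply/funext => j; apply/funext => x.
rewrite /rt patchE mxE; case: ifPn => // /negP xw.
by rewrite /hessc (test_function_off (test_function_pds [:: i; j] tp))// => wx;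
  apply: xw; rewrite inE.
Qed.

Lemma weak_dDivE w A g : L2t w A -> weak_dDiv w A g <->
  forall phi, test_function w phi -> ipt (rt w A) (hessc phi) = ip mu (g \_ w) phi.
Proof.
move=> sA; split=> H phi tp; have := H phi tp;
  rewrite Rintegral_ip Rintegral_frob ?(rt_classical_hess tp) //; exact: hessc_sqt tp.
Qed.

Lemma dDivP w A : HdDiv w A -> L2 w (dDiv w A) /\ weak_dDiv w A (dDiv w A).
Proof.
by move=> [_ _ H]; apply: (@xgetPex _ (fun=> 0) [set g | L2 w g /\ weak_dDiv w A g]).
Qed.

Lemma dDiv_ae w A g : open w -> HdDiv w A -> L2 w g -> weak_dDiv w A g ->
  {ae mu, forall x, w x -> dDiv w A x = g x}.
Proof.
move=> ow HA sg wg; have [sd wd] := dDivP HA; have [sA _ _] := HA.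
apply: eqae_ip0 => // phi tp.
by rewrite -(proj1 (weak_dDivE _ sA) wd _ tp) -(proj1 (weak_dDivE _ sA) wg _ tp).
Qed.

End tensor_restriction.

(** * Triangulations and broken Hessians *)

Section mesh.
Context {R : realType}.
Local Notation pt := (plane R).
Local Notation mu := (lebesgue2 R).
Variables (Omega : set pt) (E : seq (pt * pt)) (N : nat) (T : 'I_N -> triangle R).
Hypothesis oO : open Omega.
Hypothesis lO : lipschitz_boundary Omega.
Hypothesis bE : boundary_edges Omega E.
Hypothesis conf : conforming_mesh Omega T.
Local Notation Tk k := (open_triangle (T k)).
Implicit Types (u v : pt -> R) (D : seq 'I_2 -> pt -> R).

Lemma open_mesh k : open (Tk k).
Proof. by have [d0 _ _] := conf; exact: open_open_triangle. Qed.

Lemma measurable_mesh k : measurable (Tk k).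
Proof. by apply: open_measurable_plane; exact: open_mesh. Qed.

Lemma mesh_sub k : Tk k `<=` Omega.
Proof.
have sub : Tk k `<=` closure Omega.
  move=> x /open_sub_closed_triangle cx.
  by have [_ <- _] := conf; exists k.
exact: (open_sub_closure_lipschitz oO lO (@open_mesh k) sub).
Qed.

(** Two elements through one point would make the sum of indicators at least 2, whereas it equals
    the indicator of [Omega]. *)
Lemma mesh_disjoint :
  {ae mu, forall x, forall k l, k != l -> Tk k x -> ~ Tk l x}.
Proof.
apply: ae_imp (mesh_indicator oO bE conf) _ => x H k l kl kx lx.
have : \sum_j \1_(Tk j) x <= 1 :> R by rewrite H indicE lern1 leq_b1.
have lk : l != k by rewrite eq_sym.
have one j : Tk j x -> \1_(Tk j) x = 1 :> R by move=> jx; rewrite indicE mem_set.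
rewrite (bigD1 k)//= (bigD1 l)//= (one k kx) (one l lx).
have S0 : 0 <= \sum_(j | (j != k) && (j != l)) \1_(Tk j) x :> R.
  by apply: sumr_ge0 => j _; rewrite indicE ler0n.
by move: S0; set S := \sum_(j | _) _ => S0 S1; lra.
Qed.

Lemma ip_mesh_sum (F G : 'I_N -> pt -> R) :
  (forall k, sqint mu (F k)) -> (forall k, sqint mu (G k)) ->
  (forall k x, ~ Tk k x -> F k x = 0) -> (forall k x, ~ Tk k x -> G k x = 0) ->
  \sum_k ip mu (F k) (G k) = ip mu (fun x => \sum_k F k x) (fun x => \sum_k G k x).
Proof.
move=> sF sG F0 G0.
have sS : sqint mu (fun x => \sum_k F k x) by exact: sqint_sum.
rewrite (ip_sumr sS sG); apply: eq_bigr => k _.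
apply: Rintegral_ae_eq; [exact: (sqintM (sF k) (sG k))|exact: (sqintM sS (sG k))|].
apply: ae_imp mesh_disjoint _ => x H.
have [kx|kx] := pselect (Tk k x); last by rewrite (G0 k x kx) !mulr0.
rewrite (bigD1 k)//= big1 ?addr0// => l lk.
by apply: F0; apply: H kx; rewrite eq_sym.
Qed.

Definition elt_hess k v : 'I_2 -> 'I_2 -> pt -> R :=
  fun i j => (wpd (Tk k) [:: i; j] v) \_ (Tk k).
(** The broken Hessian as a single field on the plane, up to the null set of edges; sums over
    elements become one [ipt]. *)
Definition pw_hess v : 'I_2 -> 'I_2 -> pt -> R :=
  fun i j x => \sum_k elt_hess k v i j x.

Lemma elt_hess_rt k v : rt (Tk k) (hess (Tk k) v) = elt_hess k v.
Proof.
apply/funext => i; apply/funext => j; apply/funext => x.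
by rewrite /rt /elt_hess !patchE mxE.
Qed.

Lemma elt_hess_sqt k v : H2T Omega T v -> sqt (elt_hess k v).
Proof.
by move=> [_ /(_ k)[_ Hv]] i j; have [] := wpdP (Hv [:: i; j] isT).
Qed.

Lemma elt_hess_symt k v : symt (elt_hess k v).
Proof. by move=> i j; rewrite /elt_hess wpdC. Qed.

Lemma elt_hess_off k v i j x : ~ Tk k x -> elt_hess k v i j x = 0.
Proof. by move=> kx; rewrite /elt_hess patchE memNset. Qed.

Lemma pw_hess_sqt v : H2T Omega T v -> sqt (pw_hess v).
Proof. by move=> Hv i j; apply: sqint_sum => k; exact: elt_hess_sqt. Qed.

Lemma pw_hess_symt v : symt (pw_hess v).
Proof.
move=> i j; apply/funext => x; apply: eq_bigr => k _; by rewrite elt_hess_symt.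
Qed.

Lemma pw_hess_off v i j x : ~ Omega x -> pw_hess v i j x = 0.
Proof.
by move=> Ox; apply: big1 => k _; apply: elt_hess_off => /mesh_sub.
Qed.

Lemma ipt_mesh_sum (F G : 'I_N -> 'I_2 -> 'I_2 -> pt -> R) :
  (forall k, sqt (F k)) -> (forall k, sqt (G k)) ->
  (forall k i j x, ~ Tk k x -> F k i j x = 0) ->
  (forall k i j x, ~ Tk k x -> G k i j x = 0) ->
  \sum_k ipt (F k) (G k) =
  ipt (fun i j x => \sum_k F k i j x) (fun i j x => \sum_k G k i j x).
Proof.
move=> sF sG F0 G0; rewrite exchange_big; apply: eq_bigr => i _ /=.
rewrite exchange_big; apply: eq_bigr => j _ /=; apply: ip_mesh_sum.
- by move=> k; exact: sF.
- by move=> k; exact: sG.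
- by move=> k x; exact: F0.
- by move=> k x; exact: G0.
Qed.

Lemma ipt_pw_hess (M : 'I_2 -> 'I_2 -> pt -> R) v : sqt M -> H2T Omega T v ->
  \sum_k ipt M (elt_hess k v) = ipt M (pw_hess v).
Proof.
move=> sM Hv; rewrite exchange_big; apply: eq_bigr => i _ /=.
rewrite exchange_big; apply: eq_bigr => j _ /=; rewrite ip_sumr// => k.
exact: elt_hess_sqt.
Qed.

Lemma gammaE A (v : H2T Omega T) : HdDiv Omega A ->
  gamma_dDiv A v = ip mu (dDiv Omega A \_ Omega) (pwfun v \_ Omega) -
                   ipt (rt Omega A) (pw_hess (pwfun v)).
Proof.
move=> HA; have [sA _ _] := HA.
have Hv : H2T Omega T (pwfun v) := set_valP v.
rewrite /gamma_dDiv Rintegral_ip ip_restrict; congr (_ - _).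
rewrite -ipt_pw_hess//; apply: eq_bigr => k _.
have sAk : sqt (rt (Tk k) A).
  move=> i j; have -> : rt (Tk k) A i j = rt Omega A i j \_ (Tk k).
    apply/funext => x; rewrite /rt !patchE; case: ifPn => //.
    by rewrite inE => /mesh_sub Ox; rewrite mem_set.
  by apply: sqint_restrict; [exact: measurable_mesh|exact: sA].
rewrite Rintegral_frob//; last by rewrite elt_hess_rt; exact: elt_hess_sqt.
rewrite elt_hess_rt; apply: eq_bigr => i _; apply: eq_bigr => j _.
apply: eq_Rintegral => x _; have [kx|kx] := pselect (Tk k x); last first.
  by rewrite elt_hess_off// !mulr0.
by rewrite /rt !patchE (mem_set kx) (mem_set (mesh_sub kx)).
Qed.

End mesh.

(** * Weak derivatives of limits of test functions *)

Section test_limit_derivatives.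
Context {R : realType}.
Local Notation pt := (plane R).
Local Notation mu := (lebesgue2 R).
Variable Omega : set pt.
Hypothesis oO : open Omega.
Implicit Types (w : set pt) (u v : pt -> R) (D : seq 'I_2 -> pt -> R).

Lemma restrict_ae_eq w u v : w `<=` Omega ->
  {ae mu, forall x, Omega x -> u x = v x} -> {ae mu, forall x, w x -> u x = v x}.
Proof. by move=> wO uv; apply: ae_imp uv _ => x H /wO. Qed.

Lemma L2_test_limit D s w : test_limit Omega D -> (size s <= 2)%N ->
  measurable w -> L2 w (D s).
Proof. by move=> tD s2 mw; apply: sqint_restrict => //; exact: test_limit_sqint tD s2. Qed.

(** Formulated for [u] equal almost everywhere to some [D t], so as to cover a function and the
    components of its gradient, on an element as well as on [Omega]. *)
Lemma weak_test_limit D w u s t : test_limit Omega D -> open w -> w `<=` Omega ->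
  L2 w u -> {ae mu, forall x, Omega x -> u x = D t x} -> (size s + size t <= 2)%N ->
  weak_derivative w s u (D (s ++ t)).
Proof.
move=> tD ow wO su uD st; have mw := open_measurable_plane ow.
have t2 : (size t <= 2)%N by apply: leq_trans st; exact: leq_addl.
have sD := L2_test_limit tD t2 mw.
apply: (weak_derivative_ae mw sD su); last exact: (test_limit_weak tD mw st).
by apply: ae_imp (restrict_ae_eq wO uD) _ => x H /H.
Qed.

Lemma wpd_test_limit D w u s t : test_limit Omega D -> open w -> w `<=` Omega ->
  L2 w u -> {ae mu, forall x, Omega x -> u x = D t x} -> (size s + size t <= 2)%N ->
  {ae mu, forall x, w x -> wpd w s u x = D (s ++ t) x} /\ L2 w (wpd w s u).
Proof.
move=> tD ow wO su uD st; have wD := weak_test_limit tD ow wO su uD st.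
have st2 : (size (s ++ t) <= 2)%N by rewrite size_cat.
have sD := L2_test_limit tD st2 (open_measurable_plane ow).
split; first exact: wpd_ae wD.
by have [] := @wpdP _ w s u (ex_intro _ _ (conj sD wD)).
Qed.

Lemma sobolev_test_limit D w u m t : test_limit Omega D -> open w -> w `<=` Omega ->
  L2 w u -> {ae mu, forall x, Omega x -> u x = D t x} -> (m + size t <= 2)%N ->
  sobolev m w u.
Proof.
move=> tD ow wO su uD mt; split => // s sm; exists (D (s ++ t)).
have st : (size s + size t <= 2)%N by apply: leq_trans mt; rewrite leq_add2r.
split; last exact: weak_test_limit.
by apply: L2_test_limit => //; [rewrite size_cat|exact: open_measurable_plane].
Qed.

Lemma ae_restrict_domain D u s : test_limit Omega D ->
  {ae mu, forall x, Omega x -> u x = D s x} ->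
  {ae mu, forall x, (u \_ Omega) x = D s x}.
Proof.
move=> tD uD; apply: ae_imp (restrict_ae uD) _ => x ->.
by rewrite test_limit_off.
Qed.

(** The weak definition of div div is tested with the approximants and passed to the limit, so no
    boundary term arises. *)
Lemma ipt_dDiv A D : HdDiv Omega A -> test_limit Omega D ->
  ipt (rt Omega A) (hessD D) = ip mu (dDiv Omega A \_ Omega) (D [::]).
Proof.
move=> HA tD; have [sd wd] := dDivP HA; have [sA _ _] := HA.
have [[phi [tp cp]] _ _] := tD.
have c0 := cp [::] isT.
have c2 i j := cp [:: i; j] isT.
have h1 := @ipt_cvgr _ (fun n => hessc (phi n)) (hessD D) (rt Omega A) sA c2.
have h2 := ip_cvgl c0 sd.
have E n : ipt (rt Omega A) (hessc (phi n)) = ip mu (phi n) (dDiv Omega A \_ Omega).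
  by rewrite (proj1 (weak_dDivE _ sA) wd _ (tp n)) ipC.
rewrite (funext E) in h1; rewrite [RHS]ipC.
exact: (cvg_unique (@Rhausdorff R) h1 h2).
Qed.

End test_limit_derivatives.

(** * Stresses as elements of H(dDiv) *)

Section stress_fields.
Context {R : realType}.
Local Notation pt := (plane R).
Local Notation mu := (lebesgue2 R).
Variables (Omega : set pt) (CC : pt -> {linear 'M[R]_2 -> 'M[R]_2}).
Hypothesis mO : measurable Omega.
Hypothesis HE : elasticity_tensor Omega CC.
Implicit Types (M : 'I_2 -> 'I_2 -> pt -> R).

Lemma rt_stress A M : (forall x, Omega x -> A x = CC x (mx M x)) ->
  rt Omega A = stress Omega CC M.
Proof.
move=> AM; apply/funext => i; apply/funext => j; apply/funext => x.
by rewrite /rt /stress !patchE; case: ifPn => //; rewrite inE => /AM ->.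
Qed.

Lemma stress_HdDiv A M g : (forall x, Omega x -> A x = CC x (mx M x)) ->
  sqt M -> symt M -> L2 Omega g ->
  (forall phi, test_function Omega phi ->
     ipt (stress Omega CC M) (hessc phi) = ip mu (g \_ Omega) phi) ->
  HdDiv Omega A /\ weak_dDiv Omega A g.
Proof.
move=> AM sM symM sg H; have rA := rt_stress AM.
have sA : L2t Omega A.
  move=> i j; have := stress_sqint mO HE sM symM i j; rewrite -rA; exact.
have wg : weak_dDiv Omega A g by apply/(weak_dDivE _ sA); rewrite rA.
split => //; split => //; last by exists g.
by apply: ae_imp (stress_sym HE symM) _ => x Hx Ox; rewrite AM//; exact: Hx.
Qed.

End stress_fields.

(** * Limits of test functions on the mesh *)

Section mesh_test_limit.
Context {R : realType}.
Local Notation pt := (plane R).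
Local Notation mu := (lebesgue2 R).
Variables (Omega : set pt) (E : seq (pt * pt)) (N : nat) (T : 'I_N -> triangle R).
Hypothesis oO : open Omega.
Hypothesis lO : lipschitz_boundary Omega.
Hypothesis bE : boundary_edges Omega E.
Hypothesis conf : conforming_mesh Omega T.
Variable CC : pt -> {linear 'M[R]_2 -> 'M[R]_2}.
Hypothesis HE : elasticity_tensor Omega CC.
Local Notation Tk k := (open_triangle (T k)).
Local Notation Hv v := (set_valP v).
Implicit Types (u v : pt -> R) (D : seq 'I_2 -> pt -> R).

Let mO : measurable Omega := open_measurable_plane oO.
Let oT k : open (Tk k) := @open_mesh _ Omega N T conf k.
Let mT k : measurable (Tk k) := open_measurable_plane (@oT k).
Let TO k : Tk k `<=` Omega := @mesh_sub _ Omega N T oO lO conf k.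

Lemma L2_mesh u k : L2 Omega u -> L2 (Tk k) u.
Proof.
move=> su; apply/L2P; have -> : u \_ (Tk k) = (u \_ Omega) \_ (Tk k).
  apply/funext => x; rewrite !patchE; case: ifPn => //.
  by rewrite inE => /TO Ox; rewrite mem_set.
have s1 : sqint mu (u \_ Omega) by exact: su.
by apply: (sqint_restrict _ s1); exact: mT.
Qed.

Lemma H2T_test_limit D u : test_limit Omega D -> L2 Omega u ->
  {ae mu, forall x, Omega x -> u x = D [::] x} -> H2T Omega T u.
Proof.
move=> tD su uD; split => // k.
exact: (@sobolev_test_limit _ Omega D (Tk k) u 2 [::] tD (@oT k) (@TO k) (L2_mesh k su) uD).
Qed.

(** On each element the weak second derivatives agree with those of [D], and the indicators of the
    elements sum to that of [Omega]. *)
Lemma pw_hess_test_limit D u : test_limit Omega D -> L2 Omega u ->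
  {ae mu, forall x, Omega x -> u x = D [::] x} ->
  forall i j, {ae mu, forall x, pw_hess T u i j x = hessD D i j x}.
Proof.
move=> tD su uD i j.
have h : {ae mu, forall x, forall k, Tk k x -> wpd (Tk k) [:: i; j] u x = D [:: i; j] x}.
  apply: ae_all_fin => k.
  exact: (@wpd_test_limit _ Omega D (Tk k) u [:: i; j] [::] tD (@oT k) (@TO k) (L2_mesh k su) uD isT).1.
apply: ae_imp (ae_and h (mesh_indicator oO bE conf)) _ => x [Hx ind].
rewrite /pw_hess (eq_bigr (fun k => \1_(Tk k) x * D [:: i; j] x)) => [|k _].
  rewrite -mulr_suml ind /hessD -[in RHS](test_limit_off [:: i; j] tD) patchE indicE.
  by case: ifP; rewrite ?mul1r ?mul0r.
rewrite /elt_hess patchE indicE; case: ifPn => [|_]; last by rewrite mul0r.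
by rewrite inE => kx; rewrite Hx// mul1r.
Qed.

(** At almost every point at most one element contributes, and [CC x] is linear; so the elementwise
    energies add up to that of the broken Hessian. *)
Lemma pw_stress u v : H2T Omega T u -> H2T Omega T v ->
  \sum_k \int[mu]_(x in Tk k)
     frob (CC x (hess (Tk k) u x)) (hess (Tk k) v x) =
  ipt (stress Omega CC (pw_hess T u)) (pw_hess T v).
Proof.
move=> Hu Hv.
have rE k : rt (Tk k) (fun x => CC x (hess (Tk k) u x)) = stress Omega CC (elt_hess T k u).
  apply/funext => i; apply/funext => j; apply/funext => x; rewrite /rt /stress !patchE.
  case: ifPn => [|/negP kx].
    rewrite inE => kx; rewrite (mem_set (TO kx)); congr (CC x _ i j).
    by apply/matrixP => p q; rewrite !mxE /elt_hess patchE mem_set.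
  have -> : mx (elt_hess T k u) x = 0.
    by apply/matrixP => p q; rewrite !mxE elt_hess_off// => kx'; apply: kx; rewrite inE.
  by rewrite linear0 mxE; case: ifP.
have sS k : sqt (stress Omega CC (elt_hess T k u)).
  exact: (stress_sqint mO HE (elt_hess_sqt k Hu) (elt_hess_symt T k u)).
have sH k := elt_hess_sqt k Hv.
transitivity (\sum_k ipt (stress Omega CC (elt_hess T k u)) (elt_hess T k v)).
  by apply: eq_bigr => k _; rewrite Rintegral_frob ?rE ?elt_hess_rt.
rewrite (ipt_mesh_sum oO bE conf sS sH) //.
- congr (ipt _ _); apply/funext => i; apply/funext => j; apply/funext => x.
  rewrite /stress patchE; case: ifPn => xO; last first.
    by rewrite big1// => k _; rewrite patchE (negbTE xO).
  under eq_bigr do rewrite patchE xO.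
  have -> : mx (pw_hess T u) x = \sum_k mx (elt_hess T k u) x.
    by apply/matrixP => p q; rewrite summxE !mxE; apply: eq_bigr => k _; rewrite mxE.
  by rewrite linear_sum summxE.
- move=> k i j x kx; rewrite -rE /rt patchE memNset//.
- by move=> k i j x; exact: elt_hess_off.
Qed.

(** On a limit of test functions the broken Hessian is the global one, so the interelement terms
    cancel and [ipt_dDiv] applies. *)
Lemma gamma_vanish D A (v : H2T Omega T) : HdDiv Omega A -> test_limit Omega D ->
  {ae mu, forall x, Omega x -> pwfun v x = D [::] x} -> gamma_dDiv A v = 0.
Proof.
move=> HA tD vD; rewrite (gammaE oO lO conf v HA).
have [sv _] := Hv v; have [sA _ _] := HA; have [sd _] := dDivP HA.
have HH : H2T Omega T (pwfun v) := Hv v.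
apply/eqP; rewrite subr_eq0; apply/eqP.
transitivity (ip mu (dDiv Omega A \_ Omega) (D [::])).
  have sD : sqint mu (D [::]) := @test_limit_sqint _ _ D [::] tD isT.
  apply: (ip_ae sd sd sv sD); last exact: ae_restrict_domain.
  by apply: aeW.
rewrite -(ipt_dDiv HA tD).
apply: (ipt_ae sA sA (test_limit_sqt tD) (pw_hess_sqt HH)) => i j.
  by apply: aeW.
by apply: ae_imp (pw_hess_test_limit tD sv vD i j) _ => x ->.
Qed.

End mesh_test_limit.

(** * The hybrid formulation *)

Section hybrid.
Context {R : realType}.
Local Notation pt := (plane R).
Local Notation mu := (lebesgue2 R).
Variables (Omega : set pt) (E : seq (pt * pt)) (N : nat) (T : 'I_N -> triangle R).
Hypothesis oO : open Omega.
Hypothesis bO : bounded_set Omega.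
Hypothesis lO : lipschitz_boundary Omega.
Hypothesis bE : boundary_edges Omega E.
Hypothesis conf : conforming_mesh Omega T.
Variable CC : pt -> {linear 'M[R]_2 -> 'M[R]_2}.
Hypothesis HE : elasticity_tensor Omega CC.
Local Notation Tk k := (open_triangle (T k)).
Local Notation stress := (stress Omega CC).
Local Notation pw_hess := (pw_hess T).
Implicit Types (u v : H2T Omega T) (f : pt -> R) (D : seq 'I_2 -> pt -> R).

Let mO : measurable Omega := open_measurable_plane oO.

Definition toH2T (w : pt -> R) (Hw : H2T Omega T w) : H2T Omega T :=
  exist _ w (mem_set Hw).

(** A test function is an admissible [du] on which [eta] vanishes, so only the energy term
    survives. *)
Lemma hybrid_test f u eta phi : hybrid_solution CC f u eta ->
  test_function Omega phi -> ipt (stress (pw_hess (pwfun u))) (hessc phi) =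
    ip mu (f \_ Omega) phi.
Proof.
move=> [[A HA <-] H1 _] tp.
have tD := test_limit_test tp.
have sp : L2 Omega phi by apply: (sqint_restrict _ (sqint_test tp)); exact: mO.
have pp : {ae mu, forall x, Omega x -> phi x = pds [::] phi x} by apply: aeW.
have Hp := H2T_test_limit oO lO conf tD sp pp.
have := H1 (toH2T Hp).
rewrite (gamma_vanish oO lO bE conf (v := toH2T Hp) HA tD pp) addr0 Rintegral_ip.
rewrite (pw_stress oO lO bE conf HE (set_valP u) Hp) => <-.
have sS := stress_sqint mO HE (pw_hess_sqt (set_valP u)) (pw_hess_symt T (pwfun u)).
apply: (ipt_ae sS sS (hessc_sqt tp) (pw_hess_sqt Hp)) => i j.
  by apply: aeW.
by apply: ae_imp (pw_hess_test_limit oO lO bE conf tD sp pp i j) _ => x ->.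
Qed.

Lemma gamma_hybrid f u eta A : hybrid_solution CC f u eta -> HdDiv Omega A ->
  ip mu (dDiv Omega A \_ Omega) (pwfun u \_ Omega) =
  ipt (rt Omega A) (pw_hess (pwfun u)).
Proof.
move=> [_ _ H3] HA; have := H3 _ (ex_intro2 _ _ A HA erefl).
by rewrite (gammaE oO lO conf u HA) => /eqP; rewrite subr_eq0 => /eqP.
Qed.

(** Both Hessians are orthogonal to [A = C W]: that of [u] by the constraint, that of [D] as a limit
    of test functions. Hence [W], their difference, has zero energy. *)
Lemma hybrid_hess f u eta D : L2 Omega f -> hybrid_solution CC f u eta ->
  weak_solution Omega CC (f \_ Omega) D ->
  forall i j, {ae mu, forall x, pw_hess (pwfun u) i j x = hessD D i j x}.
Proof.
move=> sf Hu [tD HD].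
have sP := pw_hess_sqt (set_valP u); have symP := pw_hess_symt T (pwfun u).
have sG := test_limit_sqt tD; have symG := test_limit_symt tD.
pose W := subt (pw_hess (pwfun u)) (hessD D).
have sW : sqt W := sqtB sP sG; have symW : symt W := symtB symP symG.
have sSP := stress_sqint mO HE sP symP; have sSG := stress_sqint mO HE sG symG.
pose A := fun x => CC x (mx W x).
have s0 : L2 Omega (fun=> 0 : R).
  by apply: (sqint_restrict _ (sqint0 mu)); exact: mO.
have ip0 (g : pt -> R) : ip mu ((fun=> 0 : R) \_ Omega) g = 0.
  rewrite (_ : _ \_ _ = fun=> 0) ?ip0l//.
  by apply/funext => x; rewrite patchE; case: ifP.
have [HA wA] : HdDiv Omega A /\ weak_dDiv Omega A (fun=> 0).
  apply: (stress_HdDiv mO HE (M := W)) => // phi tp.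
  rewrite ip0 /W stressB (iptBl sSP sSG (hessc_sqt tp)).
  by rewrite (hybrid_test Hu tp) HD// subrr.
have dA := dDiv_ae oO HA s0 wA.
have rA : rt Omega A = stress W by exact: rt_stress.
have sd : sqint mu (dDiv Omega A \_ Omega) by have [] := dDivP HA.
have d0 (g : pt -> R) : sqint mu g -> ip mu (dDiv Omega A \_ Omega) g = 0.
  move=> sg; rewrite -(ip0 g); apply: (ip_ae sd s0 sg sg); last by apply: aeW.
  exact: restrict_ae.
have [su _] := set_valP u.
have h1 := gamma_hybrid Hu HA; rewrite d0// rA in h1.
have h2 := ipt_dDiv HA tD; rewrite d0 ?rA in h2; last exact: (@test_limit_sqint _ _ D [::] tD).
have [alpha a0 Ha] := stress_coercive mO HE.
have Woff i j x : ~ Omega x -> W i j x = 0.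
  move=> Ox; rewrite /W /subt /= (pw_hess_off oO lO conf)//.
  by have [_ D0 _] := tD; rewrite /hessD D0 // subrr.
have W0 : ipt W W = 0.
  apply/eqP; rewrite eq_le ipt_ge0 andbT -(pmulr_rle0 _ a0).
  apply: le_trans (Ha W sW symW Woff) _.
  rewrite /W (iptBr sP sG); last exact: (stress_sqint mO HE sW symW).
  by rewrite -h1 h2 subrr.
move=> i j; have Wij : ip mu (W i j) (W i j) = 0.
  by apply/eqP; rewrite eq_le ip_ge0 andbT -W0; exact: ipt_entry.
apply: ae_imp (ip_eq0 (sW i j) Wij) _ => x /eqP.
by rewrite subr_eq0 => /eqP.
Qed.

(** A duality argument: with [div div A = w], the constraint turns [(w, u)] into [(A, D^2 u)], the
    closure property turns [(w, D [::])] into [(A, hessD D)], and these agree. So [w], the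
    difference of the two functions, is orthogonal to itself. *)
Lemma hybrid_unique f u eta D : L2 Omega f -> hybrid_solution CC f u eta ->
  weak_solution Omega CC (f \_ Omega) D ->
  {ae mu, forall x, Omega x -> pwfun u x = D [::] x}.
Proof.
move=> sf Hu HD; have PG := hybrid_hess sf Hu HD; have [tD _] := HD.
have [su _] := set_valP u.
have sD := @test_limit_sqint _ _ D [::] tD isT.
have sP := pw_hess_sqt (set_valP u).
pose w := pwfun u \_ Omega \- D [::].
have sw : sqint mu w := sqintB su sD.
have wO : w \_ Omega = w.
  apply/funext => x; rewrite patchE; case: ifPn => // xO.
  by rewrite /w /= patchE (negbTE xO) -(test_limit_off [::] tD) patchE (negbTE xO) subrr.
have [D' [tD' HD']] := weak_solution_exists mO bO HE sw.
have sG := test_limit_sqt tD'; have symG := test_limit_symt tD'.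
pose A := fun x => CC x (mx (hessD D') x).
have sw' : L2 Omega w by rewrite /L2 wO.
have [HA wA] : HdDiv Omega A /\ weak_dDiv Omega A w.
  by apply: (stress_HdDiv mO HE (M := hessD D')) => // phi tp; rewrite wO HD'.
have rA : rt Omega A = stress (hessD D') by exact: rt_stress.
have sd : sqint mu (dDiv Omega A \_ Omega) by have [] := dDivP HA.
have dA : {ae mu, forall x, (dDiv Omega A \_ Omega) x = w x}.
  by apply: ae_imp (restrict_ae (dDiv_ae oO HA sw' wA)) _ => x ->; rewrite wO.
have sS := stress_sqint mO HE sG symG.
have e : ip mu (dDiv Omega A \_ Omega) w = 0.
  rewrite ipBr// (gamma_hybrid Hu HA) -(ipt_dDiv HA tD) rA.
  rewrite (ipt_ae sS sS sP (test_limit_sqt tD) _ PG) ?subrr//.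
  by move=> i j; apply: aeW.
have ww : ip mu w w = 0.
  by rewrite -e; apply: (ip_ae sw sd sw sw); [apply: ae_imp dA _ => x ->|apply: aeW].
apply: ae_imp (ip_eq0 sw ww) _ => x + Ox.
by rewrite /w /= patchE mem_set// => /eqP; rewrite subr_eq0 => /eqP.
Qed.

(** The first equation determines [eta], and the resulting expression involves only [f] and [D].
    Uniqueness of [eta] and the formula for differences follow. *)
Lemma hybrid_eta f u eta D : L2 Omega f -> hybrid_solution CC f u eta ->
  weak_solution Omega CC (f \_ Omega) D -> forall v,
  eta v = ip mu (f \_ Omega) (pwfun v \_ Omega) - ipt (stress (hessD D)) (pw_hess (pwfun v)).
Proof.
move=> sf Hu HD v; have PG := hybrid_hess sf Hu HD; have [tD _] := HD.
have [_ H1 _] := Hu; have := H1 v.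
rewrite (pw_stress oO lO bE conf HE (set_valP u) (set_valP v)) Rintegral_ip ip_restrict => <-.
have sP := pw_hess_sqt (set_valP u); have symP := pw_hess_symt T (pwfun u).
have sG := test_limit_sqt tD; have symG := test_limit_symt tD.
rewrite (ipt_ae (stress_sqint mO HE sP symP) (stress_sqint mO HE sG symG)
  (pw_hess_sqt (set_valP v)) (pw_hess_sqt (set_valP v))).
- by rewrite addrAC subrr add0r.
- exact: stress_ae.
- by move=> i j; apply: aeW.
Qed.

(** [M] is any representative of the Hessian of the weak solution: both [hessD D] itself and the
    Hessian chosen on [Omega] are used in its place. *)
Lemma moment_field f D A M : L2 Omega f -> weak_solution Omega CC (f \_ Omega) D ->
  (forall x, Omega x -> A x = CC x (mx M x)) -> sqt M -> symt M ->
  (forall i j, {ae mu, forall x, M i j x = hessD D i j x}) ->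
  [/\ HdDiv Omega A, {ae mu, forall x, Omega x -> dDiv Omega A x = f x},
      ipt (rt Omega A) (rt Omega A) = ipt (stress (hessD D)) (stress (hessD D)) &
      forall v, gamma_dDiv A v =
        ip mu (f \_ Omega) (pwfun v \_ Omega) - ipt (stress (hessD D)) (pw_hess (pwfun v))].
Proof.
move=> sf [tD HD] AM sM symM MD.
have sG := test_limit_sqt tD; have symG := test_limit_symt tD.
have sSM := stress_sqint mO HE sM symM; have sSG := stress_sqint mO HE sG symG.
have SMG i j : {ae mu, forall x, stress M i j x = stress (hessD D) i j x}.
  exact: stress_ae.
have aeq (P : 'I_2 -> 'I_2 -> pt -> R) i j : {ae mu, forall x, P i j x = P i j x} by apply: aeW.
have [HA wA] : HdDiv Omega A /\ weak_dDiv Omega A f.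
  apply: (stress_HdDiv mO HE AM) => // phi tp; rewrite -HD//.
  exact: (ipt_ae sSM sSG (hessc_sqt tp) (hessc_sqt tp)).
have rA := rt_stress AM.
have dA := dDiv_ae oO HA sf wA.
split => //.
- by rewrite rA; exact: (ipt_ae sSM sSG sSM sSG).
- move=> v; have [sv _] := set_valP v; have sP := pw_hess_sqt (set_valP v).
  have sd : sqint mu (dDiv Omega A \_ Omega) by have [] := dDivP HA.
  rewrite (gammaE oO lO conf v HA) rA; congr (_ - _).
    apply: (ip_ae sd sf sv sv); last by apply: aeW.
    exact: restrict_ae.
  exact: (ipt_ae sSM sSG sP sP).
Qed.

Lemma hybrid_exists f D : L2 Omega f -> weak_solution Omega CC (f \_ Omega) D ->
  exists u eta, hybrid_solution CC f u eta.
Proof.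
move=> sf HD; have [tD _] := HD.
have sD := @test_limit_sqint _ _ D [::] tD isT.
have sD' : L2 Omega (D [::]) by rewrite /L2 (test_limit_off [::] tD).
have DD : {ae mu, forall x, Omega x -> D [::] x = D [::] x} by apply: aeW.
have Hu := H2T_test_limit oO lO conf tD sD' DD.
have sG := test_limit_sqt tD; have symG := test_limit_symt tD.
have aG i j : {ae mu, forall x, hessD D i j x = hessD D i j x} by apply: aeW.
have [HA _ _ gA] := moment_field (A := fun x => CC x (mx (hessD D) x)) sf HD
  (fun x _ => erefl) sG symG aG.
exists (toH2T Hu), (gamma_dDiv (fun x => CC x (mx (hessD D) x))); split.
- by exists (fun x => CC x (mx (hessD D) x)).
- move=> v; rewrite gA (pw_stress oO lO bE conf HE Hu (set_valP v)) Rintegral_ip.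
  rewrite ip_restrict.
  have sP := pw_hess_sqt Hu; have symP := pw_hess_symt T (D [::]).
  rewrite (ipt_ae (stress_sqint mO HE sP symP) (stress_sqint mO HE sG symG)
    (pw_hess_sqt (set_valP v)) (pw_hess_sqt (set_valP v))).
  + by rewrite addrCA subrr addr0.
  + by apply: stress_ae; exact: (pw_hess_test_limit oO lO bE conf tD sD' DD).
  + by move=> i j; apply: aeW.
- by move=> _ [A HA' <-]; exact: (gamma_vanish oO lO bE conf (v := toH2T Hu) HA' tD DD).
Qed.

End hybrid.

(** * Energy estimates *)

Section energy.
Context {R : realType}.
Local Notation pt := (plane R).
Local Notation mu := (lebesgue2 R).
Variables (Omega : set pt) (CC : pt -> {linear 'M[R]_2 -> 'M[R]_2}).
Hypothesis mO : measurable Omega.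
Hypothesis HE : elasticity_tensor Omega CC.
Implicit Types (f : pt -> R) (D : seq 'I_2 -> pt -> R).

Lemma energy_identity f D : sqint mu f -> weak_solution Omega CC f D ->
  ipt (stress Omega CC (hessD D)) (hessD D) = ip mu f (D [::]).
Proof.
move=> sf [tD HD]; have [[phi [tp cp]] _ _] := tD.
have c0 := cp [::] isT.
have c2 i j := cp [:: i; j] isT.
have sS := stress_sqint mO HE (test_limit_sqt tD) (test_limit_symt tD).
have h1 := @ipt_cvgr _ (fun n => hessc (phi n)) (hessD D) _ sS c2.
have h2 := ip_cvgl c0 sf.
have EE n : ipt (stress Omega CC (hessD D)) (hessc (phi n)) = ip mu (phi n) f.
  by rewrite HD// ipC.
rewrite (funext EE) in h1; rewrite [RHS]ipC.
exact: (cvg_unique (@Rhausdorff R) h1 h2).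
Qed.

(** Let [x] be the squared norm of the Hessian. Coercivity gives [alpha * x <= (f, D [::])],
    Cauchy-Schwarz and Poincare give [(f, D [::]) ^+ 2 <= ip f f * (K * x)]; squaring the former and
    cancelling [x] produces [K / alpha ^+ 2]. *)
Lemma energy_bound (K alpha : R) f D : 0 <= K -> 0 < alpha ->
  (forall M, sqt M -> symt M -> (forall i j x, ~ Omega x -> M i j x = 0) ->
     alpha * ipt M M <= ipt (stress Omega CC M) M) ->
  (forall D, test_limit Omega D -> ip mu (D [::]) (D [::]) <= K * ipt (hessD D) (hessD D)) ->
  sqint mu f -> weak_solution Omega CC f D ->
  ipt (hessD D) (hessD D) <= K / alpha ^+ 2 * ip mu f f.
Proof.
move=> K0 a0 Ha HK sf HD; have [tD _] := HD; have [_ D0 _] := tD.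
have sG := test_limit_sqt tD; have symG := test_limit_symt tD.
have sD := @test_limit_sqint _ _ D [::] tD isT.
have h1 := Ha _ sG symG (fun i j x Ox => D0 [:: i; j] x Ox).
rewrite (energy_identity sf HD) in h1.
have h2 := ip_CS sf sD; have h3 := HK _ tD.
move: (ipt_ge0 (hessD D)) (ip_ge0 mu f) h1 h2 h3.
move: (ipt _ _) (ip mu f f) (ip mu f (D [::])) (ip mu (D [::]) _) => x F c p x0 F0 h1 h2 h3.
have [x00|x1] := leP x 0.
  apply: le_trans x00 _; apply: mulr_ge0 => //; apply: divr_ge0 => //; exact: sqr_ge0.
have ax : 0 <= alpha * x by rewrite mulr_ge0// ltW.
have h4 : (alpha * x) ^+ 2 <= F * (K * x).
  apply: le_trans (le_trans h2 (ler_wpM2l F0 h3)).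
  by rewrite lerXn2r ?nnegrE// (le_trans ax).
have a2 : 0 < alpha ^+ 2 by rewrite exprn_gt0.
rewrite mulrAC ler_pdivlMr// -(ler_pM2r x1).
have -> : x * alpha ^+ 2 * x = (alpha * x) ^+ 2 by ring.
by have -> : K * F * x = F * (K * x) by ring.
Qed.

End energy.

(** * Norms of functions and tensors *)

Section norms.
Context {R : realType}.
Local Notation pt := (plane R).
Local Notation mu := (lebesgue2 R).
Implicit Types (w : set pt) (v : pt -> R) (A : pt -> 'M[R]_2).

Lemma L2norm_sq w v : L2 w v -> L2norm w v ^+ 2 = ip mu (v \_ w) (v \_ w).
Proof. by move=> sv; rewrite L2normE// sqr_sqrtr// ip_ge0. Qed.

Lemma L2tnorm_sq w A : L2t w A -> L2tnorm w A ^+ 2 = ipt (rt w A) (rt w A).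
Proof.
move=> sA; rewrite /L2tnorm sqr_sqrtr.
  by apply: eq_bigr => i _; apply: eq_bigr => j _; rewrite L2norm_sq//; exact: sA.
by apply: sumr_ge0 => i _; apply: sumr_ge0 => j _; rewrite sqr_ge0.
Qed.

Lemma L2norm_ae w v v' : L2 w v -> L2 w v' ->
  {ae mu, forall x, w x -> v x = v' x} -> L2norm w v = L2norm w v'.
Proof.
move=> sv sv' vv; rewrite !L2normE//; congr Num.sqrt.
by apply: (ip_ae sv sv' sv sv'); exact: restrict_ae.
Qed.

End norms.

(** * Broken norms and the trace norm *)

Section mesh_norms.
Context {R : realType}.
Local Notation pt := (plane R).
Local Notation mu := (lebesgue2 R).
Variables (Omega : set pt) (E : seq (pt * pt)) (N : nat) (T : 'I_N -> triangle R).
Hypothesis oO : open Omega.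
Hypothesis lO : lipschitz_boundary Omega.
Hypothesis bE : boundary_edges Omega E.
Hypothesis conf : conforming_mesh Omega T.
Local Notation Tk k := (open_triangle (T k)).

(** For limits of test functions the broken norm is the global one, so bounds proved on [Omega] pass
    to any mesh with the same constant. *)
Lemma H2Tnorm_test_limit D u : test_limit Omega D -> L2 Omega u ->
  {ae mu, forall x, Omega x -> u x = D [::] x} ->
  H2Tnorm T u = Num.sqrt (ip mu (D [::]) (D [::]) + ipt (hessD D) (hessD D)).
Proof.
move=> tD su uD; have Hu := H2T_test_limit oO lO conf tD su uD.
have sD := @test_limit_sqint _ _ D [::] tD isT.
have sG := test_limit_sqt tD.
have PG := pw_hess_test_limit oO lO bE conf tD su uD.
have sP := pw_hess_sqt Hu.
have suk k : L2 (Tk k) u by exact: (L2_mesh oO lO conf k su).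
have sHk k : L2t (Tk k) (hess (Tk k) u).
  by move=> i j; have := elt_hess_sqt k Hu i j; rewrite -elt_hess_rt; exact.
rewrite /H2Tnorm; congr Num.sqrt.
rewrite (eq_bigr (fun k => ip mu (u \_ (Tk k)) (u \_ (Tk k)) +
    ipt (elt_hess T k u) (elt_hess T k u))) => [|k _]; last first.
  rewrite /H2norm sqr_sqrtr ?addr_ge0 ?sqr_ge0// L2norm_sq ?L2tnorm_sq//.
  by rewrite elt_hess_rt.
rewrite big_split /=; congr (_ + _).
- have off k x : ~ Tk k x -> (u \_ (Tk k)) x = 0 by move=> kx; rewrite patchE memNset.
  rewrite (ip_mesh_sum oO bE conf suk suk off off).
  have sS : sqint mu (fun x => \sum_k (u \_ (Tk k)) x) by exact: sqint_sum.
  have SD : {ae mu, forall x, \sum_k (u \_ (Tk k)) x = D [::] x}.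
    apply: ae_imp (ae_and (mesh_indicator oO bE conf) (ae_restrict_domain tD uD)) _ => x [ind <-].
    rewrite (eq_bigr (fun k => \1_(Tk k) x * u x)) => [|k _].
      by rewrite -mulr_suml ind restrict_indicE /= mulrC.
    by rewrite restrict_indicE /= mulrC.
  exact: (ip_ae sS sD sS sD).
- rewrite (ipt_mesh_sum oO bE conf (fun k => elt_hess_sqt k Hu) (fun k => elt_hess_sqt k Hu)).
  + exact: (ipt_ae sP sG sP sG).
  + by move=> k i j x; exact: elt_hess_off.
  + by move=> k i j x; exact: elt_hess_off.
Qed.

Lemma tracenorm_le (A : pt -> 'M[R]_2) (eta : H2T Omega T -> R) :
  HdDiv Omega A -> gamma_dDiv A = eta -> tracenorm eta <= dDivnorm Omega A.
Proof.
move=> HA gA; apply: ge_inf; last by exists A.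
by exists 0 => _ [B _ <-]; rewrite /dDivnorm sqrtr_ge0.
Qed.

End mesh_norms.

(** * Vanishing traces and normal derivatives *)

Section traces.
Context {R : realType}.
Local Notation pt := (plane R).
Local Notation mu := (lebesgue2 R).
Variables (Omega : set pt) (E : seq (pt * pt)).
Hypothesis oO : open Omega.
Hypothesis bE : boundary_edges Omega E.
Implicit Types (v : pt -> R) (D : seq 'I_2 -> pt -> R).

Let mO : measurable Omega := open_measurable_plane oO.

Lemma test_function_edge phi e (t : R) : test_function Omega phi -> e \in E ->
  t \in `[0, 1] -> phi (seg_pt e t) = 0.
Proof.
move=> tp eE t01; apply: (test_function_off tp) => Ox.
have [bO _ _ _] := bE.
have : boundary Omega (seg_pt e t) by rewrite bO; exists e => //; exists t.
by move=> [_]; rewrite (proj1 (interior_id Omega)).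
Qed.

Lemma bnorm_test phi : test_function Omega phi -> bnorm E (phi \- (fun=> 0)) = 0.
Proof.
move=> tp; rewrite /bnorm big_seq big1 ?sqrtr0// => e eE.
rewrite (@eq_Rintegral _ _ _ _ _ (fun=> 0)).
  by rewrite Rintegral_cst// mul0r mulr0.
by move=> t /set_mem t01; rewrite /= (test_function_edge tp eE t01) subr0 expr0n.
Qed.

(** The approximants [pds t (phi k)] are themselves test functions and vanish on every edge, so the
    boundary norms are identically zero. [size t <= 1] leaves one derivative for H1 and covers both
    [v] and its gradient. *)
Lemma has_trace0 D v t : test_limit Omega D -> (size t <= 1)%N -> L2 Omega v ->
  {ae mu, forall x, Omega x -> v x = D t x} -> has_trace Omega E v (fun=> 0).
Proof.
move=> tD t1 sv vD; have [[phi [tp cp]] _ _] := tD.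
have t2 : (size t <= 2)%N by exact: leq_trans t1 _.
have OO : Omega `<=` Omega by [].
have cvg0 s u : (size s <= 2)%N -> L2 Omega u ->
    {ae mu, forall x, Omega x -> u x = D s x} ->
    (fun k => L2norm Omega (pds s (phi k) \- u)) @ \oo --> (0 : R).
  move=> s2 su uD; have [sF sD FD] := cp s s2.
  have Ek k : L2norm Omega (pds s (phi k) \- u) =
      Num.sqrt (ip mu (pds s (phi k) \- D s) (pds s (phi k) \- D s)).
    have rE : (pds s (phi k) \- u) \_ Omega = pds s (phi k) \- u \_ Omega.
      apply/funext => x; rewrite /= !patchE; case: ifPn => // /negP xO.
      rewrite (test_function_off (test_function_pds s (tp k))) ?subrr// => Ox.
      by apply: xO; rewrite inE.
    have sB : L2 Omega (pds s (phi k) \- u) by rewrite /L2 rE; exact: sqintB (sF k) su.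
    rewrite (L2normE sB) rE; congr Num.sqrt.
    have sk := sqintB (sF k) su; have sk' := sqintB (sF k) sD.
    by apply: (ip_ae sk sk' sk sk'); apply: ae_imp (ae_restrict_domain tD uD) _ => x /= ->.
  rewrite (funext Ek) -(sqrtr0 R).
  exact: (cvg_comp _ _ FD (@sqrt_continuous R 0)).
split.
- exact: (@sobolev_test_limit _ Omega D Omega v 1 t tD oO OO sv vD t1).
- move=> e eE; have -> : ((fun=> 0 : R) \o seg_pt e) \_ `[0, 1] = fun=> 0 :> R.
    by apply/funext => s; rewrite patchE; case: ifP.
  exact: sqint0.
- exists (fun k => pds t (phi k)); split.
  + by move=> k; exact: test_function_smooth (test_function_pds t (tp k)).
  + exact: cvg0.
  + move=> i.
    have [w1 w2] := @wpd_test_limit _ Omega D Omega v [:: i] t tD oO OO sv vD t1.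
    exact: (cvg0 (i :: t)).
  + rewrite (_ : (fun k => _) = fun=> 0); first exact: cvg_cst.
    by apply/funext => k; apply: bnorm_test; exact: test_function_pds.
Qed.

Lemma H20_test_limit D v : test_limit Omega D -> L2 Omega v ->
  {ae mu, forall x, Omega x -> v x = D [::] x} -> H20 Omega E v.
Proof.
move=> tD sv vD; have OO : Omega `<=` Omega by [].
split.
- exact: (@sobolev_test_limit _ Omega D Omega v 2 [::] tD oO OO sv vD).
- exact: (has_trace0 tD _ sv vD).
- exists (fun=> 0), (fun=> 0); split.
  + have [w1 w2] := @wpd_test_limit _ Omega D Omega v [:: 0] [::] tD oO OO sv vD isT.
    exact: (has_trace0 tD _ w2 w1).
  + have [w1 w2] := @wpd_test_limit _ Omega D Omega v [:: 1] [::] tD oO OO sv vD isT.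
    exact: (has_trace0 tD _ w2 w1).
  + by move=> e eE; apply: aeW => t _; rewrite /dot /= !mulr0 addr0.
Qed.

End traces.

(** * Superposition and the final estimates *)

Lemma weak_solutionB {R : realType} (Omega : set (plane R))
    (CC : plane R -> {linear 'M[R]_2 -> 'M[R]_2}) (f g : plane R -> R)
    (D D' : seq 'I_2 -> plane R -> R) :
  measurable Omega -> elasticity_tensor Omega CC ->
  L2 Omega f -> L2 Omega g ->
  weak_solution Omega CC (f \_ Omega) D -> weak_solution Omega CC (g \_ Omega) D' ->
  weak_solution Omega CC ((f \- g) \_ Omega) (fun s => D s \- D' s).
Proof.
move=> mO HE sf sg [tD HD] [tD' HD']; split; first exact: test_limitB.
move=> phi tp.
have -> : (f \- g) \_ Omega = f \_ Omega \- g \_ Omega.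
  by apply/funext => x; rewrite /= !patchE; case: ifP; rewrite ?subrr.
rewrite (ipBl sf sg (sqint_test tp)) -HD// -HD'//.
rewrite [hessD _](_ : _ = subt (hessD D) (hessD D'))// stressB.
apply: (iptBl _ _ (hessc_sqt tp)); apply: stress_sqint => //.
- exact: test_limit_sqt tD.
- exact: test_limit_symt tD.
- exact: test_limit_sqt tD'.
- exact: test_limit_symt tD'.
Qed.

Theorem theorem9 (R : realType) (Omega : set (plane R))
    (E : seq (plane R * plane R))
    (CC : plane R -> {linear 'M[R]_2 -> 'M[R]_2}) :
  lipschitz_polygon Omega E ->
  elasticity_tensor Omega CC ->
  exists C : R,
    forall (kappa : R) (N : nat) (T : 'I_N -> triangle R),
    conforming_mesh Omega T -> shape_regular kappa T ->
    (forall f : plane R -> R, L2 Omega f ->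
       exists (u : H2T Omega T) (eta : H2T Omega T -> R),
         hybrid_solution CC f u eta /\
         forall (u' : H2T Omega T) (eta' : H2T Omega T -> R),
           hybrid_solution CC f u' eta' ->
           eqae Omega (pwfun u') (pwfun u) /\ eta' = eta) /\
    (forall (f f' : plane R -> R) (u u' : H2T Omega T)
            (eta eta' : H2T Omega T -> R),
       L2 Omega f -> L2 Omega f' ->
       hybrid_solution CC f u eta -> hybrid_solution CC f' u' eta' ->
       H2Tnorm T (pwfun u \- pwfun u') + tracenorm (eta \- eta')
         <= C * L2norm Omega (f \- f')) /\
    (forall (f : plane R -> R) (u : H2T Omega T) (eta : H2T Omega T -> R),
       L2 Omega f -> hybrid_solution CC f u eta ->
       let M := apply_tensor CC (hess Omega (pwfun u)) in
       [/\ H2Tnorm T (pwfun u) + tracenorm eta <= C * L2norm Omega f,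
           H20 Omega E (pwfun u),
           eta = gamma_dDiv M &
           kirchhoff_love Omega E CC f (pwfun u) M]).
Proof.
move=> [[oO _] bO _ lO bE] HE.
have mO : measurable Omega := open_measurable_plane oO.
have [K K0 HK] := poincare_hess bO.
have [alpha a0 Ha] := stress_coercive mO HE.
have [beta b0 Hb] := stress_ipt_le mO HE.
pose q := K / alpha ^+ 2.
have q0 : 0 <= q by rewrite divr_ge0// sqr_ge0.
(* [q] bounds the squared Hessian norm relative to [f], and [K * q] that of the function. For the
   trace, [beta * q] bounds the moment tensor and 1 accounts for its div div, which is [f]. The
   constant is fixed before the mesh is introduced. *)
exists (Num.sqrt ((K + 1) * q) + Num.sqrt (beta * q + 1)) => kappa N T conf _.
have solve f : L2 Omega f -> exists D, weak_solution Omega CC (f \_ Omega) D.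
  by move=> sf; exact: (weak_solution_exists mO bO HE sf).
(* Stated for plain functions and a representing tensor, not for a hybrid solution, so that it
   applies to a solution and to the difference of two. *)
have bound f D (u : plane R -> R) (eta : H2T Omega T -> R) A : L2 Omega f ->
    weak_solution Omega CC (f \_ Omega) D -> L2 Omega u ->
    {ae lebesgue2 R, forall x, Omega x -> u x = D [::] x} ->
    HdDiv Omega A -> {ae lebesgue2 R, forall x, Omega x -> dDiv Omega A x = f x} ->
    ipt (rt Omega A) (rt Omega A) = ipt (stress Omega CC (hessD D)) (stress Omega CC (hessD D)) ->
    gamma_dDiv A = eta ->
    H2Tnorm T u + tracenorm eta <=
      (Num.sqrt ((K + 1) * q) + Num.sqrt (beta * q + 1)) * L2norm Omega f.
  move=> sf HD su uD HA dA rA gA; have [tD _] := HD.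
  have [sA _ _] := HA; have [sd _] := dDivP HA.
  have HK' D' : test_limit Omega D' ->
      ip (lebesgue2 R) (D' [::]) (D' [::]) <= K * ipt (hessD D') (hessD D').
    exact: poincare_limit HK.
  have xb := energy_bound mO HE K0 a0 Ha HK' sf HD.
  have pb := HK' D tD.
  have sb := Hb _ (test_limit_sqt tD) (test_limit_symt tD).
  have F0 := ip_ge0 (lebesgue2 R) (f \_ Omega).
  rewrite mulrDl; apply: lerD.
    rewrite (H2Tnorm_test_limit oO lO bE conf tD su uD) (L2normE sf) -sqrtrM; last first.
      by rewrite mulr_ge0// addr_ge0.
    apply: ler_wsqrtr; apply: le_trans (lerD pb (lexx _)) _.
    rewrite -mulrA mulrDl mul1r; apply: lerD; last exact: xb.
    exact: ler_wpM2l.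
  apply: le_trans (tracenorm_le HA gA) _.
  rewrite /dDivnorm (L2tnorm_sq sA) rA (L2norm_ae sd sf dA) (L2norm_sq sf) (L2normE sf).
  rewrite -sqrtrM; last by rewrite addr_ge0// mulr_ge0.
  apply: ler_wsqrtr; rewrite mulrDl mul1r lerD2r.
  by apply: le_trans sb _; rewrite -mulrA; exact: ler_wpM2l.
have moment f u (eta : H2T Omega T -> R) D : L2 Omega f -> hybrid_solution CC f u eta ->
    weak_solution Omega CC (f \_ Omega) D ->
    let A := apply_tensor CC (hess Omega (pwfun u)) in
    [/\ HdDiv Omega A, {ae lebesgue2 R, forall x, Omega x -> dDiv Omega A x = f x},
      ipt (rt Omega A) (rt Omega A) =
        ipt (stress Omega CC (hessD D)) (stress Omega CC (hessD D)) &
      gamma_dDiv A = eta].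
  move=> sf Hu HD A; have [tD _] := HD.
  have uD := hybrid_unique oO bO lO bE conf HE sf Hu HD.
  have [su _] := set_valP u.
  (* The Hessian is now the one chosen on the whole of [Omega]; it agrees almost everywhere with
     [hessD D]. *)
  pose M i j : plane R -> R := wpd Omega [:: i; j] (pwfun u) \_ Omega.
  have wM i j := @wpd_test_limit _ Omega D Omega (pwfun u) [:: i; j] [::] tD oO
    (fun x Ox => Ox) su uD isT.
  have AM x : Omega x -> A x = CC x (mx M x).
    move=> Ox; congr (CC x _); apply/matrixP => i j.
    by rewrite !mxE /M patchE mem_set.
  have sM : sqt M by move=> i j; have [] := wM i j.
  have symM : symt M by move=> i j; rewrite /M wpdC.
  have MD i j : {ae lebesgue2 R, forall x, M i j x = hessD D i j x}.
    by have [h _] := wM i j; exact: (ae_restrict_domain tD h).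
  have [HA dA rA gA] := moment_field oO lO conf HE sf HD AM sM symM MD.
  split => //; apply/funext => v; rewrite gA.
  by rewrite (hybrid_eta oO lO bE conf HE sf Hu HD).
split; [|split].
- move=> f sf; have [D HD] := solve f sf.
  have [u [eta Hu]] := hybrid_exists oO lO bE conf HE sf HD.
  exists u, eta; split => // u' eta' Hu'.
  have uD := hybrid_unique oO bO lO bE conf HE sf Hu HD.
  have u'D := hybrid_unique oO bO lO bE conf HE sf Hu' HD.
  split.
    by apply: ae_imp (ae_and uD u'D) _ => x [h h'] Ox; rewrite h// h'.
  apply/funext => v.
  by rewrite (hybrid_eta oO lO bE conf HE sf Hu HD) (hybrid_eta oO lO bE conf HE sf Hu' HD).
- move=> f f' u u' eta eta' sf sf' Hu Hu'.
  have [D HD] := solve f sf; have [D' HD'] := solve f' sf'.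
  have uD := hybrid_unique oO bO lO bE conf HE sf Hu HD.
  have u'D' := hybrid_unique oO bO lO bE conf HE sf' Hu' HD'.
  (* By linearity the difference of the weak solutions solves the problem with data [f - f'], and
     its moment tensor represents [eta - eta']. *)
  have HB := weak_solutionB mO HE sf sf' HD HD'.
  have resB (a b : plane R -> R) : (a \- b) \_ Omega = a \_ Omega \- b \_ Omega.
    by apply/funext => x; rewrite /= !patchE; case: ifP; rewrite ?subrr.
  have sB (a b : plane R -> R) : L2 Omega a -> L2 Omega b -> L2 Omega (a \- b).
    by move=> sa sb; rewrite /L2 resB; exact: sqintB.
  have [su _] := set_valP u; have [su' _] := set_valP u'.
  have [tB _] := HB; have [tD _] := HD; have [tD' _] := HD'.
  have sG := test_limit_sqt tB; have symG := test_limit_symt tB.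
  have aG i j : {ae lebesgue2 R, forall x, hessD (fun s => D s \- D' s) i j x =
      hessD (fun s => D s \- D' s) i j x} by apply: aeW.
  have [HA dA rA gA] := moment_field oO lO conf HE
    (A := fun x => CC x (mx (hessD (fun s => D s \- D' s)) x)) (sB _ _ sf sf') HB
    (fun x _ => erefl) sG symG aG.
  apply: (bound _ _ _ _ _ (sB _ _ sf sf') HB (sB _ _ su su') _ HA dA rA).
    by apply: ae_imp (ae_and uD u'D') _ => x [h h'] Ox; exact: (congr2 (fun a b => a - b) (h Ox) (h' Ox)).
  apply/funext => v; rewrite gA /=.
  rewrite (hybrid_eta oO lO bE conf HE sf Hu HD) (hybrid_eta oO lO bE conf HE sf' Hu' HD').
  have [sv _] := set_valP v; have sP := pw_hess_sqt (set_valP v).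
  rewrite resB (ipBl sf sf' sv).
  rewrite [hessD _](_ : _ = subt (hessD D) (hessD D'))// stressB.
  have sS := stress_sqint mO HE (test_limit_sqt tD) (test_limit_symt tD).
  have sS' := stress_sqint mO HE (test_limit_sqt tD') (test_limit_symt tD').
  by rewrite (iptBl sS sS' sP) !opprB addrACA [RHS]addrACA; congr (_ + _); rewrite addrC.
- move=> f u eta sf Hu M; have [D HD] := solve f sf; have [tD _] := HD.
  have uD := hybrid_unique oO bO lO bE conf HE sf Hu HD.
  have [su _] := set_valP u.
  have [HM dM rM gM] := moment f u eta D sf Hu HD.
  have [h1 h2 h3] := H20_test_limit oO bE tD su uD.
  split.
  + exact: (bound f D (pwfun u) eta M sf HD su uD HM dM rM gM).
  + by split.
  + by rewrite gM.
  + by split => //; apply: aeW.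
Qed.
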